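(* Let $p=7/8$ and consider the elephant random walk with two memory channels and memory parameter $p$. There exist an almost surely finite random variable $\Theta$ and a random sign $\Xi\in\{-1,1\}$ with $\mathbb{P}(\Xi=1)=\mathbb{P}(\Xi=-1)=1/2$ such that, almost surely, $\operatorname{sgn}(S_n)=\Xi$ for all sufficiently large $n$ and $$\frac{n^2}{S_n^2}-\frac{27}{64}\log n\longrightarrow\Theta.$$ Consequently, almost surely, $$\frac{S_n}{n}=\frac{\Xi}{\sqrt{\frac{27}{64}\log n+\Theta+o(1)}},\qquad\text{and in particular}\qquad \sqrt{\log n}\,\frac{S_n}{n}\longrightarrow\frac{8\sqrt3}{9}\,\Xi.$$ Moreover, almost surely, $$\frac{A_n}{n}-\frac23=\frac23\cdot\frac{1}{\log n+\frac{64}{27}\Theta+o(1)},\qquad\text{and in particular}\qquad \log n\left(\frac{A_n}{n}-\frac23\right)\longrightarrow\frac23.$$ Equivalently, almost surely, $$A_n=\frac{2n}{3}+\frac{2n}{3\log n}-\frac{128\,\Theta}{81}\cdot\frac{n}{(\log n)^2}+o\!\left(\frac{n}{(\log n)^2}\right).$$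
   Context: Model (elephant random walk with two memory channels, memory parameter $p\in(0,1)$): $S_0=0$; $X_1,X_2$ are independent random signs, each equal to $1$ or $-1$ with probability $1/2$. For $n\ge2$ choose, independently of the past and independently for different $n$, indices $U_{1,n+1},U_{2,n+1}$ i.i.d. uniform on $\{1,\ldots,n\}$ and signs $\sigma_{1,n+1},\sigma_{2,n+1}\in\{-1,1\}$, independent of each other and of the indices, with $\mathbb{P}(\sigma_{i,n+1}=1)=p$, $\mathbb{P}(\sigma_{i,n+1}=-1)=1-p$. Put $Y_{i,n+1}=\sigma_{i,n+1}X_{U_{i,n+1}}$ for $i=1,2$, and $X_{n+1}=\operatorname{sgn}(Y_{1,n+1}+Y_{2,n+1})$ with $\operatorname{sgn}(0)=0$. The position is $S_n=\sum_{j=1}^nX_j$ and $A_n=\sum_{j=1}^n\mathbf{1}_{\{X_j\ne0\}}$ is the number of nonzero steps up to time $n$. The $o(\cdot)$ terms are random and refer to pathwise limits as $n\to\infty$. *)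

(* Defs.v *)
From mathcomp Require Export all_boot all_order all_algebra.
From mathcomp Require Export all_classical all_reals all_analysis.
Export Order.TTheory GRing.Theory Num.Theory.
Export numFieldNormedType.Exports.

Set Implicit Arguments.
Unset Strict Implicit.
Unset Printing Implicit Defensive.

Local Open Scope classical_set_scope.
Local Open Scope ring_scope.

(* The product rule over the finite subfamilies; these are given by
   injections from 'I_k, so that the index type I can be arbitrary. *)
Definition mutually_independent {d : measure_display} {T : measurableType d}
    {R : realType} (P : probability T R) (I : Type) (F : I -> set_system T) :=
  forall (k : nat) (j : 'I_k -> I), injective j ->
  forall E : 'I_k -> set T, (forall i, F (j i) (E i)) ->
    P (\bigcap_i E i) = (\prod_(i < k) P (E i))%E.

Definition sigma_generated {d d' : measure_display} {T : measurableType d}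
    {S : measurableType d'} (Z : T -> S) : set_system T :=
  preimage_set_system setT Z measurable.

Section ElephantRandomWalk.
Context {d : measure_display} {T : measurableType d} {R : realType}.
Variable P : probability T R.

(* The sources of randomness: FirstStep i stands for X_1, X_2 and, since the
   two memory channels are only consulted from the third step on, Index i n and
   Sign i n stand for U_{i,n+3} and sigma_{i,n+3}, n = 0, 1, 2, .... *)
Inductive source :=
  | FirstStep of 'I_2
  | Index of 'I_2 & nat
  | Sign of 'I_2 & nat.

Definition source_events (X : nat -> {RV P >-> R})
    (U : 'I_2 -> nat -> {RV P >-> nat}) (sigma : 'I_2 -> nat -> {RV P >-> R})
    (s : source) : set_system T :=
  match s with
  | FirstStep i => sigma_generated (X i.+1)
  | Index i n => sigma_generated (U i n.+3)
  | Sign i n => sigma_generated (sigma i n.+3)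
  end.

(* X n is the n-th step (n >= 1); X 0, and U i n and sigma i n for n <= 2,
   are unconstrained and never used.  Num.sg 0 = 0. *)
Record two_channel_elephant (p : R) (X : nat -> {RV P >-> R})
    (U : 'I_2 -> nat -> {RV P >-> nat}) (sigma : 'I_2 -> nat -> {RV P >-> R}) :
    Prop := {
  memory_parameter : 0 < p < 1 ;
  first_steps : forall n, (1 <= n <= 2)%N ->
    P [set w | X n w = 1] = (2^-1)%:E /\ P [set w | X n w = -1] = (2^-1)%:E ;
  index_uniform : forall i n k, (2 <= n)%N -> (1 <= k <= n)%N ->
    P [set w | U i n.+1 w = k] = (n%:R^-1)%:E ;
  sign_law : forall i n, (2 <= n)%N ->
    P [set w | sigma i n.+1 w = 1] = p%:E /\
    P [set w | sigma i n.+1 w = -1] = (1 - p)%:E ;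
  independence : mutually_independent P (source_events X U sigma) ;
  next_step : forall n w, (2 <= n)%N ->
    X n.+1 w = Num.sg (\sum_(i < 2) sigma i n.+1 w * X (U i n.+1 w) w)
}.

Definition position (X : nat -> T -> R) (n : nat) (w : T) : R :=
  \sum_(1 <= j < n.+1) X j w.

Definition nonzero_steps (X : nat -> T -> R) (n : nat) (w : T) : R :=
  \sum_(1 <= j < n.+1) \1_[set v | X j v != 0] w.

End ElephantRandomWalk.

(* Main.v *)
Require Import Defs.
From mathcomp Require Import ring lra zify measurable_realfun.

(** The walk is followed through the density of nonzero steps a = A_n / n and the
    speed s = S_n / n.  With 2p - 1 = 3/4, one step added to a history with
    given a and s has mean (3/4) s (2 - a) and second moment
    2 a - (3/2) a^2 + (9/32) s^2, so that in the time scale log n and up to noise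

      s' = - (3/4) s (a - 2/3),    a' = a - (3/2) a^2 + (9/32) s^2.

    At p = 7/8 the linear part of the first equation vanishes at the equilibrium
    a = 2/3, s = 0.  The parabola a - 2/3 = (9/32) s^2 is exactly invariant:
    zeta = a - 2/3 - (9/32) s^2 satisfies zeta' = - (3/2) a zeta.  On the parabola
    s' = - (27/128) s^3, that is (1 / s^2)' = 27/64, which is the first order of
    the theorem; because the invariance is exact there is no log log n correction
    and 1 / s^2 - (27/64) log n converges.

    Randomness enters through three martingales: the rescaled position
    M_n = S_n / gain_n, where gain_n is the predictable product that makes it a
    martingale, and the accumulated noises of a and of zeta.  Each has its squared
    increments dominated by the decrements of a potential of order n^(-1/2), so a
    maximal inequality on the blocks from 16^j to 16^(j+1) and Borel-Cantelli give
    convergence at rate n^(-1/10), almost surely ([dominated_rate]).  The mean of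
    1 / a stays below 3, so a does not tend to 0, and the noise of a being small it
    is bounded below ([density_bounded_below]); then zeta decays like a power of
    n ([zeta_rate]).

    The limit M of M_n must not vanish, for otherwise S_n / n would be of a smaller
    order.  From a history with a bounded below, the conditional variance of the
    future of M is comparable with the potential, its fourth moment is of the order
    of the square, and the Paley-Zygmund inequality shows that M_n has left any
    much smaller neighbourhood of 0 with a probability bounded below
    ([anticoncentration]).  Since the event that M_n is tiny settles almost surely,
    this forces it to have a vanishing probability in the limit ([ae_rescaled_limit]).
    With M different from 0, 1 / s^2 = (n / gain_n)^2 / M_n^2, and the
    increments of (n / gain_n)^2 are (27/64) M^2 / n up to a summable error
    ([inverse_square_limit]).  The expansions of S_n and A_n follow by algebra of
    limits.  The sign of M is symmetric because the law of the walk is invariant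
    under a change of sign.

    All moments are computed on finite histories: the mean of a function of the
    first steps is obtained by iterating an explicit one-step operator, and
    [pr_hist] identifies it with the probability given by the sources of
    randomness. *)

Set Implicit Arguments.
Unset Strict Implicit.
Unset Printing Implicit Defensive.
Local Open Scope classical_set_scope.
Local Open Scope ring_scope.

(** * Histories and the one-step mean *)

Section Histories.
Context {R : realType}.
Implicit Types (h : seq R) (f g : seq R -> R) (x c : R) (k n : nat).

(** A history lists the past steps, the most recent one first. *)
Definition displ h : R := \sum_(x <- h) x.
Definition activity h : R := \sum_(x <- h) x ^+ 2.
Definition len h : R := (size h)%:R.
Definition speed h : R := displ h / len h.
Definition density h : R := activity h / len h.

Definition ternary x := [|| x == 1, x == 0 | x == -1].

(** The bound on the activity holds from the second step on, as the first two
    steps are nonzero; it keeps the density positive. *)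
Definition valid h := [&& (2 <= size h)%N, all ternary h & 2 <= activity h].

Lemma ternaryP x : ternary x -> [\/ x = 1, x = 0 | x = -1].
Proof.
by case/or3P=> /eqP ->; [exact: Or31|exact: Or32|exact: Or33].
Qed.

Lemma ternary1 : ternary 1. Proof. by rewrite /ternary eqxx. Qed.
Lemma ternary0 : ternary 0. Proof. by rewrite /ternary eqxx orbT. Qed.
Lemma ternaryN1 : ternary (-1). Proof. by rewrite /ternary eqxx !orbT. Qed.

Lemma displ_cons x h : displ (x :: h) = x + displ h.
Proof. by rewrite /displ big_cons. Qed.
Lemma activity_cons x h : activity (x :: h) = x ^+ 2 + activity h.
Proof. by rewrite /activity big_cons. Qed.
Lemma len_cons x h : len (x :: h) = len h + 1.
Proof. by rewrite /len /= -natr1. Qed.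

Lemma valid_cons x h : ternary x -> valid h -> valid (x :: h).
Proof.
move=> tx /and3P[sz al ac]; apply/and3P; split=> /=.
- exact: leqW.
- by rewrite tx.
- by rewrite activity_cons ler_wpDl// sqr_ge0.
Qed.

Lemma valid_len h : valid h -> 2 <= len h.
Proof. by case/and3P=> sz _ _; rewrite /len ler_nat. Qed.

Lemma valid_activity h : valid h -> 2 <= activity h.
Proof. by case/and3P. Qed.

Lemma activity_le_len h : all ternary h -> activity h <= len h.
Proof.
elim: h => [|x h IH] /=; first by rewrite /activity /len big_nil.
case/andP=> tx /IH; rewrite activity_cons len_cons => H.
by case: (ternaryP tx) => ->; lra.
Qed.

Lemma norm_displ_le h : all ternary h -> `|displ h| <= activity h.
Proof.
elim: h => [|x h IH] /=; first by rewrite /displ /activity !big_nil normr0.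
case/andP=> tx /IH; rewrite activity_cons displ_cons !ler_norml => /andP[H1 H2].
by case: (ternaryP tx) => ->; apply/andP; split; lra.
Qed.

Lemma density_bounds h : valid h ->
  [/\ 0 < density h, density h <= 1, - density h <= speed h & speed h <= density h].
Proof.
move=> vh; have L := valid_len vh; have A := valid_activity vh.
case/and3P: vh => _ al _.
have := activity_le_len al; have := norm_displ_le al; rewrite ler_norml => /andP[p1 p2] p3.
have L0 : 0 < len h by lra.
rewrite /density /speed; split.
- by rewrite divr_gt0//; lra.
- by rewrite ler_pdivrMr// mul1r.
- by rewrite -mulNr ler_pM2r// invr_gt0.
- by rewrite ler_pM2r// invr_gt0.
Qed.

Lemma speed_cons x h : valid h -> speed (x :: h) = speed h + (x - speed h) / (len h + 1).
Proof.
by move=> /valid_len L; rewrite /speed displ_cons len_cons; field; apply/andP; split; lra.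
Qed.

Lemma density_cons x h : valid h -> density (x :: h) = density h + (x ^+ 2 - density h) / (len h + 1).
Proof.
by move=> /valid_len L; rewrite /density activity_cons len_cons; field; apply/andP; split; lra.
Qed.

(** Mean of [g] at the value proposed by one memory channel: a uniformly chosen
    past step, reversed with probability 1/8. *)
Definition channel h (g : R -> R) : R :=
  (len h)^-1 * \sum_(v <- h) (7 / 8 * g v + 1 / 8 * g (- v)).

Definition step_mean f h : R :=
  channel h (fun y1 => channel h (fun y2 => f (Num.sg (y1 + y2) :: h))).

(** A past step takes three values only, so that the history matters through the
    frequencies of these values, that is, through the density and the speed. *)
Lemma channelE h (g : R -> R) : valid h ->
  channel h g = (density h + 3 / 4 * speed h) / 2 * g 1 + (1 - density h) * g 0
             + (density h - 3 / 4 * speed h) / 2 * g (-1).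
Proof.
move=> vh; have L := valid_len vh; case/and3P: vh => _ al _; rewrite /channel.
have -> : \sum_(v <- h) (7 / 8 * g v + 1 / 8 * g (- v)) =
   (activity h + 3 / 4 * displ h) / 2 * g 1 + (len h - activity h) * g 0
             + (activity h - 3 / 4 * displ h) / 2 * g (-1).
  elim: h al {L} => [|x h IH] /=.
    by rewrite /displ /activity /len !big_nil /=; lra.
  case/andP=> tx /IH; rewrite big_cons activity_cons displ_cons len_cons => ->.
  by case: (ternaryP tx) => ->; rewrite ?oppr0 ?opprK; lra.
by rewrite /density /speed; field; lra.
Qed.

(** The mean and, below, the second moment of the next step.  If y is the value
    proposed by a channel, it has mean (3/4) s and second moment a; for y and y'
    in {-1, 0, 1} the sign of y + y' is y + y' - (y y'^2 + y^2 y') / 2, and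
    its square is y^2 + y'^2 - (3/2) y^2 y'^2 + y y' / 2. *)
Definition mean_step h : R := 3 / 4 * speed h * (2 - density h).
Definition mean_step_sq h : R := 2 * density h - 3 / 2 * density h ^+ 2 + 9 / 32 * speed h ^+ 2.

Lemma step_meanE f h : valid h ->
  step_mean f h = (mean_step_sq h + mean_step h) / 2 * f (1 :: h) + (1 - mean_step_sq h) * f (0 :: h)
          + (mean_step_sq h - mean_step h) / 2 * f (-1 :: h).
Proof.
move=> vh; rewrite /step_mean !channelE//.
have -> : 1 + 1 = 2%:R :> R by [].
rewrite !addr0 !add0r subrr addNr -opprD.
rewrite !sgrN !sgr0 !sgr1 gtr0_sg ?ltr0n //.
rewrite /mean_step_sq /mean_step; lra.
Qed.

(** The three coefficients are the probabilities of the steps 1, 0 and -1, which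
    are sums of products of the channel frequencies. *)
Lemma step_mean_weights h : valid h ->
  [/\ 0 <= (mean_step_sq h + mean_step h) / 2, 0 <= 1 - mean_step_sq h &
    0 <= (mean_step_sq h - mean_step h) / 2].
Proof.
move=> vh; have [a0 a1 s1 s2] := density_bounds vh.
rewrite /mean_step_sq /mean_step; set a := density h in a0 a1 s1 s2 *; set s := speed h in s1 s2 *.
have Q1 : 0 <= (a + 3 / 4 * s) / 2 by lra.
have Q2 : 0 <= (a - 3 / 4 * s) / 2 by lra.
have Q0 : 0 <= 1 - a by lra.
split.
- have := mulr_ge0 Q1 Q1; have := mulr_ge0 Q1 Q0; lra.
- have := mulr_ge0 Q1 Q2; have := mulr_ge0 Q0 Q0; lra.
- have := mulr_ge0 Q2 Q2; have := mulr_ge0 Q2 Q0; lra.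
Qed.

Lemma le_step_mean f g h : valid h -> (forall x, ternary x -> f (x :: h) <= g (x :: h)) ->
  step_mean f h <= step_mean g h.
Proof.
move=> vh fg; rewrite !step_meanE//; have [w1 w2 w3] := step_mean_weights vh.
by rewrite !lerD// ler_wpM2l// fg// ?ternary1 ?ternary0 ?ternaryN1.
Qed.

Lemma eq_step_mean f g h : valid h -> (forall x, ternary x -> f (x :: h) = g (x :: h)) ->
  step_mean f h = step_mean g h.
Proof.
by move=> vh fg; apply/le_anti; rewrite !le_step_mean//= => x tx; rewrite fg.
Qed.

(** Any function of a step in {-1, 0, 1} is a quadratic polynomial in it, so this
    gives every conditional mean used below. *)
Lemma step_mean_quadratic f h al be ga : valid h ->
  (forall x, ternary x -> f (x :: h) = al + be * x + ga * x ^+ 2) ->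
  step_mean f h = al + be * mean_step h + ga * mean_step_sq h.
Proof.
move=> vh fE; rewrite step_meanE// !fE ?ternary1 ?ternary0 ?ternaryN1//; lra.
Qed.

Lemma step_mean_cst h c : valid h -> step_mean (fun=> c) h = c.
Proof. by move=> vh; rewrite step_meanE//; lra. Qed.

Lemma step_mean_linear f g h (u v : R) : valid h ->
  step_mean (fun h' => u * f h' + v * g h') h = u * step_mean f h + v * step_mean g h.
Proof. by move=> vh; rewrite !step_meanE//; lra. Qed.

Definition steps_mean k f := iter k step_mean f.

Lemma steps_meanS k f h : steps_mean k.+1 f h = step_mean (steps_mean k f) h.
Proof. by []. Qed.

Lemma steps_meanSr k f : steps_mean k.+1 f = steps_mean k (step_mean f).
Proof. by rewrite /steps_mean iterSr. Qed.

Lemma steps_meanD j k f : steps_mean (j + k) f = steps_mean j (steps_mean k f).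
Proof. by rewrite /steps_mean iterD. Qed.

(** Only the histories that extend [h] by [k] steps matter. *)
Lemma le_steps_mean k f g h : valid h ->
  (forall h', valid h' -> size h' = (size h + k)%N -> drop k h' = h -> f h' <= g h') ->
  steps_mean k f h <= steps_mean k g h.
Proof.
elim: k h => [|k IH] h vh fg; first by apply: fg; rewrite ?addn0 ?drop0.
rewrite !steps_meanS; apply: le_step_mean => // x tx; apply: IH; first exact: valid_cons.
move=> h' vh' sz dr; apply: fg => //; first by rewrite sz /= addSnnS.
by rewrite -addn1 addnC -drop_drop dr /= drop0.
Qed.

Lemma eq_steps_mean k f g h : valid h ->
  (forall h', valid h' -> size h' = (size h + k)%N -> drop k h' = h -> f h' = g h') ->
  steps_mean k f h = steps_mean k g h.
Proof.
by move=> vh fg; apply/le_anti; rewrite !le_steps_mean//= => h' *; rewrite fg.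
Qed.

Lemma steps_mean_cst k h c : valid h -> steps_mean k (fun=> c) h = c.
Proof.
elim: k h => // k IH h vh; rewrite steps_meanS.
rewrite (@eq_step_mean _ (fun=> c))// ?step_mean_cst// => x tx.
by apply: IH; exact: valid_cons.
Qed.

Lemma steps_mean_linear k f g h (u v : R) : valid h ->
  steps_mean k (fun h' => u * f h' + v * g h') h = u * steps_mean k f h + v * steps_mean k g h.
Proof.
elim: k h => // k IH h vh; rewrite !steps_meanS -step_mean_linear//; apply: eq_step_mean => // x tx.
by apply: IH; exact: valid_cons.
Qed.

Lemma steps_mean_supermartingale k f h :
  (forall h', valid h' -> step_mean f h' <= f h') -> valid h -> steps_mean k f h <= f h.
Proof.
move=> sm; elim: k h => // k IH h vh; rewrite steps_meanS.
apply: le_trans (sm _ vh); apply: le_step_mean => // x tx.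
by apply: IH; exact: valid_cons.
Qed.

Lemma steps_mean_submartingale k f h :
  (forall h', valid h' -> f h' <= step_mean f h') -> valid h -> f h <= steps_mean k f h.
Proof.
move=> sm; elim: k h => // k IH h vh; rewrite steps_meanS.
apply: (le_trans (sm _ vh)); apply: le_step_mean => // x tx.
by apply: IH; exact: valid_cons.
Qed.

End Histories.

(** * Martingales whose increments are paid for by a potential *)

Section Martingales.
Context {R : realType}.
Implicit Types (h : seq R) (f g Q Phi : seq R -> R) (x c : R) (k n : nat).

Lemma mean_step_bounds h : valid h ->
  [/\ `|mean_step h| <= 1, 0 <= mean_step_sq h & mean_step_sq h <= 1].
Proof.
move=> vh; have [w1 w2 w3] := step_mean_weights vh; split; try lra.
by rewrite ler_norml; apply/andP; split; lra.
Qed.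

(** The potential pays for the square increments, so that its value at a history
    bounds the conditional variance of the whole future of the martingale.  The
    last clause says that it is of order n^(-1/2); its constant is the one
    obtained for the rescaled displacement. *)
Definition dominated Q Phi :=
  [/\ forall h, valid h -> step_mean Q h = Q h,
      forall h x, valid h -> ternary x -> (Q (x :: h) - Q h) ^+ 2 <= Phi h - Phi (x :: h),
      forall h, valid h -> 0 <= Phi h
    & forall h, valid h -> Phi h ^+ 2 * len h <= 512].

Lemma square_supermartingale Q Phi c h : dominated Q Phi -> valid h ->
  step_mean (fun h' => (Q h' - c) ^+ 2 + Phi h') h <= (Q h - c) ^+ 2 + Phi h.
Proof.
case=> mQ dQ _ _ vh.
apply: (@le_trans _ _ (step_mean (fun h' => ((Q h - c) ^+ 2 + Phi h - 2 * (Q h - c) * Q h) * 1 +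
   (2 * (Q h - c)) * Q h') h)).
  apply: le_step_mean => // x tx; have := dQ h x vh tx.
  set q := Q h; set q' := Q (x :: h); set p := Phi h; set p' := Phi (x :: h).
  by move=> H; nra.
rewrite (@step_mean_linear _ (fun=> 1))// step_mean_cst// mQ//; lra.
Qed.

Definition hit (b : pred (seq R)) k h' := has (fun j => b (drop j h')) (iota 0 k.+1).

Lemma hitS b k h' : hit b k.+1 h' = hit b k h' || b (drop k.+1 h').
Proof. by rewrite /hit -(addn1 k.+1) (iotaD 0 k.+1 1) has_cat add0n has_seq1. Qed.

(** Kolmogorov's inequality.  The probability of an exceedance solves a recursion
    in the number of steps, equal to 1 where the threshold is passed, and the
    right-hand side is a supermartingale which is at least 1 there. *)
Lemma maximal_inequality Q Phi c t k h : dominated Q Phi -> valid h -> 0 < t ->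
  steps_mean k (fun h' => (hit (fun h' => t <= `|Q h' - c|) k h')%:R) h
    <= ((Q h - c) ^+ 2 + Phi h) / t ^+ 2.
Proof.
move=> D vh t0; set b := fun h' => t <= `|Q h' - c|.
have t20 : 0 < t ^+ 2 by rewrite exprn_gt0.
have hitb h' : valid h' -> b h' -> 1 <= ((Q h' - c) ^+ 2 + Phi h') / t ^+ 2.
  move=> vh' bh'; rewrite ler_pdivlMr// mul1r.
  have [_ _ P _] := D; apply: (@le_trans _ _ ((Q h' - c) ^+ 2)); last by rewrite lerDl P.
  by rewrite -(real_normK (num_real (Q h' - c))) ler_sqr ?nnegrE// ltW.
have nneg h' : valid h' -> 0 <= ((Q h' - c) ^+ 2 + Phi h') / t ^+ 2.
  by move=> vh'; have [_ _ P _] := D; rewrite divr_ge0 ?addr_ge0 ?sqr_ge0 ?P.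
elim: k h vh => [|k IH] h vh.
  rewrite /= /hit /= drop0 orbF.
  by case: (boolP (b h)) => bh; [exact: hitb|exact: nneg].
case: (boolP (b h)) => bh.
  apply: le_trans (hitb _ vh bh).
  rewrite -[leRHS](@steps_mean_cst _ k.+1 h 1 vh); apply: le_steps_mean => // h' *.
  by case: hit; rewrite ?ler01.
rewrite steps_meanS.
apply: (@le_trans _ _ (step_mean (fun h' => (t ^+ 2)^-1 * ((Q h' - c) ^+ 2 + Phi h') + 0 * 0) h)).
  apply: le_step_mean => // x tx; have vxh := valid_cons tx vh.
  rewrite mulr0 addr0 mulrC; apply: le_trans (IH _ vxh).
  apply: le_steps_mean => // h' vh' sz dr; rewrite hitS.
  have -> : drop k.+1 h' = h by rewrite -addn1 addnC -drop_drop dr /= drop0.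
  by rewrite (negbTE bh) orbF.
rewrite (@step_mean_linear _ _ (fun=> 0))// mul0r addr0 mulrC ler_pM2r ?invr_gt0//.
exact: square_supermartingale.
Qed.

(** The mean position after a step is [growth] times the position, which the
    product [gain] of these factors compensates. *)
Definition growth h : R := 1 + 3 / 4 * (2 - density h) / len h.

Fixpoint gain h : R := if h is _ :: h' then
  (if (2 <= size h')%N then gain h' * growth h' else 1) else 1.

Lemma gain_cons x h : valid h -> gain (x :: h) = gain h * growth h.
Proof. by case/and3P=> /= ->. Qed.

Lemma density_le1 h : (2 <= size h)%N -> all ternary h -> density h <= 1.
Proof.
move=> sz al; have := activity_le_len al.
have L : 0 < len h by rewrite ltr0n (leq_trans _ sz).
by rewrite /density ler_pdivrMr// mul1r.
Qed.

Lemma density_ge0 h : 0 <= density h.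
Proof. by rewrite divr_ge0 ?ler0n// sumr_ge0// => i _; rewrite sqr_ge0. Qed.

Lemma growth_bounds h : (2 <= size h)%N -> all ternary h ->
  1 + 3 / 4 / len h <= growth h /\ growth h <= 1 + 3 / 2 / len h.
Proof.
move=> sz al; have a1 := density_le1 sz al; have a0 := density_ge0 h.
have L : 0 < (len h)^-1 by rewrite invr_gt0 ltr0n (leq_trans _ sz).
rewrite /growth !lerD2l; split; rewrite ler_pM2r//; lra.
Qed.

(** As the density is at most 1, [growth] lies between 1 + (3/4) / n and
    1 + (3/2) / n whatever the history, so the gain is at least of order n^(3/4),
    with the exponent made integral by a fourth power, and at most of order n^2. *)
Lemma gain_bounds h : (2 <= size h)%N -> all ternary h ->
  [/\ 0 < gain h, len h ^+ 3 <= 8 * gain h ^+ 4 & 6 * gain h <= len h * (len h + 1)].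
Proof.
elim: h => // x h IH sz /= /andP[tx al].
case: ltnP => [sz2|]; last first.
  move: sz => /=; rewrite ltnS => s1 s2; have -> : len (x :: h) = 2.
    by rewrite /len /=; congr (_%:R); lia.
  by split; lra.
have [g0 g1 g2] := IH sz2 al; have [r1 r2] := growth_bounds sz2 al.
have L : 2 <= len h by rewrite /len ler_nat.
have rE : 1 + 3 / 4 / len h = (len h + 3 / 4) / len h by field; lra.
have rE2 : 1 + 3 / 2 / len h = (len h + 3 / 2) / len h by field; lra.
rewrite rE in r1; rewrite rE2 in r2; rewrite len_cons.
move: (len h) (gain h) (growth h) L g0 g1 g2 r1 r2 => l g r L g0 g1 g2 r1 r2.
have l0 : 0 < l by lra.
have r0 : 0 < r by apply: lt_le_trans r1; rewrite divr_gt0//; lra.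
rewrite ler_pdivrMr// in r1; rewrite ler_pdivlMr// in r2.
split; first by rewrite mulr_gt0.
- have H4 : (l + 3 / 4) ^+ 4 <= (r * l) ^+ 4.
    by rewrite lerXn2r ?nnegrE//; [lra|rewrite mulr_ge0// ltW].
  have H3 : l * (l + 1) ^+ 3 <= (l + 3 / 4) ^+ 4.
    rewrite -subr_ge0.
    have -> : (l + 3 / 4) ^+ 4 - l * (l + 1) ^+ 3 = 3 / 8 * l ^+ 2 + 11 / 16 * l + 81 / 256
      by field.
    by rewrite !addr_ge0// ?mulr_ge0 ?sqr_ge0//; lra.
  have l40 : 0 < l ^+ 4 by rewrite exprn_gt0.
  rewrite -(ler_pM2l l40).
  have -> : l ^+ 4 * (8 * (g * r) ^+ 4) = (8 * g ^+ 4) * (r * l) ^+ 4 by ring.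
  apply: le_trans (ler_pM _ _ g1 H4); rewrite ?exprn_ge0//; [|lra..].
  have -> : l ^+ 4 * (l + 1) ^+ 3 = l ^+ 3 * (l * (l + 1) ^+ 3) by ring.
  by rewrite ler_pM2l// exprn_gt0.
- rewrite -(ler_pM2l l0).
  have -> : l * (6 * (g * r)) = (6 * g) * (r * l) by ring.
  have -> : l * ((l + 1) * (l + 1 + 1)) = (l * (l + 1)) * (l + 2) by ring.
  apply: ler_pM => //; rewrite ?mulr_ge0//; lra.
Qed.

Lemma gain_gt0 h : valid h -> 0 < gain h.
Proof. by case/and3P=> sz al _; have [] := gain_bounds sz al. Qed.

Lemma growth_gt1 h : valid h -> 1 < growth h.
Proof.
move=> vh; have L := valid_len vh; case/and3P: vh => sz al _.
have [r1 _] := growth_bounds sz al; apply: lt_le_trans r1.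
by rewrite ltrDl divr_gt0//; lra.
Qed.

Definition rescaled h : R := displ h / gain h.
Definition potential h : R := 8 * len h / gain h ^+ 2.

Lemma rescaled_cons x h : valid h ->
  rescaled (x :: h) = rescaled h + (x - mean_step h) / (gain h * growth h).
Proof.
move=> vh; have L := valid_len vh; have g0 := gain_gt0 vh; have r1 := growth_gt1 vh.
rewrite /rescaled gain_cons// displ_cons.
have rE : growth h * len h = len h + 3 / 4 * (2 - density h).
  by rewrite /growth; field; lra.
have mE : mean_step h * len h = (3 / 4 * (2 - density h)) * displ h.
  by rewrite /mean_step /speed; field; lra.
have E : mean_step h = (growth h - 1) * displ h.
  apply: (@mulIf _ (len h)); first by lra.
  rewrite mE; have -> : 3 / 4 * (2 - density h) = growth h * len h - len h by lra.
  by ring.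
by rewrite E; field; apply/andP; split; lra.
Qed.

Lemma rescaled_increment_mean h : valid h -> step_mean (fun h' => rescaled h' - rescaled h) h = 0.
Proof.
move=> vh; rewrite (@step_mean_quadratic _ _ _ (- mean_step h / (gain h * growth h))
   (gain h * growth h)^-1 0)//; first by rewrite mulrC; ring.
by move=> x tx; rewrite rescaled_cons//; ring.
Qed.

Lemma rescaled_martingale h : valid h -> step_mean rescaled h = rescaled h.
Proof.
move=> vh; have := rescaled_increment_mean vh.
rewrite (@eq_step_mean _ (fun h' => rescaled h' - rescaled h)
  (fun h' => 1 * rescaled h' + (- rescaled h) * 1))//.
  by rewrite (@step_mean_linear _ _ (fun=> 1))// step_mean_cst//; lra.
by move=> x _; ring.
Qed.

(** At each step n is multiplied by 1 + 1 / n and gain^2 by at least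
    1 + (3/2) / n, so n / gain^2 decreases; the decrement is of the order of
    1 / gain^2, the size of the squared increment of the rescaled displacement. *)
Lemma potential_drop x h : valid h ->
  4 / (gain h * growth h) ^+ 2 <= potential h - potential (x :: h).
Proof.
move=> vh; have L := valid_len vh; have g0 := gain_gt0 vh; have r1 := growth_gt1 vh.
rewrite /potential gain_cons// len_cons.
have G0 : 0 < (gain h * growth h) ^+ 2 by rewrite exprn_gt0// mulr_gt0//; lra.
have -> : 8 * len h / gain h ^+ 2 = 8 * len h * growth h ^+ 2 / (gain h * growth h) ^+ 2.
  by field; apply/andP; split; lra.
rewrite -mulrBl ler_pM2r ?invr_gt0//.
case/and3P: vh => sz al _; have [r _] := growth_bounds sz al.
have : 1 + 3 / 2 / len h <= growth h ^+ 2.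
  apply: le_trans (_ : (1 + 3 / 4 / len h) ^+ 2 <= _).
    have : 0 < (len h)^-1 by rewrite invr_gt0; lra.
    by move: (len h)^-1 => i i0; nra.
  rewrite lerXn2r// ?nnegrE; last by lra.
  by rewrite addr_ge0// divr_ge0//; lra.
move=> H; have L0 : 0 < len h by lra.
have := ler_wpM2l (ltW L0) H.
have -> : len h * (1 + 3 / 2 / len h) = len h + 3 / 2 by field; lra.
by move=> H'; lra.
Qed.

Lemma step_dev x h : valid h -> ternary x -> (x - mean_step h) ^+ 2 <= 4.
Proof.
move=> vh tx; have [] := mean_step_bounds vh; rewrite ler_norml => /andP[m1 m2] _ _.
by case: (ternaryP tx) => ->; nra.
Qed.

Lemma rescaled_increment_sq x h : valid h -> ternary x ->
  (rescaled (x :: h) - rescaled h) ^+ 2 <= potential h - potential (x :: h).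
Proof.
move=> vh tx; apply: le_trans (potential_drop x vh).
have g0 := gain_gt0 vh; have r1 := growth_gt1 vh.
rewrite rescaled_cons// addrC addKr expr_div_n ler_pM2r ?step_dev//.
by rewrite invr_gt0 exprn_gt0// mulr_gt0//; lra.
Qed.

Lemma potential_ge0 h : valid h -> 0 <= potential h.
Proof.
move=> vh; rewrite /potential divr_ge0 ?sqr_ge0// mulr_ge0// /len ler0n//.
Qed.

Lemma rescaled_dominated : dominated rescaled potential.
Proof.
split; [exact: rescaled_martingale|by move=> *; exact: rescaled_increment_sq|exact: potential_ge0|].
move=> h vh; have g0 := gain_gt0 vh; have L := valid_len vh.
case/and3P: vh => sz al _; have [_ g1 _] := gain_bounds sz al.
have -> : potential h ^+ 2 * len h = 64 * len h ^+ 3 / gain h ^+ 4.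
  by rewrite /potential; field; lra.
by rewrite ler_pdivrMr ?exprn_gt0//; lra.
Qed.

Fixpoint noise_sum (phi : R -> seq R -> R) h : R := if h is x :: h' then
  noise_sum phi h' + (if (2 <= size h')%N then phi x h' else 0) else 0.

Lemma noise_sum_cons phi x h : valid h -> noise_sum phi (x :: h) = noise_sum phi h + phi x h.
Proof. by case/and3P=> /= ->. Qed.

Definition noise_act x h : R := (x ^+ 2 - mean_step_sq h) / (len h + 1).
(** The noise of a - (9/32) s^2 in one step, to first order in 1 / n. *)
Definition noise_z x h : R :=
  (x ^+ 2 - mean_step_sq h - 9 / 16 * speed h * (x - mean_step h)) / (len h + 1).

(** Increments of order 1 / n are paid for by a potential of order 1 / n, because
    1 / n - 1 / (n + 1) is at least (1 / (n + 1))^2. *)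
Lemma noise_sum_dominated phi (al be ga : seq R -> R) :
  (forall x h, valid h -> phi x h = (al h + be h * x + ga h * x ^+ 2) / (len h + 1)) ->
  (forall h, valid h -> al h + be h * mean_step h + ga h * mean_step_sq h = 0) ->
  (forall x h, valid h -> ternary x -> (al h + be h * x + ga h * x ^+ 2) ^+ 2 <= 5) ->
  dominated (noise_sum phi) (fun h => 5 / len h).
Proof.
move=> phiE m0 bd; split.
- move=> h vh; have L := valid_len vh.
  rewrite (@step_mean_quadratic _ _ _ (noise_sum phi h + al h / (len h + 1))
     (be h / (len h + 1)) (ga h / (len h + 1)))//.
    rewrite -[RHS]addr0 -[X in _ = _ + X](mul0r (len h + 1)^-1) -(m0 _ vh).
    by ring.
  by move=> x tx; rewrite noise_sum_cons// phiE//; ring.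
- move=> h x vh tx; have L := valid_len vh.
  rewrite noise_sum_cons// addrC addKr phiE// expr_div_n len_cons.
  have -> : 5 / len h - 5 / (len h + 1) = 5 / (len h * (len h + 1)).
    by field; apply/andP; split; lra.
  apply: ler_pM; rewrite ?sqr_ge0 ?invr_ge0 ?sqr_ge0 ?bd//.
  by rewrite lef_pV2 ?posrE ?mulr_gt0 ?exprn_gt0//; try lra; rewrite expr2 ler_pM2r; lra.
- by move=> h vh; have L := valid_len vh; rewrite divr_ge0//; lra.
- move=> h vh; have L := valid_len vh.
  have -> : (5 / len h) ^+ 2 * len h = 25 / len h by field; lra.
  by rewrite ler_pdivrMr; lra.
Qed.

Lemma noise_act_dominated : dominated (noise_sum noise_act) (fun h => 5 / len h).
Proof.
apply: (@noise_sum_dominated _ (fun h => - mean_step_sq h) (fun=> 0) (fun=> 1)).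
- by move=> x h _; rewrite /noise_act; congr (_ / _); ring.
- by move=> h _; ring.
- move=> x h vh tx; have [_ m1 m2] := mean_step_bounds vh.
  by case: (ternaryP tx) => ->; nra.
Qed.

Lemma noise_z_dominated : dominated (noise_sum noise_z) (fun h => 5 / len h).
Proof.
apply: (@noise_sum_dominated _ (fun h => - mean_step_sq h + 9 / 16 * speed h * mean_step h)
   (fun h => - (9 / 16 * speed h)) (fun=> 1)).
- by move=> x h _; rewrite /noise_z; congr (_ / _); ring.
- by move=> h _; ring.
- move=> x h vh tx; have [] := mean_step_bounds vh; rewrite ler_norml => /andP[m1 m2] m3 m4.
  have [a0 a1 s1 s2] := density_bounds vh.
  have sm : `|speed h * (x - mean_step h)| <= 2.
    rewrite normrM -[2]mul1r ler_pM// ler_norml; [by apply/andP; split; lra|].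
    by case: (ternaryP tx) => ->; apply/andP; split; lra.
  move: sm; rewrite ler_norml => /andP[sm1 sm2].
  have -> : - mean_step_sq h + 9 / 16 * speed h * mean_step h + - (9 / 16 * speed h) * x + 1 * x ^+ 2 =
     x ^+ 2 - mean_step_sq h - 9 / 16 * (speed h * (x - mean_step h)) by ring.
  have x2 : 0 <= x ^+ 2 <= 1 by case: (ternaryP tx) => ->; apply/andP; split; lra.
  case/andP: x2 => x20 x21.
  set u := _ - _; have u1 : - (17 / 8) <= u by rewrite /u; lra.
  have u2 : u <= 17 / 8 by rewrite /u; lra.
  by nra.
Qed.

End Martingales.

(** * Second and fourth moments of the rescaled displacement *)

Section AntiConcentration.
Context {R : realType}.
Implicit Types (h : seq R) (f g Q Phi : seq R -> R) (x c : R) (k n : nat).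

(** The corrections 8 N^2 Phi + 4 Phi^2 to N^4 absorb the terms of second and
    higher order in the expansion of (N + D)^4 when D^2 is at most the
    decrement of Phi. *)
Definition quartic c h : R :=
  (rescaled h - c) ^+ 4 + 8 * (rescaled h - c) ^+ 2 * potential h + 4 * potential h ^+ 2.

(** The potential after the step does not depend on that step, so the terms
    linear in the increment have mean zero; what remains is a sum of
    nonnegative terms. *)
Lemma quartic_supermartingale c h : valid h -> step_mean (quartic c) h <= quartic c h.
Proof.
move=> vh; set Psi := quartic c.
pose q := 8 * (len h + 1) / (gain h * growth h) ^+ 2.
have qE x : potential (x :: h) = q by rewrite /potential len_cons gain_cons.
pose N := rescaled h - c.
apply: (@le_trans _ _ (step_mean (fun h' => (Psi h - (4 * N ^+ 3 + 16 * N * q) * rescaled h) * 1 +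
   (4 * N ^+ 3 + 16 * N * q) * rescaled h') h)).
  apply: le_step_mean => // x tx; have := rescaled_increment_sq vh tx.
  have vxh := valid_cons tx vh; have := potential_ge0 vxh.
  have -> : Psi h = N ^+ 4 + 8 * N ^+ 2 * potential h + 4 * potential h ^+ 2 by [].
  rewrite /Psi /quartic qE.
  have -> : rescaled (x :: h) - c = N + (rescaled (x :: h) - rescaled h) by rewrite /N; ring.
  have -> : (4 * N ^+ 3 + 16 * N * q) * rescaled (x :: h) =
    (4 * N ^+ 3 + 16 * N * q) * (rescaled h + (rescaled (x :: h) - rescaled h)) by ring.
  move: (rescaled (x :: h) - rescaled h) => D; move: (potential h) (rescaled h) => p m q0.
  set d := p - q => Dd; have -> : p = q + d by rewrite /d; lra.
  rewrite -subr_ge0.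
  have -> : ((N ^+ 4 + 8 * N ^+ 2 * (q + d) + 4 * (q + d) ^+ 2) -
     (4 * N ^+ 3 + 16 * N * q) * m) * 1 + (4 * N ^+ 3 + 16 * N * q) * (m + D) -
     ((N + D) ^+ 4 + 8 * (N + D) ^+ 2 * q + 4 * q ^+ 2) =
     8 * q * (d - D ^+ 2) + (8 * N ^+ 2 + 3 * (d + D ^+ 2)) * (d - D ^+ 2) + d ^+ 2
     + 2 * D ^+ 2 * (N - D) ^+ 2 by ring.
  have d0 : 0 <= d - D ^+ 2 by lra.
  have D20 := sqr_ge0 D.
  have N20 := sqr_ge0 N.
  have d20 : 0 <= d by lra.
  move: (d - D ^+ 2) (N - D) d0 => e f e0.
  apply: addr_ge0; first apply: addr_ge0; first apply: addr_ge0.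
  - by rewrite mulr_ge0// mulr_ge0.
  - by apply: mulr_ge0 => //; lra.
  - exact: sqr_ge0.
  - by rewrite mulr_ge0 ?sqr_ge0// mulr_ge0.
rewrite (@step_mean_linear _ (fun=> 1) rescaled)// step_mean_cst// rescaled_martingale//; lra.
Qed.

Lemma fourth_moment k h : valid h ->
  steps_mean k (fun h' => rescaled h' ^+ 4) h <= 32 * (rescaled h ^+ 2 + potential h) ^+ 2.
Proof.
move=> vh; pose c := rescaled h.
pose Psi := quartic c.
apply: (@le_trans _ _ (steps_mean k (fun h' => 8 * Psi h' + (8 * c ^+ 4) * 1) h)).
  apply: le_steps_mean => // h' vh' _ _; have p0 := potential_ge0 vh'; rewrite /Psi /quartic.
  have -> : rescaled h' = (rescaled h' - c) + c by ring.
  move: (rescaled h' - c) => N; rewrite addrK.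
  rewrite -subr_ge0.
  have -> : 8 * (N ^+ 4 + 8 * N ^+ 2 * potential h' + 4 * potential h' ^+ 2) 
    + 8 * c ^+ 4 * 1 - (N + c) ^+ 4
    = ((N - c) ^+ 4 + 6 * (N ^+ 2 - c ^+ 2) ^+ 2)
      + 64 * N ^+ 2 * potential h' + 32 * potential h' ^+ 2 by ring.
  have := sqr_ge0 ((N - c) ^+ 2); rewrite -exprM => H.
  apply: addr_ge0; first apply: addr_ge0; first apply: addr_ge0 => //.
  - by rewrite mulr_ge0 ?sqr_ge0.
  - by rewrite mulr_ge0// mulr_ge0 ?sqr_ge0.
  - by rewrite mulr_ge0 ?sqr_ge0.
rewrite (@steps_mean_linear _ k Psi (fun=> 1))// steps_mean_cst//.
have := @steps_mean_supermartingale _ k Psi h (fun h' => @quartic_supermartingale c h') vh.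
rewrite [in X in _ <= X -> _]/Psi /quartic -/c subrr => H.
have c2 := sqr_ge0 c; have p0 := potential_ge0 vh.
have := mulr_ge0 c2 p0; rewrite -/c; have := sqr_ge0 (c ^+ 2); nra.
Qed.

(** As a function of s^2 the variance is decreasing, hence smallest at s^2 = a^2,
    where it is a times a cubic polynomial in a that is at least 7/32 on [0, 1]. *)
Lemma variance_ge h : valid h -> 7 / 32 * density h <= mean_step_sq h - mean_step h ^+ 2.
Proof.
move=> vh; have [a0 a1 s1 s2] := density_bounds vh; rewrite /mean_step_sq /mean_step.
move: (density h) (speed h) a0 a1 s1 s2 => a s a0 a1 s1 s2.
have S : 0 <= a ^+ 2 - s ^+ 2.
  have -> : a ^+ 2 - s ^+ 2 = (a - s) * (a + s) by ring.
  by rewrite mulr_ge0//; lra.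
rewrite -subr_ge0.
have -> : 2 * a - 3 / 2 * a ^+ 2 + 9 / 32 * s ^+ 2 - (3 / 4 * s * (2 - a)) ^+ 2 - 7 / 32 * a =
  9 / 32 * (2 * (2 - a) ^+ 2 - 1) * (a ^+ 2 - s ^+ 2) +
  a * (1 - a) * (57 / 32 - 54 / 32 * a + 18 / 32 * a ^+ 2) by field.
apply: addr_ge0; apply: mulr_ge0 => //.
- by apply: mulr_ge0; [lra|]; nra.
- by apply: mulr_ge0; lra.
- by have := sqr_ge0 a; lra.
Qed.

Lemma step_mean_rescaled_sq h : valid h -> step_mean (fun h' => rescaled h' ^+ 2) h =
  rescaled h ^+ 2 + (mean_step_sq h - mean_step h ^+ 2) / (gain h * growth h) ^+ 2.
Proof.
move=> vh; have g0 := gain_gt0 vh; have r1 := growth_gt1 vh.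
pose G := gain h * growth h.
rewrite (@step_mean_quadratic _ _ _ ((rescaled h - mean_step h / G) ^+ 2)
  (2 * (rescaled h - mean_step h / G) / G) (G^-1 ^+ 2))//; last first.
  by move=> x tx; rewrite rescaled_cons// -/G; ring.
by rewrite -/G -exprVn; ring.
Qed.

Lemma step_mean_rescaled_sq_ge h : valid h ->
  rescaled h ^+ 2 <= step_mean (fun h' => rescaled h' ^+ 2) h.
Proof.
move=> vh; rewrite step_mean_rescaled_sq// lerDl.
have := variance_ge vh; have [a0 _ _ _] := density_bounds vh.
by move=> v; rewrite divr_ge0 ?sqr_ge0//; lra.
Qed.

(** While the length goes from [l] to at most 2 [l] the activity does not decrease
    and the gain is at most multiplied by 4, so every conditional variance is at
    least of the order of activity / (l gain^2). *)
Lemma second_moment_doubling (A0 G0 l : R) j h : valid h ->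
    2 <= l -> 0 < G0 -> 0 < A0 -> A0 <= activity h ->
    gain h * (l * (l + 1)) <= G0 * (len h * (len h + 1)) ->
    len h + j%:R <= 2 * l ->
  rescaled h ^+ 2 + j%:R * (7 / 32 * (A0 / (2 * l)) / (4 * G0) ^+ 2)
   <= steps_mean j (fun h' => rescaled h' ^+ 2) h.
Proof.
move=> + l2 G00 A00; elim: j h => [|j IH] h vh hA hG hl.
  by rewrite mul0r addr0.
have L := valid_len vh; have g0 := gain_gt0 vh; have r1 := growth_gt1 vh.
rewrite -natr1 in hl *; have j0 : 0 <= j%:R :> R by [].
set v0 := 7 / 32 * _ / _; rewrite steps_meanS.
have : step_mean (fun h' => 1 * rescaled h' ^+ 2 + (j%:R * v0) * 1) h <=
       step_mean (steps_mean j (fun h' => rescaled h' ^+ 2)) h.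
  apply: le_step_mean => // x tx; rewrite mul1r mulr1; apply: IH.
  - exact: valid_cons.
  - by rewrite activity_cons ler_wpDl ?sqr_ge0.
  - rewrite gain_cons// len_cons.
    have rE : growth h * len h <= len h + 2.
      have [a0 _ _ _] := density_bounds vh.
      have -> : growth h * len h = len h + 3 / 4 * (2 - density h) by rewrite /growth; field; lra.
      by lra.
    have lp : 0 < len h by lra.
    rewrite -(ler_pM2l lp).
    have -> : len h * (gain h * growth h * (l * (l + 1))) =
      (gain h * (l * (l + 1))) * (growth h * len h) by ring.
    have -> : len h * (G0 * ((len h + 1) * (len h + 1 + 1))) =
      (G0 * (len h * (len h + 1))) * (len h + 2) by ring.
    apply: ler_pM => //; rewrite ?mulr_ge0//; lra.
  - by rewrite len_cons; lra.
rewrite (@step_mean_linear _ (fun h' => rescaled h' ^+ 2) (fun=> 1))// step_mean_cst//.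
rewrite step_mean_rescaled_sq//.
apply: le_trans; rewrite mul1r mulr1 mulrDl mul1r addrA -addrA.
rewrite [j%:R * v0 + v0]addrC addrA lerD2r lerD2l /v0.
have act_l : A0 / (2 * l) <= density h.
  rewrite /density ler_pM//; [lra|rewrite invr_ge0; lra|].
  by rewrite lef_pV2 ?posrE; lra.
have Gle : gain h * growth h <= 4 * G0.
  have rE : growth h * len h <= len h + 2.
    have [a0 _ _ _] := density_bounds vh.
    have -> : growth h * len h = len h + 3 / 4 * (2 - density h) by rewrite /growth; field; lra.
    by lra.
  have lp : 0 < len h * (l * (l + 1)) by rewrite !mulr_gt0//; lra.
  rewrite -(ler_pM2r lp).
  have -> : gain h * growth h * (len h * (l * (l + 1))) =
    (gain h * (l * (l + 1))) * (growth h * len h) by ring.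
  apply: (@le_trans _ _ ((G0 * (len h * (len h + 1))) * (len h + 2))).
    by apply: ler_pM => //; rewrite ?mulr_ge0//; lra.
  have -> : 4 * G0 * (len h * (l * (l + 1))) = G0 * len h * (4 * (l * (l + 1))) by ring.
  have -> : G0 * (len h * (len h + 1)) * (len h + 2) =
     G0 * len h * ((len h + 1) * (len h + 2)) by ring.
  rewrite ler_pM2l; last by rewrite mulr_gt0//; lra.
  have l1 : len h + 1 <= 2 * l by lra.
  have l3 : 0 < len h + 1 by lra.
  apply: (@le_trans _ _ ((2 * l) * (2 * l + 1))); last by nra.
  by apply: ler_pM; lra.
have v := variance_ge vh.
have G2 : (gain h * growth h) ^+ 2 <= (4 * G0) ^+ 2.
  by rewrite lerXn2r// nnegrE ?mulr_ge0//; lra.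
have G20 : 0 < (gain h * growth h) ^+ 2 by rewrite exprn_gt0// mulr_gt0//; lra.
apply: ler_pM.
- by rewrite mulr_ge0// divr_ge0//; lra.
- by rewrite invr_ge0 sqr_ge0.
- by lra.
- by rewrite lef_pV2// posrE// exprn_gt0//; lra.
Qed.

(** Doubling the length already produces a variance comparable with the potential,
    and the second moment of a martingale does not decrease afterwards. *)
Lemma second_moment_ge : exists2 kap : R, 0 < kap <= 1 & forall k h, valid h ->
  rescaled h ^+ 2 + kap * density h * potential h
  <= steps_mean (size h + k) (fun h' => rescaled h' ^+ 2) h.
Proof.
(* 7/32 from the variance, 1/2 from the density, 16 from the gain, 8 from the
   potential *)
exists (7 / 32 / 2 / 16 / 8) => [|k h vh]; first by apply/andP; split; lra.
rewrite steps_meanD.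
have L := valid_len vh; have g0 := gain_gt0 vh; have hA := valid_activity vh.
have hA0 : 0 < activity h by lra.
have := @second_moment_doubling (activity h) (gain h) (len h) (size h) h vh L g0 hA0
  (lexx _) (lexx _).
rewrite -/(len h) => H.
have {}H := H (ltac:(lra)).
apply: (@le_trans _ _ (steps_mean (size h) (fun h' => rescaled h' ^+ 2) h)).
- apply: le_trans H; rewrite lerD2l /density /potential le_eqVlt; apply/orP; left.
  by apply/eqP; field; apply/andP; split; lra.
- apply: le_steps_mean => // h' vh' _ _.
  by apply: (@steps_mean_submartingale _ k (fun h' => rescaled h' ^+ 2)) => // *;
    exact: step_mean_rescaled_sq_ge.
Qed.

End AntiConcentration.

(** * Anti-concentration at zero, and the mean inverse density *)

Section SmallBall.
Context {R : realType}.
Implicit Types (h : seq R) (f g Q Phi : seq R -> R) (x c : R) (k n : nat).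

(** Paley-Zygmund, in the form m <= eta + la m^2 + (1 / (4 la)) 1_(m >= eta) for
    m the square of the rescaled displacement: its first and second moments are
    comparable with W = M^2 + potential and with W^2. *)
Lemma anticoncentration : exists2 kap : R, 0 < kap & forall c k h,
  valid h -> 0 < c -> c <= density h ->
  (kap * c) ^+ 2 / 64 <=
  steps_mean (size h + k) (fun h' => (kap * c / 4 * potential h <= rescaled h' ^+ 2)%R%:R) h.
Proof.
have [kap /andP[kap0 kap1] E2'] := @second_moment_ge R.
exists kap; first exact: kap0.
move=> c k h vh c0 ca; have {}E2' := E2' k h vh.
have L := valid_len vh; have g0 := gain_gt0 vh.
have [_ a1 _ _] := density_bounds vh.
have p0 : 0 < potential h by rewrite divr_gt0 ?exprn_gt0//; lra.
pose c2 := kap * c; pose W := rescaled h ^+ 2 + potential h.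
have c20 : 0 < c2 by exact: mulr_gt0.
have c21 : c2 <= 1 by rewrite -[leRHS]mul1r /c2 ler_pM//; lra.
have W0 : 0 < W by rewrite /W; have := sqr_ge0 (rescaled h); lra.
have E2 : c2 * W <= steps_mean (size h + k) (fun h' => rescaled h' ^+ 2) h.
  apply: le_trans E2'.
  rewrite /W mulrDr lerD//; first by rewrite -[leRHS]mul1r ler_wpM2r ?sqr_ge0.
  by rewrite ler_pM2r// ler_pM2l.
have E4 := fourth_moment (size h + k) vh; rewrite -/W in E4.
(* with this value, la times the bound 32 W^2 of the fourth moment is c2 W / 2 *)
pose la := c2 / (64 * W).
have la0 : 0 < la by rewrite divr_gt0//; lra.
pose I h' : R := (kap * c / 4 * potential h <= rescaled h' ^+ 2)%R%:R.
have : steps_mean (size h + k) (fun h' => rescaled h' ^+ 2) h <=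
   steps_mean (size h + k) (fun h' => 1 * (la * rescaled h' ^+ 4 + (4 * la)^-1 * I h')
      + (c2 * potential h / 4) * 1) h.
  apply: le_steps_mean => // h' vh' _ _; rewrite mulr1 mul1r /I.
  have e4 : rescaled h' ^+ 4 = (rescaled h' ^+ 2) ^+ 2 by rewrite -exprM.
  have q0 := sqr_ge0 (rescaled h' ^+ 2).
  case: (leP (kap * c / 4 * potential h) (rescaled h' ^+ 2)) => [_|lt]; rewrite e4.
  - set m := rescaled h' ^+ 2 in q0 *; rewrite mulr1 -subr_ge0.
    have -> : la * m ^+ 2 + (4 * la)^-1 + c2 * potential h / 4 - m =
       la * (m - (2 * la)^-1) ^+ 2 + c2 * potential h / 4 by field; lra.
    apply: addr_ge0; first by rewrite mulr_ge0 ?sqr_ge0// ltW.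
    by rewrite divr_ge0// mulr_ge0// ltW.
  - rewrite mulr0 addr0; apply: (le_trans (ltW lt)).
    have -> : kap * c / 4 * potential h = c2 * potential h / 4 by rewrite -/c2 mulrAC.
    by rewrite lerDr mulr_ge0// ltW.
rewrite (@steps_mean_linear _ _ (fun h' => la * rescaled h' ^+ 4 + (4 * la)^-1 * I h') (fun=> 1))//.
rewrite (@steps_mean_linear _ _ (fun h' => rescaled h' ^+ 4) I)// steps_mean_cst//.
rewrite -/I; set p := steps_mean _ I h; move: E4; set m4 := steps_mean _ _ h => E4 H.
have {}H : c2 * W <= la * (32 * W ^+ 2) + (4 * la)^-1 * p + c2 * W / 4.
  apply: (le_trans E2); apply: (le_trans H); rewrite mul1r mulr1.
  apply: lerD; first by rewrite lerD2r ler_pM2l.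
  rewrite ler_pM2r// ler_pM2l// /W; have := sqr_ge0 (rescaled h); lra.
have e1 : la * (32 * W ^+ 2) = c2 * W / 2 by rewrite /la; field; lra.
have e2 : (4 * la)^-1 * p = 16 * W / c2 * p.
  by rewrite /la; field; apply/andP; split; lra.
rewrite e1 e2 in H.
have {}H : c2 * W / 4 <= 16 * W / c2 * p by lra.
rewrite -/c2; have {E2'} k0 : 0 < 16 * W / c2 by rewrite divr_gt0//; lra.
rewrite -(ler_pM2l k0); apply: le_trans H.
have -> : 16 * W / c2 * (c2 ^+ 2 / 64) = c2 * W / 4 by field; lra.
by [].
Qed.

(** When the density a is small the next step is nonzero with probability about
    2 a, because two channels are consulted; so n / A_n is contracted at rate
    1 / (3 n) towards a bounded value. *)
Lemma step_mean_inverse_activity h : valid h ->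
  step_mean (fun h' => len h' / activity h') h
  <= (1 - (3 * len h)^-1) * (len h / activity h) + (len h)^-1.
Proof.
move=> vh; have L := valid_len vh; have hA := valid_activity vh.
rewrite (@step_mean_quadratic _ _ _ ((len h + 1) / activity h) 0
  (- ((len h + 1) / (activity h * (activity h + 1)))))//; last first.
  move=> x tx; rewrite len_cons activity_cons.
  by case: (ternaryP tx) => ->; field; rewrite ?gt_eqF//; nra.
have m2 : activity h / len h * (2 - 3 / 2 * (activity h / len h)) <= mean_step_sq h.
  by rewrite /mean_step_sq /density; have := sqr_ge0 (speed h); lra.
have a1 : activity h <= len h by case/and3P: vh => _ /activity_le_len.
move: (len h) (activity h) (mean_step_sq h) L hA m2 a1 => l A m L hA m2 a1.
rewrite mul0r addr0.
have q0 : 0 < (l + 1) / (A * (A + 1)) by rewrite divr_gt0 ?mulr_gt0//; lra.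
have : (l + 1) / (A * (A + 1)) * (A / l * (2 - 3 / 2 * (A / l)))
       <= (l + 1) / (A * (A + 1)) * m by rewrite ler_pM2l.
suff : 4 / 3 / A - 1 / l <= (l + 1) / (A * (A + 1)) * (A / l * (2 - 3 / 2 * (A / l))).
  move=> H1 H2.
  have -> : (1 - (3 * l)^-1) * (l / A) + l^-1 = (l + 1) / A - (4 / 3 / A - 1 / l).
    by field; apply/andP; split; lra.
  by lra.
have -> : (l + 1) / (A * (A + 1)) * (A / l * (2 - 3 / 2 * (A / l))) =
   ((l + 1) * (2 * l - 3 / 2 * A)) / ((A + 1) * (l * l)) by field; apply/and3P; split; lra.
rewrite ler_pdivlMr; last by rewrite !mulr_gt0//; lra.
have -> : (4 / 3 / A - 1 / l) * ((A + 1) * (l * l)) = (4 / 3 * l - A) * l * (A + 1) / A.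
  by field; apply/andP; split; lra.
rewrite ler_pdivrMr; last by lra.
have e : 0 <= 4 / 3 * l - A by lra.
have u : 0 <= (4 / 3 * l - A) * (3 / 2 * A - (A + 1)) by apply: mulr_ge0; lra.
nra.
Qed.

End SmallBall.

(** * Means over the histories of a given length *)

Section Law.
Context {R : realType}.
Implicit Types (h : seq R) (f g Q Phi : seq R -> R) (x c : R) (k n : nat).

(** The first two steps are independent and symmetric signs; [k] further steps
    follow. *)
Definition history_mean k f : R :=
  (steps_mean k f [:: 1; 1] + steps_mean k f [:: 1; -1]
   + steps_mean k f [:: -1; 1] + steps_mean k f [:: -1; -1]) / 4.

Lemma valid_init x y : x ^+ 2 = 1 -> y ^+ 2 = 1 -> valid [:: x; y].
Proof.
move=> x2 y2; rewrite /valid /= /activity !big_cons big_nil x2 y2.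
have t z : z ^+ 2 = 1 -> ternary z.
  by move/eqP; rewrite sqrf_eq1 /ternary => /orP[->//|->]; rewrite !orbT.
by rewrite !t//=; lra.
Qed.

Lemma le_history_mean k f g :
  (forall h, valid h -> size h = k.+2 -> f h <= g h) -> history_mean k f <= history_mean k g.
Proof.
move=> fg; rewrite /history_mean ler_pM2r//.
by rewrite !lerD// le_steps_mean ?valid_init ?sqrrN ?expr1n// => h vh;
  rewrite addnC addn2 => sz _; exact: fg.
Qed.

Lemma eq_history_mean k f g :
  (forall h, valid h -> size h = k.+2 -> f h = g h) -> history_mean k f = history_mean k g.
Proof. by move=> fg; apply/le_anti; rewrite !le_history_mean// => h vh sz; rewrite fg. Qed.

Lemma history_meanSr k f : history_mean k.+1 f = history_mean k (step_mean f).
Proof. by rewrite /history_mean !steps_meanSr. Qed.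

Lemma history_meanD j k f : history_mean (j + k) f = history_mean j (steps_mean k f).
Proof. by rewrite /history_mean !steps_meanD. Qed.

Lemma history_mean_linear k f g (u v : R) :
  history_mean k (fun h' => u * f h' + v * g h') = u * history_mean k f + v * history_mean k g.
Proof.
by rewrite /history_mean !steps_mean_linear ?valid_init ?sqrrN ?expr1n//; lra.
Qed.

Lemma history_mean_cst k c : history_mean k (fun=> c) = c.
Proof. by rewrite /history_mean !steps_mean_cst ?valid_init ?sqrrN ?expr1n//; lra. Qed.

Lemma history_mean_scale k f (u : R) : history_mean k (fun h' => u * f h') = u * history_mean k f.
Proof.
rewrite (@eq_history_mean k _ (fun h' => u * f h' + 0 * f h')) ?history_mean_linear ?mul0r ?addr0//.
by move=> *; rewrite mul0r addr0.
Qed.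

Lemma history_mean_sum k (I : Type) (s : seq I) (F : I -> seq R -> R) :
  history_mean k (fun h => \sum_(i <- s) F i h) = \sum_(i <- s) history_mean k (F i).
Proof.
elim: s => [|i s IH].
  by rewrite big_nil -[RHS](history_mean_cst k); apply: eq_history_mean => *; rewrite big_nil.
rewrite big_cons -IH -[history_mean k (F i)]mul1r -[X in _ = _ + X]mul1r -history_mean_linear.
by apply: eq_history_mean => *; rewrite big_cons !mul1r.
Qed.

Lemma inverse_activity_mean k : history_mean k (fun h => len h / activity h) <= 3.
Proof.
elim: k => [|k IH].
  rewrite -[leRHS](history_mean_cst 0); apply: le_history_mean => h vh sz.
  have hA := valid_activity vh; rewrite /len sz ler_pdivrMr; lra.
rewrite history_meanSr.
apply: (@le_trans _ _ (history_mean k (fun h => (1 - (3 * k.+2%:R)^-1) * (len h / activity h)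
   + k.+2%:R^-1 * 1))).
  apply: le_history_mean => h vh sz; rewrite mulr1.
  have <- : len h = k.+2%:R by rewrite /len sz.
  exact: step_mean_inverse_activity.
rewrite history_mean_linear history_mean_cst; set l := k.+2%:R : R.
have l2 : 2 <= l by rewrite ler_nat.
have k0 : 0 <= 1 - (3 * l)^-1.
  by rewrite subr_ge0 invf_le1; lra.
apply: (@le_trans _ _ ((1 - (3 * l)^-1) * 3 + l^-1 * 1)).
  by rewrite lerD2r ler_wpM2l.
have -> : (1 - (3 * l)^-1) * 3 + l^-1 * 1 = 3 by field; lra.
by [].
Qed.

(** Markov's inequality for the inverse density. *)
Lemma small_density_mean k c : 0 < c -> history_mean k (fun h => (density h < c)%R%:R) <= 3 * c.
Proof.
move=> c0; apply: (@le_trans _ _ (history_mean k (fun h => c * (len h / activity h)))).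
  apply: le_history_mean => h vh _; have L := valid_len vh; have hA := valid_activity vh.
  rewrite mulrA ler_pdivlMr; last lra.
  case: ltP => [|_]; last by rewrite mul0r mulr_ge0; lra.
  by rewrite /density ltr_pdivrMr ?mul1r; lra.
by rewrite history_mean_scale [leRHS]mulrC ler_pM2l// inverse_activity_mean.
Qed.

Definition neg h : seq R := map -%R h.

Lemma step_mean_neg f h : step_mean (f \o neg) h = step_mean f (neg h).
Proof.
rewrite /step_mean /channel /len /neg size_map; congr (_ * _); rewrite big_map; apply: eq_bigr => v _.
rewrite !big_map; congr (_ * (_ * _) + _ * (_ * _)); apply: eq_bigr => u _ /=.
  by congr (_ * f (_ :: _) + _ * f (_ :: _)); rewrite -sgrN; congr Num.sg; ring.
by congr (_ * f (_ :: _) + _ * f (_ :: _)); rewrite -sgrN; congr Num.sg; ring.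
Qed.

Lemma steps_mean_neg k f h : steps_mean k (f \o neg) h = steps_mean k f (neg h).
Proof.
elim: k f h => // k IH f h; rewrite !steps_meanSr -IH.
by congr (steps_mean k _ h); apply/funext => h'; rewrite step_mean_neg.
Qed.

Lemma history_mean_neg k f : history_mean k (f \o neg) = history_mean k f.
Proof. by rewrite /history_mean !steps_mean_neg /= !opprK; lra. Qed.

Lemma positive_negative_mean k :
  history_mean k (fun h => (0 < displ h)%R%:R) =
  history_mean k (fun h => (displ h < 0)%R%:R).
Proof.
rewrite -history_mean_neg; apply: eq_history_mean => h _ _ /=.
by rewrite /displ /neg big_map sumrN oppr_gt0.
Qed.

End Law.

(** * Probabilities as real numbers *)

Section RealProbability.
Context d (T : measurableType d) (R : realType) (P : probability T R).
Implicit Types (A B : set T).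

Definition pr A : R := fine (P A).

Lemma prK A : measurable A -> P A = (pr A)%:E.
Proof. by move=> mA; rewrite /pr fineK// fin_num_measure. Qed.

Lemma pr_ge0 A : 0 <= pr A.
Proof. by rewrite /pr fine_ge0. Qed.

Lemma pr0 : pr set0 = 0.
Proof. by rewrite /pr measure0. Qed.

Lemma prT : pr setT = 1.
Proof. by rewrite /pr probability_setT. Qed.

Lemma prU A B : measurable A -> measurable B -> A `&` B = set0 ->
  pr (A `|` B) = pr A + pr B.
Proof.
move=> mA mB AB; rewrite {1}/pr.
have -> : P (A `|` B) = (P A + P B)%E by exact: measureU.
by rewrite (prK mA) (prK mB).
Qed.

Lemma pr_split A B : measurable A -> measurable B ->
  pr A = pr (A `&` B) + pr (A `&` ~` B).
Proof.
move=> mA mB; rewrite -prU.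
- by rewrite -setIUr setUv setIT.
- exact: measurableI.
- by apply: measurableI => //; exact: measurableC.
- by rewrite setIACA setICr setI0.
Qed.

Lemma le_pr A B : measurable A -> measurable B -> A `<=` B -> pr A <= pr B.
Proof.
move=> mA mB AB; rewrite (pr_split mB mA) (_ : B `&` A = A) ?lerDl ?pr_ge0//.
exact/setIidPr.
Qed.

Lemma pr_partition (V : eqType) (Z : T -> V) (s : seq V) G : uniq s ->
  (forall v, measurable [set w | Z w = v]) -> \sum_(v <- s) pr [set w | Z w = v] = 1 ->
  measurable G -> pr G = \sum_(v <- s) pr (G `&` [set w | Z w = v]).
Proof.
move=> us mZ Z1 mG.
pose W := [set w | Z w \in s].
have add A : measurable A -> measurable (A `&` W) /\
    pr (A `&` W) = \sum_(v <- s) pr (A `&` [set w | Z w = v]).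
  move=> mA; rewrite /W; clear W Z1; elim: s us => [_|v s IH /= /andP[vs us]].
    have -> : [set w | Z w \in [::]] = set0 by apply/seteqP; split.
    by rewrite setI0 big_nil pr0; split => //; exact: measurable0.
  have [mI E] := IH us.
  have -> : A `&` [set w | Z w \in v :: s] =
     (A `&` [set w | Z w = v]) `|` (A `&` [set w | Z w \in s]).
    apply/seteqP; split => w /=; rewrite inE.
      by case=> Aw /orP[/eqP|]; [left|right].
    by case=> -[Aw]; [move=> ->; rewrite eqxx|move=> ->; rewrite orbT].
  have mv : measurable (A `&` [set w | Z w = v]) by exact: measurableI.
  split; first exact: measurableU.
  rewrite prU// ?E ?big_cons//.
  by apply/seteqP; split => w //= [[_ ->] [_]]; rewrite (negbTE vs).
have [mW] := add _ measurableT; rewrite setTI in mW * => pW.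
have [_ <-] := add _ mG.
have pWc : pr (~` W) = 0.
  have := pr_split measurableT mW; rewrite !setTI prT pW.
  under eq_bigr do rewrite setTI.
  by rewrite Z1 => H; lra.
rewrite (pr_split mG mW) [X in _ + X](_ : _ = 0) ?addr0//.
apply/le_anti; rewrite pr_ge0 andbT -pWc le_pr//.
- by apply: measurableI => //; exact: measurableC.
- exact: measurableC.
Qed.

End RealProbability.

(** * From the sources of randomness to the law of the history *)

Section Bridge.
Context d (T : measurableType d) (R : realType) (P : probability T R)
  (X : nat -> {RV P >-> R}) (U : 'I_2 -> nat -> {RV P >-> nat})
  (sigma : 'I_2 -> nat -> {RV P >-> R}).
Context (hX : two_channel_elephant (7 / 8) X U sigma).
Local Notation pr := (pr P).

Fixpoint hist n (w : T) : seq R :=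
  if n is n'.+1 then X n'.+1 w :: hist n' w else [::].

Lemma size_hist n w : size (hist n w) = n.
Proof. by elim: n => //= n ->. Qed.

Lemma drop_hist j n w : drop j (hist (j + n) w) = hist n w.
Proof. by elim: j => [|j IH]; rewrite ?drop0. Qed.

(** The order is that of use, so that the sources after the first 2 + 4 k ones are
    those used beyond the first k + 2 steps. *)
Definition nth_source (i : nat) : source :=
  match i with
  | 0 => FirstStep ord0
  | 1 => FirstStep ord_max
  | i'.+2 => match (i' %% 4)%N with
    | 0 => Index ord0 (i' %/ 4)
    | 1 => Index ord_max (i' %/ 4)
    | 2 => Sign ord0 (i' %/ 4)
    | _ => Sign ord_max (i' %/ 4)
    end
  end.

Definition source_rank (s : source) : nat :=
  match s with
  | FirstStep i => i
  | Index i m => (2 + 4 * m + i)%N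
  | Sign i m => (4 + 4 * m + i)%N
  end.

Lemma nth_sourceK : cancel nth_source source_rank.
Proof.
case=> [|[|i]] //=; have := ltn_pmod i (isT : (0 < 4)%N); have := divn_eq i 4.
by case: (i %% 4)%N => [|[|[|[|]]]] //= E _; rewrite {2}E; lia.
Qed.

Local Notation ev l := (source_events X U sigma (nth_source l)).

Lemma generated_measurable d' (S : measurableType d') (Z : {RV P >-> S}) A :
  sigma_generated Z A -> measurable A.
Proof. by case=> B mB <-; exact: (measurable_funP Z). Qed.

Lemma generated_preimage d' (S : measurableType d') (Z : {RV P >-> S}) (B : set S) :
  measurable B -> sigma_generated Z (Z @^-1` B).
Proof. by move=> mB; exists B => //; rewrite setTI. Qed.

Lemma source_event_measurable l A : ev l A -> measurable A.
Proof.
by case: (nth_source l) => [i|i m|i m] /= /generated_measurable.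
Qed.

Lemma source_independence k (F : nat -> set T) : (forall l, ev l (F l)) ->
  pr (\big[setI/setT]_(l < k) F l) = \prod_(l < k) pr (F l).
Proof.
move=> evF.
have mF l : measurable (F l) by exact: source_event_measurable (evF l).
have := independence hX (k := k) (j := fun i => nth_source i) _ (E := fun i => F i) _.
rewrite -bigcap_mkord.
move=> /(_ (inj_comp (can_inj nth_sourceK) val_inj) (fun i => evF i)) H.
rewrite {1}/pr.
have -> : \bigcap_(i < k) F i = \bigcap_(i in [set: 'I_k]) F i.
  apply/seteqP; split => w /= H' i.
    by move=> _; apply: H' => /=.
  by move=> /= ik; exact: (H' (Ordinal ik)).
rewrite H; elim: k {H} => [|k IH]; first by rewrite !big_ord0.
rewrite !big_ord_recr /= fineM ?fin_num_measure// ?IH//.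
by apply/prode_fin_num => i _; rewrite fin_num_measure.
Qed.

Lemma value_event_X (i : 'I_2) (x : R) : ev i [set w | X i.+1 w = x].
Proof.
have -> : nth_source i = FirstStep i.
  by case: i => [[|[|//]] p] /=; congr FirstStep; apply: val_inj.
exact: (@generated_preimage _ _ (X i.+1) [set x]).
Qed.

Lemma nth_source_Index (i : 'I_2) k : nth_source (2 + 4 * k + i) = Index i k.
Proof.
rewrite (_ : 2 + 4 * k + i = (k * 4 + i).+2)%N; last by lia.
case: i => [[|[|//]] p] /=; rewrite modnMDl divnMDl// modn_small// divn_small// !addn0;
  by congr Index; apply: val_inj.
Qed.

Lemma nth_source_Sign (i : 'I_2) k : nth_source (4 + 4 * k + i) = Sign i k.
Proof.
rewrite (_ : 4 + 4 * k + i = (k * 4 + (2 + i)).+2)%N; last by lia.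
case: i => [[|[|//]] p] /=; rewrite modnMDl divnMDl// modn_small// divn_small// !addn0;
  by congr Sign; apply: val_inj.
Qed.

Lemma value_event_U (i : 'I_2) k (u : nat) : ev (2 + 4 * k + i) [set w | U i k.+3 w = u].
Proof.
rewrite nth_source_Index.
exact: (@generated_preimage _ _ (U i k.+3) [set u]).
Qed.

Lemma value_event_sigma (i : 'I_2) k (x : R) :
  ev (4 + 4 * k + i) [set w | sigma i k.+3 w = x].
Proof.
rewrite nth_source_Sign.
exact: (@generated_preimage _ _ (sigma i k.+3) [set x]).
Qed.

Lemma nth_hist n i w : (i < n)%N -> nth 0 (hist n w) i = X (n - i) w.
Proof. by elim: n i => // n IH [|i] //= /IH ->. Qed.

Lemma next_step_hist k w (u0 u1 : nat) (s0 s1 : R) h :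
    hist k.+2 w = h -> (1 <= u0 <= k.+2)%N -> (1 <= u1 <= k.+2)%N ->
    U ord0 k.+3 w = u0 -> U ord_max k.+3 w = u1 ->
    sigma ord0 k.+3 w = s0 -> sigma ord_max k.+3 w = s1 ->
  X k.+3 w = Num.sg (s0 * nth 0 h (k.+2 - u0) + s1 * nth 0 h (k.+2 - u1)).
Proof.
move=> <- u0k u1k U0 U1 S0 S1; rewrite (next_step hX)//.
have sum2 (f : 'I_2 -> R) : \sum_(i < 2) f i = f ord0 + f ord_max.
  by rewrite !big_ord_recl big_ord0 addr0; congr (_ + f _); apply: val_inj.
rewrite sum2 U0 U1 S0 S1 !nth_hist; try lia.
by rewrite !subKn//; lia.
Qed.

Definition sign_weight (s : R) : R := if s == 1 then 7 / 8 else 1 / 8.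

Lemma sign_weight1 : sign_weight 1 = 7 / 8.
Proof. by rewrite /sign_weight eqxx. Qed.

Lemma sign_weightN1 : sign_weight (-1) = 1 / 8.
Proof. by rewrite /sign_weight; case: eqP => // E; lra. Qed.

Lemma channel_sources n h g : size h = n ->
  channel h g = \sum_(u <- iota 1 n) \sum_(s <- [:: 1; -1])
    (n%:R^-1 * sign_weight s) * g (s * nth 0 h (n - u)).
Proof.
move=> sz; rewrite /channel /len sz big_distrr /= (big_nth 0) sz big_nat_rev /=.
rewrite (_ : iota 1 n = index_iota 1 n.+1); last by rewrite /index_iota subn1.
rewrite big_add1 /= !big_nat.
apply: eq_bigr => u /= uk.
rewrite !big_cons big_nil sign_weight1 sign_weightN1.
by rewrite [1 * nth _ _ _]mul1r mulN1r add0n; lra.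
Qed.

Lemma prX_value n x : (1 <= n <= 2)%N -> x \in [:: 1; -1] -> pr [set w | X n w = x] = 2^-1.
Proof.
move=> n12; have [p1 p2] := first_steps hX n12.
by rewrite !inE => /orP[] /eqP ->; rewrite /pr ?p1 ?p2.
Qed.

Lemma prU_value i k u : (1 <= u <= k.+2)%N ->
  pr [set w | U i k.+3 w = u] = k.+2%:R^-1.
Proof. by move=> uk; rewrite /pr (index_uniform hX). Qed.

Lemma prsigma_value i k s : s \in [:: 1; -1] ->
  pr [set w | sigma i k.+3 w = s] = sign_weight s.
Proof.
have [p1 p2] := sign_law hX i (isT : (2 <= k.+2)%N).
rewrite !inE => /orP[] /eqP ->; rewrite /pr ?p1 ?p2 ?sign_weight1 ?sign_weightN1//=.
by lra.
Qed.

Lemma uniq_signs : uniq [:: 1; -1 : R].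
Proof.
by rewrite /= inE andbT; apply/eqP => E; lra.
Qed.

Lemma measurable_value d' (S : measurableType d') (Z : {RV P >-> S}) v :
  measurable [set v] -> measurable [set w | Z w = v].
Proof.
by move=> mv; have := measurable_funP Z measurableT [set v] mv; rewrite setTI.
Qed.

Lemma measurable_hist n h : measurable [set w | hist n w = h].
Proof.
elim: n h => [|n IH] h /=.
  case: (eqVneq [::] h) => [<-|/eqP nh].
    by rewrite (_ : [set _ | _] = setT) //; apply/seteqP; split.
  by rewrite (_ : [set _ | _] = set0) //; apply/seteqP; split.
case: h => [|x h].
  by rewrite (_ : [set _ | _] = set0) //; apply/seteqP; split.
rewrite (_ : [set _ | _] = [set w | X n.+1 w = x] `&` [set w | hist n w = h]).
  apply: measurableI => //; exact: (@measurable_value _ _ (X n.+1) x (measurable_set1 x)).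
by apply/seteqP; split => w /= [-> ->].
Qed.

Lemma pr_partition_U i k G : measurable G ->
  pr G = \sum_(u <- iota 1 k.+2) pr (G `&` [set w | U i k.+3 w = u]).
Proof.
move=> mG; apply: pr_partition => //; first exact: iota_uniq.
- by move=> v; exact: (@measurable_value _ _ (U i k.+3) v I).
- rewrite (eq_big_seq (fun=> k.+2%:R^-1)) => [|u].
    by rewrite big_const_seq count_predT size_iota iter_addr_0 -[LHS]mulr_natr mulVf// pnatr_eq0.
  by rewrite mem_iota => uk; apply: prU_value; lia.
Qed.

Lemma pr_partition_sigma i k G : measurable G ->
  pr G = \sum_(s <- [:: 1; -1]) pr (G `&` [set w | sigma i k.+3 w = s]).
Proof.
move=> mG; apply: pr_partition => //; first exact: uniq_signs.
- by move=> v; exact: (@measurable_value _ _ (sigma i k.+3) v (measurable_set1 v)).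
- rewrite (eq_big_seq sign_weight) => [|s]; last by move/prsigma_value.
  by rewrite !big_cons big_nil sign_weight1 sign_weightN1; lra.
Qed.

Lemma pr_partition_X n G : (1 <= n <= 2)%N -> measurable G ->
  pr G = \sum_(s <- [:: 1; -1]) pr (G `&` [set w | X n w = s]).
Proof.
move=> n12 mG; apply: pr_partition => //; first exact: uniq_signs.
- by move=> v; exact: (@measurable_value _ _ (X n) v (measurable_set1 v)).
- rewrite (eq_big_seq (fun=> 2^-1)) => [|s]; last by move/prX_value => ->.
  by rewrite !big_cons big_nil; lra.
Qed.

Lemma pr_hist_future_init m h (F : nat -> set T) : (forall l, ev (2 + l) (F l)) ->
  pr ([set w | hist 2 w = h] `&` \big[setI/setT]_(l < m) F l) =
  history_mean 0 (fun h' => (h' == h)%:R) * \prod_(l < m) pr (F l).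
Proof.
move=> evF.
have mF l : measurable (F l) by exact: source_event_measurable (evF l).
have mbF : measurable (\big[setI/setT]_(l < m) F l).
  by apply: bigsetI_measurable => l _.
set B := \big[setI/setT]_(l < m) F l in mbF *.
have mG : measurable ([set w | hist 2 w = h] `&` B).
  by apply: measurableI => //; exact: measurable_hist.
rewrite (@pr_partition_X 1)//.
have mX n s : measurable [set w | X n w = s].
  exact: (@measurable_value _ _ (X n) s (measurable_set1 s)).
rewrite (eq_big_seq (fun s1 => \sum_(s2 <- [:: 1; -1])
   ([:: s2; s1] == h)%:R * (2^-1 * 2^-1 * \prod_(l < m) pr (F l)))); last first.
  move=> s1 s1P; rewrite (@pr_partition_X 2)//; last exact: measurableI.
  apply: eq_big_seq => s2 s2P.
  case: eqP => [<-|nh]; last first.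
    rewrite mul0r [X in pr X](_ : _ = set0) ?pr0//.
    by apply/seteqP; split => w //= [[[E _] X1] X2]; apply: nh; rewrite -E X1 X2.
  pose F' l := match l with 0 => [set w | X 1 w = s1] | 1 => [set w | X 2 w = s2]
    | l'.+2 => F l' end.
  have evF' l : ev l (F' l).
    case: l => [|[|l]]; [exact: (value_event_X ord0)|exact: (value_event_X ord_max)|].
    exact: evF.
  have := @source_independence (2 + m) F' evF'.
  rewrite !big_ord_recl /= (prX_value _ s1P)// (prX_value _ s2P)// mul1r -mulrA => <-.
  congr pr; apply/seteqP; split => w /=.
    by case=> [[[E Bw] X1] X2]; do 2!split => //.
  by case=> X1 [X2 Bw]; rewrite X1 X2.
rewrite !big_cons !big_nil /history_mean /=; lra.
Qed.

(** The statement carries arbitrary events of the sources not used so far, as the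
    induction splits the event according to the values of the four sources of the
    new step, each of which becomes one factor of the product. *)
Lemma pr_hist_future k m h (F : nat -> set T) : (forall l, ev (2 + 4 * k + l) (F l)) ->
  pr ([set w | hist k.+2 w = h] `&` \big[setI/setT]_(l < m) F l) =
  history_mean k (fun h' => (h' == h)%:R) * \prod_(l < m) pr (F l).
Proof.
elim: k m h F => [|k IH] m h F evF; first exact: pr_hist_future_init.
have mF l : measurable (F l) by exact: source_event_measurable (evF l).
have mbF : measurable (\big[setI/setT]_(l < m) F l).
  by apply: bigsetI_measurable => l _.
case: h => [|x h].
  rewrite [X in pr X](_ : _ = set0) ?pr0; last by apply/seteqP; split => w //= [].
  rewrite (@eq_history_mean _ _ _ (fun=> 0)) ?history_mean_cst ?mul0r// => h' _.
  by case: h'.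
have -> : history_mean k.+1 (fun h' => (h' == x :: h)%:R) =
   channel h (fun y1 => channel h (fun y2 => (Num.sg (y1 + y2) == x)%:R)) *
   history_mean k (fun h' => (h' == h)%:R).
  rewrite history_meanSr -history_mean_scale; apply: eq_history_mean => h' vh' _; rewrite /step_mean.
  case: (eqVneq h' h) => [->|nh]; rewrite ?mulr1 ?mulr0.
    congr (channel h _); apply/funext => y1; congr (channel h _); apply/funext => y2.
    by rewrite eqseq_cons eqxx andbT.
  have z g : (forall y, g y = 0) -> channel h' g = 0.
    by move=> g0; rewrite /channel big1 ?mulr0// => v _; rewrite !g0 !mulr0 addr0.
  by apply: (z) => y1; apply: (z) => y2; rewrite eqseq_cons (negbTE nh) andbF.
set B := \big[setI/setT]_(l < m) F l in mbF *.
have IH0 : history_mean k (fun h' => (h' == h)%:R) = pr [set w | hist k.+2 w = h].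
  have ev0 l : ev (2 + 4 * k + l) setT.
    case: (nth_source _) => [i|i n|i n]; exists setT; rewrite ?preimage_setT ?setIT//.
  by rewrite -[RHS]mulr1 -[X in _ = pr X * _]setIT; have := IH 0%N h (fun=> setT) ev0;
    rewrite !big_ord0 => ->; rewrite !mulr1.
have [szh|nszh] := eqVneq (size h) k.+2; last first.
  have z1 w : hist k.+2 w <> h.
    by move=> E; move/eqP: nszh; rewrite -E size_hist.
  rewrite IH0 (_ : [set w | hist k.+2 w = h] = set0); last first.
    by apply/seteqP; split => w //= /z1.
  rewrite (_ : _ `&` B = set0) ?pr0 ?mulr0 ?mul0r//.
  by apply/seteqP; split => w //= [[_ /z1]].
have mX n s : measurable [set w | X n w = s].
  exact: (@measurable_value _ _ (X n) s (measurable_set1 s)).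
have mS i n s : measurable [set w | sigma i n w = s].
  exact: (@measurable_value _ _ (sigma i n) s (measurable_set1 s)).
have mU i n s : measurable [set w | U i n w = s].
  exact: (@measurable_value _ _ (U i n) s I).
have mG : measurable ([set w | hist k.+3 w = x :: h] `&` B).
  by apply: measurableI => //; exact: measurable_hist.
rewrite (channel_sources _ szh) !big_distrl/= (@pr_partition_U ord0 k _ mG).
apply: eq_big_seq => u0; rewrite mem_iota => u0k.
rewrite (@pr_partition_sigma ord0 k); last exact: measurableI.
rewrite !big_distrl; apply: eq_big_seq => s0 s0P.
rewrite (@pr_partition_U ord_max k); last by do 2!apply: measurableI => //.
rewrite (channel_sources _ szh) big_distrr !big_distrl.
apply: eq_big_seq => u1; rewrite mem_iota => u1k.
rewrite (@pr_partition_sigma ord_max k); last by do 3!apply: measurableI => //.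
rewrite /= big_distrr !big_distrl; apply: eq_big_seq => s1 s1P.
have u0k' : (1 <= u0 <= k.+2)%N by lia.
have u1k' : (1 <= u1 <= k.+2)%N by lia.
case: eqP => [sgE|nsg]; last first.
  rewrite [X in pr X](_ : _ = set0) ?pr0 /= ?(mulr0, mul0r)//.
  apply/seteqP; split => w //= [[[[[[Xx hh] _] U0] S0] U1] S1].
  by apply: nsg; rewrite -(next_step_hist hh _ _ U0 U1 S0 S1).
pose F' l := match l with
  | 0 => [set w | U ord0 k.+3 w = u0] | 1 => [set w | U ord_max k.+3 w = u1]
  | 2 => [set w | sigma ord0 k.+3 w = s0] | 3 => [set w | sigma ord_max k.+3 w = s1]
  | l'.+4 => F l' end.
have evF' l : ev (2 + 4 * k + l) (F' l).
  case: l => [|[|[|[|l]]]].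
  - exact: (@value_event_U ord0).
  - exact: (@value_event_U ord_max).
  - by rewrite (_ : 2 + 4 * k + 2 = 4 + 4 * k + @ord0 1)%N;
      [exact: value_event_sigma|rewrite /=; lia].
  - by rewrite (_ : 2 + 4 * k + 3 = 4 + 4 * k + @ord_max 1)%N;
      [exact: value_event_sigma|rewrite /=; lia].
  - by rewrite (_ : 2 + 4 * k + l.+4 = 2 + 4 * k.+1 + l)%N//; lia.
have := IH (4 + m)%N h F' evF'.
rewrite !big_ord_recl /= !prU_value// !prsigma_value// => H.
transitivity (history_mean k (fun h' => (h' == h)%:R) * (k.+2%:R^-1 *
  (k.+2%:R^-1 * (sign_weight s0 * (sign_weight s1 * \prod_(i < m) pr (F i))))));
  last by ring.
rewrite -H; congr pr; apply/seteqP; split => w /=.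
  by case=> [[[[[[Xx hh] Bw] U0] S0] U1] S1]; do 5!split => //.
case=> hh [U0 [U1 [S0 [S1 Bw]]]]; do 5!split => //.
by rewrite hh (next_step_hist hh _ _ U0 U1 S0 S1)// sgE.
Qed.

Lemma pr_hist k h : pr [set w | hist k.+2 w = h] = history_mean k (fun h' => (h' == h)%:R).
Proof.
have ev0 l : ev (2 + 4 * k + l) setT.
  case: (nth_source _) => [i|i n|i n]; exists setT; rewrite ?preimage_setT ?setIT//.
have := @pr_hist_future k 0%N h (fun=> setT) ev0.
by rewrite !big_ord0 setIT mulr1.
Qed.

End Bridge.

(** * Sequences controlled by powers of n *)

Section PowerRates.
Context {R : realType}.
Implicit Types (x u : nat -> R) (e : R) (n N : nat).

(** x - r increases and x + r decreases, so the two enclose a common limit. *)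
Lemma telescoping_limit x (r : nat -> R) N :
  (forall n, (N <= n)%N -> 0 <= r n) ->
  (forall n, (N <= n)%N -> `|x n.+1 - x n| <= r n - r n.+1) ->
  exists L, forall n, (N <= n)%N -> `|x n - L| <= r n.
Proof.
move=> r0 dx.
have mono m k : (N <= m)%N -> x m - r m <= x (m + k)%N - r (m + k)%N /\
    x (m + k)%N + r (m + k)%N <= x m + r m.
  move=> Nm; elim: k => [|k [IH1 IH2]]; first by rewrite addn0.
  have := dx (m + k)%N (leq_trans Nm (leq_addr _ _)); rewrite addnS ler_norml.
  by case/andP=> h1 h2; split; lra.
have cross m k : (N <= m)%N -> (N <= k)%N -> x m - r m <= x k + r k.
  move=> Nm Nk; case: (leqP m k) => mk.
    have [H _] := mono m (k - m)%N Nm; rewrite subnKC// in H.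
    by have := r0 k Nk; lra.
  have [_ H] := mono k (m - k)%N Nk; rewrite subnKC ?(ltnW mk)// in H.
  by have := r0 m Nm; lra.
pose A := [set x n - r n | n in [set n | (N <= n)%N]].
exists (sup A) => n Nn.
have A0 : A !=set0 by exists (x N - r N); exists N => /=.
have ubA k : (N <= k)%N -> ubound A (x k + r k).
  by move=> Nk _ [m /= Nm <-]; exact: cross.
have h1 : x n - r n <= sup A.
  by apply: ub_le_sup; [exists (x N + r N); exact: ubA|exists n].
have h2 : sup A <= x n + r n by apply: ge_sup => //; exact: ubA.
by rewrite ler_norml; apply/andP; split; lra.
Qed.

Definition inv_pow e n : R := n%:R `^ (- e).

Lemma inv_pow_gt0 e n : (0 < n)%N -> 0 < inv_pow e n.
Proof. by move=> n0; rewrite powR_gt0// ltr0n. Qed.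

Lemma inv_pow_ge0 e n : 0 <= inv_pow e n.
Proof. exact: powR_ge0. Qed.

Lemma inv_powD e f n : (0 < n)%N -> inv_pow (e + f) n = inv_pow e n * inv_pow f n.
Proof. by move=> n0; rewrite /inv_pow opprD powRD// pnatr_eq0 -lt0n n0 implybT. Qed.

Lemma inv_pow1 n : inv_pow 1 n = n%:R^-1.
Proof. by rewrite /inv_pow powR_inv1. Qed.

Lemma inv_pow_le1 e n : 0 <= e -> (0 < n)%N -> inv_pow e n <= 1.
Proof.
move=> e0 n0; rewrite /inv_pow -[leRHS](powRr0 n%:R); apply: ler_powR; first by rewrite ler1n.
by rewrite oppr_le0.
Qed.

Lemma le_inv_pow e f n : e <= f -> (0 < n)%N -> inv_pow f n <= inv_pow e n.
Proof.
by move=> ef n0; rewrite /inv_pow; apply: ler_powR; [rewrite ler1n|rewrite lerN2].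
Qed.

Lemma inv_pow_expR e n : (0 < n)%N -> inv_pow e n = expR (- e * ln n%:R).
Proof. by move=> n0; rewrite /inv_pow /powR pnatr_eq0 gtn_eqF. Qed.

Lemma ln_succ_bounds n : (0 < n)%N ->
  n.+1%:R^-1 <= ln n.+1%:R - ln n%:R :> R /\ ln n.+1%:R - ln n%:R <= n%:R^-1 :> R.
Proof.
move=> n0; have n0' : (0 : R) < n%:R by rewrite ltr0n.
have n1 : (0 : R) < n.+1%:R by rewrite ltr0n.
have E : n.+1%:R = n%:R + 1 :> R by rewrite natr1.
split.
- have := @le_ln1Dx R (- n.+1%:R^-1).
  have -> : 1 + - n.+1%:R^-1 = n%:R / n.+1%:R :> R by rewrite E; field; rewrite -E gt_eqF.
  rewrite ln_div ?posrE// => H; have : ln n%:R - ln n.+1%:R <= - n.+1%:R^-1 :> R.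
    apply: H; rewrite ltrN2 invf_lt1//; rewrite ltr1n ltnS//.
  by move=> H'; rewrite -lerN2 opprB.
- have := @le_ln1Dx R (n%:R^-1).
  have -> : 1 + n%:R^-1 = n.+1%:R / n%:R :> R by rewrite E; field; rewrite gt_eqF.
  rewrite ln_div ?posrE//; apply.
  by apply: (@lt_trans _ _ 0); rewrite ?ltrN10// invr_gt0.
Qed.

Lemma inv_pow_succ e n : (0 < n)%N ->
  inv_pow e n.+1 = inv_pow e n * expR (- e * (ln n.+1%:R - ln n%:R)).
Proof. by move=> n0; rewrite !inv_pow_expR// -expRD; congr expR; ring. Qed.

Lemma inv_pow_drop e n : 0 < e <= 1 -> (0 < n)%N ->
  e / 4 * (inv_pow e n / n%:R) <= inv_pow e n - inv_pow e n.+1.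
Proof.
move=> /andP[e0 e1] n0; rewrite inv_pow_succ//.
have [l1 l2] := ln_succ_bounds n0; set l := _ - _ in l1 l2 *.
have r0 := inv_pow_gt0 e n0.
have N1 : (1 : R) <= n%:R by rewrite ler1n.
have l0 : (2 * n%:R)^-1 <= l.
  apply: le_trans l1; rewrite lef_pV2 ?posrE ?ltr0n//; last by lra.
  by rewrite -natr1; lra.
pose y := e * (2 * n%:R)^-1.
have i0 : 0 < (2 * n%:R)^-1 :> R by rewrite invr_gt0; lra.
have i1 : (2 * n%:R)^-1 <= 1 :> R by rewrite invf_le1; lra.
have y0 : 0 < y by rewrite mulr_gt0.
have y1 : y <= 1 by rewrite /y -[leRHS]mul1r ler_pM// ltW.
have : expR (- e * l) <= (1 + y)^-1.
  rewrite mulNr expRN lef_pV2 ?posrE ?expR_gt0//; last by lra.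
  apply: (@le_trans _ _ (1 + e * l)); last exact: expR_ge1Dx.
  by rewrite lerD2l ler_pM2l.
have -> : (1 + y)^-1 = 1 - y / (1 + y) by field; lra.
have : y / 2 <= y / (1 + y) by rewrite ler_pM2l// lef_pV2 ?posrE; lra.
move=> h1 h2.
have -> : e / 4 * (inv_pow e n / n%:R) = inv_pow e n * (y / 2) by rewrite /y; field; lra.
rewrite -[X in _ <= X - _]mulr1 -mulrBr ler_pM2l//; lra.
Qed.

Lemma inv_pow_decay e n : 0 <= e -> (0 < n)%N -> inv_pow e n * (1 - e / n%:R) <= inv_pow e n.+1.
Proof.
move=> e0 n0; rewrite inv_pow_succ// ler_pM2l ?inv_pow_gt0//.
have [_ l2] := ln_succ_bounds n0.
apply: le_trans (expR_ge1Dx _); rewrite lerD2l mulNr lerN2.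
by rewrite ler_wpM2l.
Qed.

Lemma inv_pow_growth e n : 0 <= e -> (0 < n)%N ->
  inv_pow (- e) n * (1 + e / (2 * n%:R)) <= inv_pow (- e) n.+1.
Proof.
move=> e0 n0; rewrite inv_pow_succ// ler_pM2l ?inv_pow_gt0// opprK.
have [l1 _] := ln_succ_bounds n0.
have N1 : (1 : R) <= n%:R by rewrite ler1n.
apply: le_trans (expR_ge1Dx _); rewrite lerD2l.
rewrite ler_wpM2l//; apply: le_trans l1.
by rewrite lef_pV2 ?posrE ?ltr0n//; rewrite -?natr1; lra.
Qed.

Lemma ln_le_inv_pow e n : 0 < e -> (0 < n)%N -> ln n%:R <= e^-1 * inv_pow (- e) n.
Proof.
move=> e0 n0; rewrite -ler_pdivrMl ?invr_gt0// invrK /inv_pow opprK -ln_powR.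
by apply: ltW; apply: ln_sublinear; rewrite powR_gt0// ltr0n.
Qed.

Lemma inv_pow_cvg0 e : 0 < e -> inv_pow e n @[n --> \oo] --> 0.
Proof.
move=> e0; apply/cvgrPdist_le => /= eps eps0.
near=> n; rewrite sub0r normrN ger0_norm ?inv_pow_ge0//.
have n0 : (0 < n)%N by near: n; exists 1%N.
rewrite /inv_pow powRN -[leRHS]invrK lef_pV2 ?posrE ?invr_gt0 ?powR_gt0 ?ltr0n//.
have : eps^-1 `^ e^-1 <= n%:R by near: n; exact: nbhs_infty_ger.
move=> H; rewrite -[leLHS]powRr1 ?invr_ge0 ?(ltW eps0)// -[X in _ `^ X <= _](mulVf (lt0r_neq0 e0)) powRrM.
by apply: ge0_ler_powR; rewrite ?nnegrE ?powR_ge0 ?(ltW e0) ?ler0n.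
Unshelve. all: by end_near. Qed.

(** n^(-e) / n is at most 4 / e times the decrement of n^(-e). *)
Lemma power_rate_limit x e C N : 0 < e <= 1 -> 0 <= C -> (0 < N)%N ->
  (forall n, (N <= n)%N -> `|x n.+1 - x n| <= C * (inv_pow e n / n%:R)) ->
  exists L, forall n, (N <= n)%N -> `|x n - L| <= 4 * C / e * inv_pow e n.
Proof.
move=> e01 C0 N0 dx; have /andP[e0 e1] := e01.
apply: telescoping_limit => n Nn.
  by rewrite mulr_ge0 ?inv_pow_ge0// divr_ge0 ?(ltW e0)// mulr_ge0.
apply: (le_trans (dx n Nn)).
rewrite -mulrBr.
have -> : C * (inv_pow e n / n%:R) = 4 * C / e * (e / 4 * (inv_pow e n / n%:R)).
  by field; rewrite !gt_eqF// ltr0n (leq_trans N0).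
by rewrite ler_wpM2l ?inv_pow_drop ?(leq_trans N0)// divr_ge0 ?(ltW e0)// mulr_ge0.
Qed.

(** The contraction beats the decay of n^(-e') as soon as e' < kap; the value kap / 4
    leaves room for the error term. *)
Lemma contraction_rate x e kap C N : 0 < e -> 0 < kap <= 1 -> 0 <= C -> (0 < N)%N ->
  (forall n, (N <= n)%N ->
     `|x n.+1| <= `|x n| * (1 - kap / n.+1%:R) + C * (inv_pow e n / n%:R)) ->
  exists e' K, [/\ 0 < e' <= 1, 0 <= K & forall n, (N <= n)%N -> `|x n| <= K * inv_pow e' n].
Proof.
move=> e0 /andP[k0 k1] C0 N0 dx.
pose e' := Num.min e (kap / 4).
have e'0 : 0 < e' by rewrite lt_min e0/=; lra.
have e'1 : e' <= kap / 4 by rewrite ge_min lexx orbT.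
have e'e : e' <= e by rewrite ge_min lexx.
pose K := `|x N| / inv_pow e' N + 4 * C / kap.
have rN := inv_pow_gt0 e' N0.
have K0 : 0 <= K by rewrite addr_ge0// divr_ge0 ?(ltW rN) ?(ltW k0)// mulr_ge0.
exists e', K; split => //; first by rewrite e'0/=; lra.
move=> n; elim: n => [|n IH].
  by rewrite leqn0 => /eqP N00; rewrite N00 in N0.
rewrite leq_eqVlt => /orP[/eqP NE|].
  rewrite -NE /K mulrDl divfK ?gt_eqF// lerDl mulr_ge0 ?inv_pow_ge0//.
  by rewrite divr_ge0 ?(ltW k0)// mulr_ge0.
rewrite ltnS => Nn; have n0 : (0 < n)%N by exact: leq_trans N0 Nn.
have {}IH := IH Nn; apply: (le_trans (dx n Nn)).
apply: (@le_trans _ _ (K * (inv_pow e' n * (1 - e' / n%:R)))); last first.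
  by rewrite ler_wpM2l// inv_pow_decay// ltW.
have nR : (1 : R) <= n%:R by rewrite ler1n.
have r0 := inv_pow_gt0 e' n0.
have i1 : n.+1%:R^-1 <= n%:R^-1 :> R by rewrite lef_pV2 ?posrE ?ltr0n// ler_nat.
have i2 : (2 * n%:R)^-1 <= n.+1%:R^-1 :> R.
  by rewrite lef_pV2 ?posrE ?ltr0n// -?natr1; lra.
have kk : 0 <= 1 - kap / n.+1%:R.
  rewrite subr_ge0 ler_pdivrMr ?ltr0n// mul1r; apply: (le_trans k1); by rewrite ler1n.
apply: (@le_trans _ _ (K * inv_pow e' n * (1 - kap / n.+1%:R) + C * (inv_pow e' n / n%:R))).
  apply: lerD; first by rewrite ler_wpM2r.
  rewrite ler_wpM2l// ler_pM2r ?invr_gt0 ?ltr0n// le_inv_pow//.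
have -> : K * inv_pow e' n * (1 - kap / n.+1%:R) + C * (inv_pow e' n / n%:R) =
  inv_pow e' n * (K * (1 - kap / n.+1%:R) + C / n%:R) by ring.
have -> : K * (inv_pow e' n * (1 - e' / n%:R)) = inv_pow e' n * (K * (1 - e' / n%:R)) by ring.
rewrite ler_pM2l//.
have CK : 4 * C / kap <= K by rewrite lerDr divr_ge0// ltW.
have {}CK : C <= K * (kap / 4).
  have -> : C = 4 * C / kap * (kap / 4) by field; rewrite gt_eqF.
  by rewrite ler_pM2r//; lra.
have i0 : 0 < n%:R^-1 :> R by rewrite invr_gt0 ltr0n.
rewrite invfM in i2.
move: (n%:R^-1) (n.+1%:R^-1) i0 i1 i2 => i i' i0 i1 i2.
have H1 : K * (e' * i) <= K * (kap / 4 * i) by rewrite ler_wpM2l// ler_pM2r.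
have H2 : C * i <= K * (kap / 4) * i by rewrite ler_pM2r.
have H3 : K * (kap * (2^-1 * i)) <= K * (kap * i') by rewrite ler_wpM2l// ler_pM2l.
lra.
Qed.

(** A sequence with increments of order 1 / n, multiplicatively perturbed by a
    summable amount, grows slower than any power. *)
Lemma slow_growth (g : nat -> R) e e' C N : 0 < e -> 0 < e' -> 0 <= C -> (0 < N)%N ->
  (forall n, (N <= n)%N -> 0 <= g n) ->
  (forall n, (N <= n)%N -> g n.+1 <= g n * (1 + C * (inv_pow e n / n%:R)) + C / n%:R) ->
  exists K N', [/\ 0 <= K, (N <= N')%N & forall n, (N' <= n)%N -> g n <= K * inv_pow (- e') n].
Proof.
move=> e0 e'0 C0 N0 g0 dg.
have : \forall n \near \oo, C * inv_pow e n <= e' / 4.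
  have /cvgrPdist_le H := inv_pow_cvg0 e0.
  have c0 : 0 < e' / 4 / (C + 1) by rewrite !divr_gt0//; lra.
  near=> n.
  have : `|0 - inv_pow e n| <= e' / 4 / (C + 1) by near: n; exact: H.
  rewrite sub0r normrN ger0_norm ?inv_pow_ge0// => H1.
  apply: (@le_trans _ _ ((C + 1) * inv_pow e n)).
    by rewrite ler_wpM2r ?inv_pow_ge0//; lra.
  by rewrite mulrC -ler_pdivlMr//; lra.
case=> N1 _ HN1; pose N' := maxn N N1.
have N'0 : (0 < N')%N by rewrite (leq_trans N0)// leq_maxl.
have rN := inv_pow_gt0 (- e') N'0.
pose K := g N' / inv_pow (- e') N' + 4 * C / e'.
have K0 : 0 <= K.
  by rewrite addr_ge0// divr_ge0 ?(ltW rN) ?(ltW e'0)// ?g0 ?leq_maxl// mulr_ge0.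
exists K, N'; split => //; first exact: leq_maxl.
elim=> [|n IH].
  by rewrite leqn0 => /eqP N00; rewrite N00 in N'0.
rewrite leq_eqVlt => /orP[/eqP NE|].
  rewrite -NE /K mulrDl divfK ?gt_eqF// lerDl mulr_ge0 ?inv_pow_ge0//.
  by rewrite divr_ge0 ?(ltW e'0)// mulr_ge0.
rewrite ltnS => Nn; have n0 : (0 < n)%N by exact: leq_trans N'0 Nn.
have {}IH := IH Nn.
have Nn0 : (N <= n)%N by apply: leq_trans Nn; exact: leq_maxl.
apply: (le_trans (dg n Nn0)).
have Hn : C * inv_pow e n <= e' / 4 by apply: HN1 => /=; apply: leq_trans Nn; exact: leq_maxr.
apply: (@le_trans _ _ (K * (inv_pow (- e') n * (1 + e' / (2 * n%:R))))); last first.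
  by rewrite ler_wpM2l// inv_pow_growth// ltW.
have nR : (1 : R) <= n%:R by rewrite ler1n.
have i0 : 0 < n%:R^-1 :> R by rewrite invr_gt0 ltr0n.
rewrite invfM.
have r1 : 1 <= inv_pow (- e') n.
  rewrite /inv_pow opprK -[leLHS](powRr0 n%:R); apply: ler_powR => //; exact: ltW.
have CK : 4 * C / e' <= K by rewrite lerDr divr_ge0 ?g0 ?leq_maxl// ltW.
have {}CK : C <= K * (e' / 4).
  have -> : C = 4 * C / e' * (e' / 4) by field; rewrite gt_eqF.
  by rewrite ler_pM2r//; lra.
move: (inv_pow (- e') n) (inv_pow e n) (n%:R^-1) r1 Hn IH i0 => r q i r1 Hn IH i0.
have H1 : g n * (1 + C * (q * i)) <= K * r * (1 + e' / 4 * i).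
  have gn := g0 n Nn0.
  apply: (@le_trans _ _ (g n * (1 + e' / 4 * i))).
    by rewrite ler_wpM2l// lerD2l mulrA ler_pM2r.
  by rewrite ler_wpM2r// addr_ge0// mulr_ge0 ?(ltW i0)//; lra.
have H2 : C * i <= K * (e' / 4) * (r * i).
  apply: (@le_trans _ _ (K * (e' / 4) * (1 * i))).
    by rewrite mul1r ler_pM2r.
  by rewrite ler_wpM2l ?mulr_ge0//; [lra|rewrite ler_pM2r].
lra.
Unshelve. all: by end_near. Qed.

(** The exponent 1/10 comes from 16 <= (4/3)^10. *)
Lemma block_rate u : (\forall j \near \oo, forall i, (i <= 16 ^ j.+2 - 16 ^ j.+1)%N ->
     `|u (16 ^ j.+1 + i)%N - u (16 ^ j.+1)%N| <= (3 / 4) ^+ j) ->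
  exists L K N, [/\ 0 <= K, (0 < N)%N & forall n, (N <= n)%N -> `|u n - L| <= K * inv_pow (1 / 10) n].
Proof.
case=> J _ HJ; pose v j := u (16 ^ j.+1)%N.
have [L HL] : exists L, forall j, (J <= j)%N -> `|v j - L| <= 4 * (3 / 4) ^+ j.
  apply: telescoping_limit => j Jj; first by rewrite mulr_ge0// exprn_ge0.
  have := HJ j Jj (16 ^ j.+2 - 16 ^ j.+1)%N (leqnn _); rewrite subnKC ?leq_pexp2l//.
  by rewrite exprS => H; apply: (le_trans H); lra.
exists L, (5 * (16 / 9)), (16 ^ J.+1)%N; split; [lra|by rewrite expn_gt0|].
move=> n Nn; have n0 : (0 < n)%N by apply: leq_trans Nn; rewrite expn_gt0.
have /andP[j1 j2] := trunc_log_bounds (isT : (1 < 16)%N) n0.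
have Jt : (J < trunc_log 16 n)%N.
  by rewrite -ltnS -(ltn_exp2l _ _ (isT : (1 < 16)%N)); exact: leq_ltn_trans Nn j2.
case: (trunc_log 16 n) Jt j1 j2 => // j; rewrite ltnS => Jj j1 j2.
have h1 := HL j Jj.
have h2 : `|u n - v j| <= (3 / 4) ^+ j.
  have := HJ j Jj (n - 16 ^ j.+1)%N; rewrite subnKC//; apply.
  by rewrite leq_sub2r// ltnW.
have h3 : `|u n - L| <= 5 * (3 / 4) ^+ j.
  have -> : u n - L = (u n - v j) + (v j - L) by ring.
  by apply: (le_trans (ler_normD _ _)); lra.
apply: (le_trans h3); rewrite -mulrA ler_pM2l//.
have h4 : n%:R `^ (1 / 10) <= (4 / 3) ^+ j.+2 :> R.
  apply: (@le_trans _ _ ((((4 / 3) ^+ j.+2) ^+ 10) `^ (1 / 10))).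
    apply: ge0_ler_powR; [by rewrite divr_ge0|by rewrite nnegrE|by rewrite nnegrE !exprn_ge0|].
    apply: (@le_trans _ _ ((16 ^ j.+2)%:R)); first by rewrite ler_nat ltnW.
    rewrite -exprM mulnC exprM natrX lerXn2r// ?nnegrE ?exprn_ge0//; lra.
  by rewrite -powR_mulrn ?exprn_ge0// -powRrM mul1r mulfV ?powRr1 ?exprn_ge0.
rewrite /inv_pow powRN.
have q0 : 0 < (4 / 3) ^+ j.+2 :> R by rewrite exprn_gt0.
apply: (@le_trans _ _ (16 / 9 * ((4 / 3) ^+ j.+2)^-1)); last first.
  by rewrite ler_pM2l// lef_pV2 ?posrE ?powR_gt0 ?ltr0n.
rewrite -exprVn invf_div !exprS; have : 0 <= (3 / 4) ^+ j :> R by rewrite exprn_ge0.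
lra.
Qed.

End PowerRates.

(** * Almost sure statements from bounds on events *)

Section AlmostSure.
Context d (T : measurableType d) (R : realType) (P : probability T R).
Local Notation pr := (pr P).

Lemma ae_pr0 (A : set T) (Q : T -> Prop) : measurable A -> pr A = 0 ->
  (forall w, ~ A w -> Q w) -> {ae P, forall w, Q w}.
Proof.
move=> mA A0 AQ; exists A; split => //; first by rewrite prK// A0.
by move=> w /= nQ; apply: contrapT => /AQ.
Qed.

(** Geometric form of the first Borel-Cantelli lemma. *)
Lemma borel_cantelli (F : nat -> set T) (C q : R) : (forall j, measurable (F j)) ->
  0 <= C -> 0 <= q < 1 -> (forall j, pr (F j) <= C * q ^+ j) ->
  {ae P, forall w, \forall j \near \oo, ~ F j w}.
Proof.
move=> mF C0 /andP[q0 q1] FC.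
apply: (@ae_pr0 (lim_sup_set F)).
- apply: bigcapT_measurable => n; apply: bigcup_measurable => j _; exact: mF.
- rewrite /pr lim_sup_set_cvg0//.
  apply: (@le_lt_trans _ _ (C / (1 - q))%:E); last exact: ltry.
  apply: lime_le; first by apply: is_cvg_nneseries => *; exact: measure_ge0.
  apply: nearW => n.
  apply: (@le_trans _ _ ((\sum_(0 <= i < n) C * q ^+ i)%:E)).
    rewrite -sumEFin; apply: lee_sum => i _.
    by have := FC i; rewrite -lee_fin -prK.
  rewrite lee_fin -mulr_sumr ler_wpM2l// -[leRHS]mul1r ler_pdivlMr ?subr_gt0//.
  elim: n => [|n IH]; first by rewrite big_geq// mul0r.
  suff : (\sum_(0 <= i < n) q ^+ i) * (1 - q) = 1 - q ^+ n.
    move=> E; rewrite big_nat_recr//= mulrDl E mulrBr mulr1.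
    have qn : 0 <= q ^+ n * q by rewrite mulr_ge0// exprn_ge0.
    by lra.
  elim: n {IH} => [|n IH]; first by rewrite big_geq// mul0r expr0 subrr.
  by rewrite big_nat_recr//= mulrDl IH exprS; ring.
- move=> w nF; apply: contrapT => H; apply: nF => n _.
  apply: contrapT => H'; apply: H; exists n => // j /= nj Fj.
  by apply: H'; exists j.
Qed.

(** Fatou's lemma for events. *)
Lemma pr_liminf_le (F : nat -> set T) (c : R) N0 : (forall n, measurable (F n)) ->
  (forall n, (N0 <= n)%N -> pr (F n) <= c) ->
  pr (\bigcup_N \bigcap_(n in [set n | (N <= n)%N]) F n) <= c.
Proof.
move=> mF Fc.
pose A N := \bigcap_(n in [set n | (N <= n)%N]) F n.
have mA N : measurable (A N).
  by apply: bigcap_measurable; [exists N => /=|move=> *; exact: mF].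
have mU : measurable (\bigcup_N A N) by apply: bigcupT_measurable.
have nd : nondecreasing_seq A.
  move=> m n mn; apply/subsetPset => w Am k /= nk; apply: Am => /=; exact: leq_trans nk.
have H := nondecreasing_cvg_mu (mu := P) mA mU nd.
rewrite -lee_fin -prK//.
have <- := cvg_lim (@ereal_hausdorff R) H.
apply: lime_le; first by apply/cvg_ex; exists (P (\bigcup_N A N)).
apply: nearW => n /=; rewrite prK// lee_fin.
apply: le_trans (Fc (maxn n N0) (leq_maxr _ _)); apply: le_pr => //.
by move=> w Aw; apply: Aw => /=; exact: leq_maxl.
Qed.

(** Continuity from above. *)
Lemma pr_decreasing_small (F : nat -> set T) (e : R) : (forall n, measurable (F n)) ->
  nonincreasing_seq F -> {ae P, forall w, exists n, ~ F n w} -> 0 < e ->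
  exists n, pr (F n) <= e.
Proof.
move=> mF ni aeF e0.
have mI : measurable (\bigcap_n F n) by apply: bigcapT_measurable.
have F0 : (P (F 0%N) < +oo)%E by rewrite prK// ltry.
have H : (P \o F) @ \oo --> P (\bigcap_n F n) by exact: nonincreasing_cvg_mu.
have I0 : P (\bigcap_n F n) = 0%E.
  case: aeF => B [mB B0 sB]; apply/eqP; rewrite eq_le measure_ge0 andbT -B0.
  apply: le_measure; rewrite ?inE//.
  by move=> w Fw; apply: sB => /= -[n]; apply; exact: Fw.
rewrite I0 in H.
have /fine_cvgP[_ /cvgrPdist_le/(_ e e0)[n _ /(_ n (leqnn n))]] := H.
rewrite /= sub0r normrN ger0_norm ?fine_ge0// => h; by exists n.
Qed.

End AlmostSure.

(** * The finite set of possible histories *)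

Section Words.
Context {R : realType}.
Implicit Types (h : seq R).

Fixpoint words n : seq (seq R) :=
  if n is n'.+1 then [seq x :: h | x <- [:: 1; 0; -1], h <- words n'] else [:: [::]].

Lemma mem_words n h : size h = n -> all ternary h -> h \in words n.
Proof.
elim: n h => [|n IH] [|x h] //= [sz] /andP[tx th].
have hw := IH h sz th; rewrite !mem_cat.
by case: (ternaryP tx) => ->; rewrite map_f ?orbT.
Qed.

End Words.

(** * Almost sure convergence of dominated martingales *)

Section Events.
Context d (T : measurableType d) (R : realType) (P : probability T R)
  (X : nat -> {RV P >-> R}) (U : 'I_2 -> nat -> {RV P >-> nat})
  (sigma : 'I_2 -> nat -> {RV P >-> R}).
Context (hX : two_channel_elephant (7 / 8) X U sigma).
Local Notation pr := (pr P).
Local Notation hist := (hist X).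

(** Validity is part of the event to make it a finite union of events fixing the
    history; this is what makes it measurable for an arbitrary predicate. *)
Definition event k (b : pred (seq R)) : set T :=
  [set w | valid (hist k.+2 w) && b (hist k.+2 w)].

Lemma pr_hist_in k (s : seq (seq R)) : uniq s ->
  measurable [set w | hist k.+2 w \in s] /\
  pr [set w | hist k.+2 w \in s] = \sum_(h <- s) history_mean k (fun h' => (h' == h)%:R).
Proof.
elim: s => [_|h s IH /= /andP[hs us]].
  by rewrite big_nil (_ : [set _ | _] = set0) ?pr0//; apply/seteqP; split.
have [mI E] := IH us.
have -> : [set w | hist k.+2 w \in h :: s] =
   [set w | hist k.+2 w = h] `|` [set w | hist k.+2 w \in s].
  apply/seteqP; split => w /=; rewrite inE.
    by case/orP=> [/eqP|]; [left|right].
  by case=> [->|->]; rewrite ?eqxx ?orbT.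
have mh := measurable_hist X k.+2 h.
split; first exact: measurableU.
rewrite prU// ?E ?big_cons ?(pr_hist hX)//.
by apply/seteqP; split => w //= [->]; rewrite (negbTE hs).
Qed.

Lemma event_law k b : measurable (event k b) /\ pr (event k b) = history_mean k (fun h => (b h)%:R).
Proof.
pose s := [seq h <- undup (words k.+2) | valid h && b h].
have us : uniq s by rewrite filter_uniq ?undup_uniq.
have -> : event k b = [set w | hist k.+2 w \in s].
  apply/seteqP; split => w /=; rewrite mem_filter; last by case/andP.
  move=> vb; rewrite (vb : valid (hist k.+2 w) && _) mem_undup (@mem_words _ k.+2)//.
    exact: (size_hist X k.+2 w).
  by case/andP: vb => /and3P[].
have [mI ->] := pr_hist_in k us; split => //.
rewrite -history_mean_sum; apply: eq_history_mean => h vh sz.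
rewrite (_ : \sum_(i <- s) (h == i)%:R = (h \in s)%:R).
  have hw : h \in words k.+2 by apply: mem_words => //; case/and3P: vh.
  by rewrite mem_filter vh mem_undup hw andbT.
elim: s us {mI} => [|g s IH /= /andP[gs us]]; first by rewrite big_nil.
rewrite big_cons IH// inE; case: eqP => [->|_]; last by rewrite add0r.
by rewrite (negbTE gs) addr0.
Qed.

Lemma measurable_event k b : measurable (event k b).
Proof. by have [] := event_law k b. Qed.

Lemma pr_event k b : pr (event k b) = history_mean k (fun h => (b h)%:R).
Proof. by have [] := event_law k b. Qed.

Lemma ae_valid : {ae P, forall w, forall k, valid (hist k.+2 w)}.
Proof.
apply/ae_foralln => k; apply: (@ae_pr0 _ _ _ _ (~` event k predT)).
- exact: measurableC (measurable_event _ _).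
- have := pr_split P measurableT (measurable_event k predT).
  by rewrite !setTI prT pr_event history_mean_cst => H; lra.
- by move=> w /= /contrapT; rewrite /event /= andbT.
Qed.

(** On the block from 16^j to 16^(j+1) the potential is of order 4^(-j), so an
    oscillation of (3/4)^j has probability of order (4/9)^j, which is summable. *)
Lemma dominated_rate Q Phi : dominated Q Phi ->
  {ae P, forall w, exists L K N, [/\ 0 <= K, (0 < N)%N &
    forall n, (N <= n)%N -> `|Q (hist n w) - L| <= K * inv_pow (1 / 10) n]}.
Proof.
move=> D.
pose m j := (16 ^ j.+2 - 16 ^ j.+1)%N.
pose k0 j := (16 ^ j.+1 - 2)%N.
have k0E j : (k0 j).+2 = (16 ^ j.+1)%N.
  by rewrite /k0 -addn2 subnK// (@leq_trans (16 ^ 1))// leq_pexp2l.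
pose t j : R := (3 / 4) ^+ j.
pose b j h' := hit (fun h'' => t j <= `|Q h'' - Q (drop (m j) h')|) (m j) h'.
pose F j := event (k0 j + m j) (b j).
have t0 j : 0 < t j by rewrite exprn_gt0.
have FC j : pr (F j) <= 6 * (4 / 9) ^+ j.
  rewrite /F pr_event history_meanD -[leRHS](history_mean_cst (k0 j)).
  apply: le_history_mean => h vh sz.
  rewrite k0E in sz.
  rewrite (@eq_steps_mean _ _ _ (fun h' => (hit (fun h'' => t j <= `|Q h'' - Q h|) (m j) h')%:R))//;
    last by move=> h' _ _ dr; rewrite /b dr.
  apply: (le_trans (maximal_inequality (Q h) (m j) D vh (t0 j))).
  rewrite subrr expr0n add0r ler_pdivrMr ?exprn_gt0//.
  have [_ _ /(_ h vh) P0 /(_ h vh)] := D; rewrite /len sz => P2.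
  have P3 : Phi h * 4 ^+ j.+1 <= 23.
    rewrite -ler_sqr ?nnegrE ?mulr_ge0 ?exprn_ge0//.
    rewrite exprMn -exprM mulnC exprM; apply: (@le_trans _ _ 512); last by lra.
    by apply: le_trans P2; rewrite natrX; rewrite (_ : 4 ^+ 2 = 16%:R :> R)//; ring.
  rewrite /t -!exprM mulnC exprM -mulrA -exprMn.
  rewrite (_ : 4 / 9 * (3 / 4) ^+ 2 = 4^-1 :> R); last by field.
  rewrite exprVn ler_pdivlMr ?exprn_gt0//; rewrite exprS in P3; lra.
have q01 : 0 <= (4 / 9 : R) < 1 by apply/andP; split; lra.
have BC := borel_cantelli (fun j => measurable_event _ _ : measurable (F j))
  (ler0n _ 6) q01 FC.
apply: filterS2 ae_valid BC => w vw BC.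
apply: (@block_rate _ (fun n => Q (hist n w))).
apply: filterS BC => j nF i im; apply: contrapT => /negP; rewrite -ltNge => lt.
apply: nF; suff bj : b j (hist (k0 j + m j).+2 w) by exact/andP.
rewrite /b; have -> : (k0 j + m j).+2 = (m j + 16 ^ j.+1)%N by rewrite -k0E !addnS addnC.
rewrite drop_hist; apply/hasP; exists (m j - i)%N.
  by rewrite mem_iota /= add0n ltnS leq_subr.
rewrite (_ : (m j + 16 ^ j.+1)%N = ((m j - i) + (16 ^ j.+1 + i))%N) ?drop_hist ?ltW//.
by rewrite addnCA addnC subnK// addnC.
Qed.

(** If the density tended to 0, it would be below c from some time on, an event of
    probability at most 3 c for every c. *)
Lemma ae_density_limsup : {ae P, forall w, exists2 e : R, 0 < e &
  forall N, exists2 n, (N <= n)%N & e <= density (hist n w)}.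
Proof.
pose c j : R := j.+1%:R^-1.
have c0 j : 0 < c j by rewrite invr_gt0.
pose A j := \bigcup_N \bigcap_(n in [set n | (N <= n)%N])
  event n (fun h => density h < c j).
have mA j : measurable (A j).
  apply: bigcupT_measurable => N; apply: bigcap_measurable; first by exists N => /=.
  by move=> n _; exact: measurable_event.
have pA j : pr (A j) <= 3 * c j.
  apply: (@pr_liminf_le _ _ _ _ _ _ 0) => [n|n _]; first exact: measurable_event.
  by rewrite pr_event small_density_mean.
have mI : measurable (\bigcap_j A j) by exact: bigcapT_measurable.
have : {ae P, forall w, ~ (\bigcap_j A j) w}.
  apply: (@ae_pr0 _ _ _ _ _ _ mI) => //.
  apply/le_anti; rewrite pr_ge0 andbT; apply/ler_addgt0Pr => e e0; rewrite add0r.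
  have [j _ /(_ j (leqnn _)) jP] : \forall j \near \oo, 3 / e <= j%:R.
    exact: nbhs_infty_ger.
  apply: (@le_trans _ _ (pr (A j))); first by apply: le_pr => // w; apply.
  apply: (le_trans (pA j)); rewrite /c ler_pdivrMr// mulrC -ler_pdivrMr//.
  by apply: (le_trans jP); rewrite ler_nat.
apply: filterS2 ae_valid => w vw nA.
have [j nAj] : exists j, ~ A j w.
  by apply: contrapT => H; apply: nA => j _; apply: contrapT => ?; apply: H; exists j.
exists (c j) => // N; apply: contrapT => H; apply: nAj; exists N => // n /= Nn.
apply/andP; split; first exact: vw.
rewrite ltNge; apply/negP => le; apply: H; exists n.+2 => //.
by rewrite (leq_trans Nn)// -addn2 leq_addr.
Qed.

End Events.

(** * The limit of the rescaled displacement does not vanish *)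

Section NonDegenerate.
Context d (T : measurableType d) (R : realType) (P : probability T R)
  (X : nat -> {RV P >-> R}) (U : 'I_2 -> nat -> {RV P >-> nat})
  (sigma : 'I_2 -> nat -> {RV P >-> R}).
Context (hX : two_channel_elephant (7 / 8) X U sigma).
Local Notation pr := (pr P).
Local Notation hist := (hist X).

(** The exponent is half of that of the rate of convergence: a limit equal to 0 makes
    the rescaled displacement eventually tiny, any other limit makes it
    eventually not tiny. *)
Definition tiny (h : seq R) : bool := `|rescaled h| <= inv_pow (1 / 20) (size h).

Lemma inv_pow_lt_eventually (K c : R) (e f : R) : 0 < e -> 0 < f -> 0 < c -> 0 <= K ->
  \forall n \near \oo, K * inv_pow (e + f) n < c * inv_pow e n.
Proof.
move=> e0 f0 c0 K0.
have /cvgrPdist_lt H := @inv_pow_cvg0 R _ f0.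
have cK : 0 < c / (K + 1) by rewrite divr_gt0//; lra.
near=> n; have n0 : (0 < n)%N by near: n; exists 1%N.
have : `|0 - inv_pow f n| < c / (K + 1) by near: n; exact: H.
rewrite sub0r normrN ger0_norm ?inv_pow_ge0// ltr_pdivlMr; last by lra.
have re := inv_pow_gt0 e n0; have rf := inv_pow_gt0 f n0.
move=> H1; rewrite inv_powD// mulrCA mulrC ltr_pM2r//.
apply: le_lt_trans H1; rewrite mulrC ler_wpM2l ?(ltW rf)//; lra.
Unshelve. all: by end_near. Qed.

Lemma ae_tiny_settles : {ae P, forall w,
  (\forall n \near \oo, tiny (hist n w)) \/ (\forall n \near \oo, ~~ tiny (hist n w))}.
Proof.
apply: filterS (dominated_rate hX (@rescaled_dominated R)) => w [L [K [N [K0 N0 HL]]]].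
have e20 : 0 < 1 / 20 :> R by lra.
have eE : 1 / 10 = 1 / 20 + 1 / 20 :> R by lra.
have [L0|L0] := eqVneq L 0; [left|right].
  have := inv_pow_lt_eventually e20 e20 (ltr01 : 0 < 1 :> R) K0.
  apply: filter_app; exists N => // n /= Nn lt.
  rewrite /tiny size_hist; have := HL n Nn; rewrite L0 subr0 eE.
  by move=> h; rewrite [X in _ < X]mul1r in lt; exact: le_trans h (ltW lt).
have := @inv_pow_cvg0 R _ e20 => /cvgrPdist_lt H.
have c0 : 0 < `|L| / (K + 1) by rewrite divr_gt0 ?normr_gt0//; lra.
have := H _ c0; apply: filter_app; exists N => // n /= Nn.
rewrite sub0r normrN ger0_norm ?inv_pow_ge0// ltr_pdivlMr; last by lra.
move=> lt; rewrite /tiny size_hist -ltNge.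
have n0 : (0 < n)%N by apply: leq_trans Nn.
have h := HL n Nn.
have r1 : inv_pow (1 / 10) n <= inv_pow (1 / 20) n :> R by apply: le_inv_pow => //; lra.
have h2 : `|L| <= `|rescaled (hist n w)| + `|rescaled (hist n w) - L|.
  rewrite -{1}(subKr (rescaled (hist n w)) L); exact: ler_normB.
have h3 := ler_wpM2l K0 r1; lra.
Qed.

Definition unsettled n := \bigcup_(i in [set i | (n <= i)%N])
  \bigcup_(j in [set j | (n <= j)%N]) (event X i tiny `&` ~` event X j tiny).

(** An event that almost surely holds either at all late times or at none changes
    between two late times with a small probability only. *)
Lemma pr_tiny_lost (e : R) : 0 < e ->
  exists n0, forall n m, (n0 <= n)%N -> (n0 <= m)%N ->
    pr (event X n tiny `&` ~` event X m tiny) <= e.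
Proof.
have mE n := measurable_event hX n tiny.
have mp i j : measurable (event X i tiny `&` ~` event X j tiny).
  by apply: measurableI => //; exact: measurableC.
have mS n : measurable (unsettled n).
  by apply: bigcup_measurable => i _; apply: bigcup_measurable => j _; exact: mp.
move=> e0; have [||n0 Hn0] := @pr_decreasing_small _ _ _ P unsettled e mS _ _ e0.
- move=> m n mn; apply/subsetPset => w [i /= ni [j /= nj Hp]].
  by exists i => /=; [exact: leq_trans mn ni|exists j => //=; exact: leq_trans mn nj].
- apply: filterS2 (ae_valid hX) ae_tiny_settles => w vw [] [N _ HN]; exists N;
    move=> [n /= Nn [m /= Nm [/andP[_ tn] ntm]]].
  + apply: ntm; apply/andP; split; first exact: vw.
    by apply: HN => /=; rewrite (leq_trans Nm)// -addn2 leq_addr.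
  + have := HN n.+2; rewrite /= tn; have -> : (N <= n.+2)%N; last by move=> /(_ isT).
    by rewrite (leq_trans Nn)// -addn2 leq_addr.
- exists n0 => n m nn nm; apply: le_trans Hn0; apply: le_pr => //.
  by move=> w Hw; exists n => //; exists m.
Qed.

Lemma potential_ge h : valid h -> 288 / (len h ^+ 3 * 4) <= potential h :> R.
Proof.
move=> vh; have L := valid_len vh; have g0 := gain_gt0 vh.
case/and3P: vh => sz al _; have [_ _ g2] := gain_bounds sz al.
have l2 : len h * (len h + 1) <= 2 * len h ^+ 2 by rewrite expr2; nra.
have G : gain h ^+ 2 * 36 <= 4 * len h ^+ 4.
  have -> : gain h ^+ 2 * 36 = (6 * gain h) ^+ 2 by ring.
  have -> : 4 * len h ^+ 4 = (2 * len h ^+ 2) ^+ 2 by ring.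
  by rewrite lerXn2r ?nnegrE//; [lra|rewrite mulr_ge0 ?sqr_ge0|lra].
rewrite /potential ler_pdivlMr ?exprn_gt0// mulrAC ler_pdivrMr; last first.
  by rewrite mulr_gt0 ?exprn_gt0//; lra.
have -> : 8 * len h * (len h ^+ 3 * 4) = 8 * (4 * len h ^+ 4) by ring.
lra.
Qed.

(** A tiny rescaled displacement at a late time is lost later on with a probability
    at least a constant times that of being tiny with density at least c, by
    anti-concentration.  Losing it is unlikely, and so is a density below c. *)
Lemma pr_tiny_small (e : R) : 0 < e -> exists n0, forall n, (n0 <= n)%N -> pr (event X n tiny) <= e.
Proof.
move=> e0; have [kap kap0 AC] := @anticoncentration R.
pose c := e / 6; have c0 : 0 < c by rewrite /c; lra.
pose ka := (kap * c) ^+ 2 / 64.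
have ka0 : 0 < ka by rewrite divr_gt0// exprn_gt0// mulr_gt0.
have e' : 0 < ka * (e / 2) by rewrite mulr_gt0//; lra.
have [n0 Hn0] := pr_tiny_lost e'.
exists n0 => n n0n.
(* lower bound, uniform over the histories of length n + 2, for the threshold of
   the anti-concentration estimate *)
pose et := kap * c / 4 * (288 / (n.+2%:R ^+ 3 * 4)) : R.
have et0 : 0 < et by rewrite /et !(mulr_gt0, divr_gt0, exprn_gt0).
have [N1 _ HN1] : \forall N \near \oo, inv_pow (1 / 20) N ^+ 2 < et.
  have e20 : 0 < 1 / 20 :> R by lra.
  have /cvgrPdist_lt H := @inv_pow_cvg0 R _ e20.
  have m0 : 0 < Num.min et 1 by rewrite lt_min et0 ltr01.
  have := H _ m0; apply: filterS => N; rewrite sub0r normrN ger0_norm ?inv_pow_ge0//.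
  rewrite lt_min => /andP[h1 h2]; apply: le_lt_trans h1.
  by rewrite expr2 -[leRHS]mulr1 ler_wpM2l ?inv_pow_ge0// ltW.
pose j := (n.+2 + N1)%N.
pose b1 h := (c <= density h) && tiny h.
have cond : ka * history_mean n (fun h => (b1 h)%:R) <=
    history_mean (n + j) (fun h' => (b1 (drop j h'))%:R
      * (kap * c / 4 * potential (drop j h') <= rescaled h' ^+ 2)%R%:R).
  rewrite history_meanD -history_mean_scale; apply: le_history_mean => h vh sz.
  rewrite (@eq_steps_mean _ _ _ (fun h' => (b1 h)%:R
      * (kap * c / 4 * potential h <= rescaled h' ^+ 2)%R%:R
      + 0 * 0))//; last by move=> h' _ _ ->; rewrite mulr0 addr0.
  rewrite (@steps_mean_linear _ _
    (fun h' => (kap * c / 4 * potential h <= rescaled h' ^+ 2)%R%:R) (fun=> 0))//.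
  rewrite mul0r addr0; case: (boolP (b1 h)) => [/andP[ca _]|_]; last by rewrite mul0r mulr0.
  by rewrite mul1r mulr1 /j -sz; exact: AC.
have lost : history_mean (n + j) (fun h' => (b1 (drop j h'))%:R *
    (kap * c / 4 * potential (drop j h') <= rescaled h' ^+ 2)%R%:R) <=
    pr (event X n tiny `&` ~` event X (n + j) tiny).
  pose b2 h' := b1 (drop j h') && (kap * c / 4 * potential (drop j h') <= rescaled h' ^+ 2).
  rewrite (@eq_history_mean _ _ _ (fun h' => (b2 h')%:R)) => [|h' _ _]; last first.
    by rewrite /b2; case: (b1 _); rewrite ?mul1r ?mul0r.
  rewrite -(pr_event hX).
  have nul : pr (~` event X n predT) = 0.
    have := pr_split P measurableT (measurable_event hX n predT).
    by rewrite !setTI prT (pr_event hX) history_mean_cst => H; lra.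
  have mV := measurable_event hX n predT.
  rewrite (pr_split P (measurable_event hX _ b2) mV).
  rewrite [X in _ + X](_ : _ = 0) ?addr0; last first.
    apply/le_anti; rewrite pr_ge0 andbT -nul; apply: le_pr.
    - by apply: measurableI; [exact: (measurable_event hX)|exact: measurableC].
    - exact: measurableC.
    - exact: subIsetr.
  apply: le_pr.
  - by apply: measurableI; exact: (measurable_event hX).
  - by apply: measurableI; [|apply: measurableC]; exact: (measurable_event hX).
  - move=> w [] /andP[v' /andP[]].
    have -> : (n + j).+2 = (j + n.+2)%N by rewrite !addnS addnC.
    rewrite drop_hist => /andP[_ tn] le /andP[vn _].
    split; first by apply/andP.
    move=> /andP[_]; rewrite /tiny size_hist (_ : (n + j).+2 = (j + n.+2)%N); last first.
      by rewrite !addnS addnC.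
    move=> tm.
    have : et <= rescaled (hist (j + n.+2) w) ^+ 2.
      apply: le_trans le; rewrite /et ler_pM2l ?divr_gt0 ?mulr_gt0//.
      by have := potential_ge vn; rewrite /len size_hist.
    apply/negP; rewrite -ltNge; apply: le_lt_trans (HN1 (j + n.+2)%N _).
      rewrite -(real_normK (num_real (rescaled _))) lerXn2r ?nnegrE ?inv_pow_ge0//.
    by rewrite /= /j -addnA addnCA leq_addr.
have b1le : history_mean n (fun h => (b1 h)%:R) <= e / 2.
  rewrite -(ler_pM2l ka0); apply: (le_trans cond); apply: (le_trans lost).
  by apply: Hn0 => //; rewrite (leq_trans n0n)// leq_addr.
rewrite (pr_event hX).
apply: (@le_trans _ _ (history_mean n (fun h => 1 * (b1 h)%:R + 1 * (density h < c)%R%:R))).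
  apply: le_history_mean => h _ _; rewrite /b1 !mul1r [c <= _]leNgt.
  by case: (density h < c); case: (tiny h); rewrite /= ?addr0 ?add0r ?lexx ?ler01.
rewrite history_mean_linear !mul1r.
have := small_density_mean n c0; rewrite /c; lra.
Qed.

Lemma ae_not_tiny : {ae P, forall w, forall N, exists2 n, (N <= n)%N & ~~ tiny (hist n w)}.
Proof.
pose A := \bigcup_N \bigcap_(n in [set n | (N <= n)%N]) event X n tiny.
have mE n := measurable_event hX n tiny.
have mA : measurable A.
  apply: bigcupT_measurable => N; apply: bigcap_measurable; first by exists N => /=.
  by move=> n _; exact: mE.
have A0 : pr A = 0.
  apply/le_anti; rewrite pr_ge0 andbT; apply/ler_addgt0Pr => e e0; rewrite add0r.
  have [n0 Hn0] := pr_tiny_small e0.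
  exact: (@pr_liminf_le _ _ _ _ _ _ n0).
have nA := ae_pr0 mA A0 (fun w H => H).
apply: filterS2 (ae_valid hX) nA => w vw nAw N.
apply: contrapT => H; apply: nAw; exists N => // n /= Nn.
apply/andP; split; first exact: vw.
apply/negPn/negP => nt; apply: H; exists n.+2 => //.
by rewrite (leq_trans Nn)// -addn2 leq_addr.
Qed.

Lemma ae_rescaled_limit : {ae P, forall w, exists M K N, [/\ M != 0, 0 <= K, (0 < N)%N &
    forall n, (N <= n)%N -> `|rescaled (hist n w) - M| <= K * inv_pow (1 / 10) n]}.
Proof.
apply: filterS2 (dominated_rate hX (@rescaled_dominated R)) ae_not_tiny => w.
move=> [L [K [N [K0 N0 HL]]]] nt; exists L, K, N; split => //.
apply/negP => /eqP L0.
have e20 : 0 < 1 / 20 :> R by lra.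
have eE : 1 / 10 = 1 / 20 + 1 / 20 :> R by lra.
have [N1 _ H1] := inv_pow_lt_eventually e20 e20 (ltr01 : 0 < 1 :> R) K0.
have [n nN /negP] := nt (maxn N N1); apply.
have h := HL n (leq_trans (leq_maxl _ _) nN).
have := H1 n (leq_trans (leq_maxr _ _) nN); rewrite [X in _ < X]mul1r -eE => h1.
rewrite /tiny size_hist; move: h; rewrite L0 subr0 => h.
by apply: (le_trans h); exact: ltW.
Qed.

End NonDegenerate.

(** * Attraction to the invariant parabola *)

Section Pathwise.
Context {R : realType}.
Implicit Types (h : seq R) (H : nat -> seq R) (x e K L : R) (n N : nat).

Definition trajectory H := (forall n, size (H n) = n) /\
  (forall n, (2 <= n)%N -> valid (H n) /\ exists2 x, ternary x & H n.+1 = x :: H n).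

Definition power_limit (u : nat -> R) L := exists K N,
  [/\ 0 <= K, (0 < N)%N & forall n, (N <= n)%N -> `|u n - L| <= K * inv_pow (1 / 10) n].

Lemma power_limit_small u L c : power_limit u L -> 0 < c ->
  \forall n \near \oo, `|u n - L| <= c.
Proof.
move=> [K [N [K0 N0 HL]]] c0.
have e0 : 0 < 1 / 10 :> R by lra.
have /cvgrPdist_lt/(_ (c / (K + 1))) := @inv_pow_cvg0 R _ e0.
have cK : 0 < c / (K + 1) by rewrite divr_gt0//; lra.
move=> /(_ cK); apply: filter_app; exists N => // n /= Nn.
rewrite sub0r normrN ger0_norm ?inv_pow_ge0// ltr_pdivlMr; last by lra.
move=> lt; apply: (le_trans (HL n Nn)).
have := inv_pow_ge0 (1 / 10 : R) n; lra.
Qed.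

(** Below 2/3 the drift of the density is nonnegative, and from above 2/3 one late
    step does not bring it near 1/3.  So after a late time at which the density is
    at least e, only the remaining noise can lower it below min (e, 1/3), and that
    noise is much smaller. *)
Lemma density_bounded_below H L : trajectory H ->
  power_limit (fun n => noise_sum noise_act (H n)) L ->
  (exists2 e : R, 0 < e & forall N, exists2 n, (N <= n)%N & e <= density (H n)) ->
  exists2 e : R, 0 < e & \forall n \near \oo, e <= density (H n).
Proof.
move=> [szH trH] plim [e e0 le].
pose e1 : R := Num.min e (1 / 3).
have e1e : e1 <= e by rewrite ge_min lexx.
have e13 : e1 <= 1 / 3 by rewrite ge_min lexx orbT.
have e10 : 0 < e1 by rewrite lt_min e0; lra.
have [N1 _ HN1] := power_limit_small plim (ltac:(lra) : 0 < e1 / 8).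
have [n0 n0N en0] := le (maxn N1 3).
pose q n := density (H n) - (noise_sum noise_act (H n) - L).
exists (3 / 4 * e1); first by lra.
have tail n : (n0 <= n)%N -> `|noise_sum noise_act (H n) - L| <= e1 / 8.
  move=> nn; apply: HN1 => /=; apply: leq_trans nn; apply: leq_trans n0N; exact: leq_maxl.
have inv n : (n0 <= n)%N -> 7 / 8 * e1 <= q n.
  elim: n => [|n IH].
    rewrite leqn0 => /eqP n00; move: n0N; rewrite n00 leqn0 => /eqP.
    by have := leq_maxr N1 3 => + E; rewrite E.
  rewrite leq_eqVlt => /orP[/eqP <-|].
    by have := tail n0 (leqnn _); rewrite ler_norml /q => /andP[]; lra.
  rewrite ltnS => nn; have {}IH := IH nn.
  have n3 : (3 <= n)%N by apply: leq_trans nn; apply: leq_trans n0N; exact: leq_maxr.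
  have [vh [x tx HE]] := trH n (ltnW n3).
  have L3 : 3 <= len (H n) by rewrite /len szH ler_nat.
  have [a0 a1 _ _] := density_bounds vh.
  have qE : q n.+1 = q n + (mean_step_sq (H n) - density (H n)) / (len (H n) + 1).
    by rewrite /q HE density_cons// noise_sum_cons// /noise_act; ring.
  have m2 : 2 * density (H n) - 3 / 2 * density (H n) ^+ 2 <= mean_step_sq (H n).
    by rewrite /mean_step_sq; have := sqr_ge0 (speed (H n)); lra.
  have i0 : 0 < (len (H n) + 1)^-1 by rewrite invr_gt0; lra.
  have i1 : (len (H n) + 1)^-1 <= 1 / 4 by rewrite -[leLHS]mul1r ler_pdivrMr; lra.
  rewrite qE; case: (lerP (density (H n)) (2 / 3)) => a23.
    have : 0 <= (mean_step_sq (H n) - density (H n)) / (len (H n) + 1); last by lra.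
    by apply: mulr_ge0; [|exact: ltW]; nra.
  have := tail n nn; rewrite ler_norml => /andP[t1 t2].
  have : - (1 / 8) <= (mean_step_sq (H n) - density (H n)) / (len (H n) + 1).
    have m3 : - (1 / 2) <= mean_step_sq (H n) - density (H n) by nra.
    have := ler_wpM2r (ltW i0) m3; lra.
  by rewrite /q; lra.
exists n0 => // n /= nn; have := inv n nn; have := tail n nn.
by rewrite ler_norml /q => /andP[]; lra.
Qed.

(** Signed distance to the invariant parabola. *)
Definition zeta h : R := density h - 2 / 3 - 9 / 32 * speed h ^+ 2.

Lemma zeta_cons x h : valid h -> zeta (x :: h) =
  zeta h * (1 - 3 / 2 * density h / (len h + 1)) + noise_z x h
  - 9 / 32 * ((x - speed h) / (len h + 1)) ^+ 2.
Proof.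
move=> vh; have L2 := valid_len vh.
rewrite /zeta density_cons// speed_cons// /noise_z /mean_step_sq /mean_step; field; lra.
Qed.

(** The coefficient of contraction is (3/2) a, which is bounded below; subtracting
    the remaining noise from zeta turns the recursion into a deterministic one. *)
Lemma zeta_rate H L e : trajectory H ->
  power_limit (fun n => noise_sum noise_z (H n)) L ->
  0 < e -> (\forall n \near \oo, e <= density (H n)) ->
  exists e' K N, [/\ 0 < e' <= 1 / 10, 0 <= K, (2 <= N)%N &
    forall n, (N <= n)%N -> `|zeta (H n)| <= K * inv_pow e' n].
Proof.
move=> [szH trH] [K [N [K0 N0 HL]]] e0 [N1 _ HN1].
pose N' := maxn (maxn N N1) 2.
have NN n : (N' <= n)%N -> [/\ (N <= n)%N, (N1 <= n)%N & (2 <= n)%N].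
  by rewrite /N' !geq_max => /andP[/andP[]].
pose y n := zeta (H n) - (noise_sum noise_z (H n) - L).
(* the contraction lemma asks for a coefficient at most 1 *)
pose kap := Num.min (3 / 2 * e) 1.
have kap0 : 0 < kap by rewrite lt_min ltr01 andbT mulr_gt0//; lra.
have kap1 : kap <= 1 by rewrite ge_min lexx orbT.
have e10 : 0 < 1 / 10 :> R by lra.
have C0 : 0 <= 3 / 2 * K + 9 / 8 by lra.
have N'0 : (0 < N')%N by rewrite /N' leq_max orbT.
have [||e' [K' [/andP[e'0 e'1] K'0 Hy]]] :=
    @contraction_rate _ y (1 / 10) kap (3 / 2 * K + 9 / 8) N' e10 _ C0 N'0.
- by rewrite kap0.
- move=> n nN; have [n1 n2 n3] := NN n nN.
  have [vh [x tx HE]] := trH n n3.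
  have L2 : 2 <= len (H n) by rewrite /len szH ler_nat.
  have [a0 a1 s1 s2] := density_bounds vh.
  have ae : e <= density (H n) by exact: HN1.
  have lE : n.+1%:R = len (H n) + 1 by rewrite /len szH natr1.
  have yE : y n.+1 = y n * (1 - 3 / 2 * density (H n) / (len (H n) + 1))
     - 3 / 2 * density (H n) / (len (H n) + 1) * (noise_sum noise_z (H n) - L)
     - 9 / 32 * ((x - speed (H n)) / (len (H n) + 1)) ^+ 2.
    by rewrite /y HE zeta_cons// noise_sum_cons//; ring.
  have i0 : 0 < (len (H n) + 1)^-1 by rewrite invr_gt0; lra.
  have i1 : (len (H n) + 1)^-1 <= 1 / 3 by rewrite -[leLHS]mul1r ler_pdivrMr; lra.
  have i2 : (len (H n) + 1)^-1 <= n%:R^-1.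
    by rewrite -lE lef_pV2 ?posrE ?ltr0n ?ler_nat// (leq_trans _ n3).
  have th0 : 0 <= 3 / 2 * density (H n) / (len (H n) + 1).
    by rewrite mulr_ge0 ?(ltW i0)//; lra.
  have th1 : 3 / 2 * density (H n) / (len (H n) + 1) <= 1.
    apply: (@le_trans _ _ (3 / 2 * (1 / 3))); last by lra.
    by apply: ler_pM; lra.
  have th2 : kap / n.+1%:R <= 3 / 2 * density (H n) / (len (H n) + 1).
    rewrite lE ler_pM2r//; apply: (@le_trans _ _ (3 / 2 * e)); last by lra.
    by rewrite ge_min lexx.
  have th3 : 3 / 2 * density (H n) / (len (H n) + 1) <= 3 / 2 * n%:R^-1.
    by apply: ler_pM; lra.
  have rn := inv_pow_ge0 (1 / 10 : R) n.
  have r1 : n%:R^-1 <= inv_pow (1 / 10) n :> R.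
    by rewrite -inv_pow1; apply: le_inv_pow; [lra|exact: leq_trans n3].
  have tl := HL n n1.
  have sq : ((x - speed (H n)) / (len (H n) + 1)) ^+ 2 <= 4 * (inv_pow (1 / 10) n / n%:R).
    rewrite expr_div_n; apply: ler_pM; rewrite ?sqr_ge0 ?invr_ge0 ?sqr_ge0//.
      by case: (ternaryP tx) => ->; nra.
    rewrite expr2 invfM; apply: ler_pM; rewrite ?(ltW i0)//.
    exact: le_trans i2 r1.
  move: yE th0 th1 th2 th3; set th := 3 / 2 * density (H n) / _ => yE th0 th1 th2 th3.
  rewrite yE; apply: (le_trans (ler_normB _ _)).
  rewrite [X in _ + X]ger0_norm; last by rewrite mulr_ge0 ?sqr_ge0.
  apply: (@le_trans _ _ ((`|y n| * (1 - kap / n.+1%:R) +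
     3 / 2 * n%:R^-1 * (K * inv_pow (1 / 10) n)) + 9 / 32 * (4 * (inv_pow (1 / 10) n / n%:R)))).
    apply: lerD; last by rewrite ler_pM2l.
    apply: (le_trans (ler_normB _ _)); apply: lerD.
      rewrite normrM [X in _ * X]ger0_norm ?subr_ge0//.
      by rewrite ler_wpM2l// lerD2l lerN2.
    by rewrite normrM ger0_norm//; apply: ler_pM.
  rewrite -addrA lerD2l; move: (n%:R^-1) (inv_pow (1 / 10) n) => i r; lra.
exists (Num.min e' (1 / 10)), (K' + K), N'; split.
- by rewrite lt_min e'0 e10/= ge_min lexx orbT.
- by rewrite addr_ge0.
- by rewrite leq_max leqnn orbT.
- move=> n nN; have [n1 n2 n3] := NN n nN.
  have n0 : (0 < n)%N by exact: leq_trans n3.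
  have -> : zeta (H n) = y n + (noise_sum noise_z (H n) - L) by rewrite /y; ring.
  apply: (le_trans (ler_normD _ _)); rewrite mulrDl; apply: lerD.
    apply: (le_trans (Hy n nN)); rewrite ler_wpM2l// le_inv_pow// ge_min lexx//.
  by apply: (le_trans (HL n n1)); rewrite ler_wpM2l// le_inv_pow// ge_min lexx orbT.
Qed.

Lemma inv_sq_expansion (t : R) : `|t| <= 1 / 4 -> `|(1 - t) ^- 2 - (1 + 2 * t)| <= 7 * t ^+ 2.
Proof.
rewrite ler_norml => /andP[t1 t2].
have t0 : 0 < (1 - t) ^+ 2 by rewrite exprn_gt0//; lra.
have -> : (1 - t) ^- 2 - (1 + 2 * t) = (3 - 2 * t) * t ^+ 2 / (1 - t) ^+ 2.
  by field; lra.
have tt := sqr_ge0 t.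
rewrite ger0_norm; last by rewrite divr_ge0 ?(ltW t0)// mulr_ge0//; lra.
by rewrite ler_pdivrMr//; nra.
Qed.

(** Equal to M^2 / s^2, with M the rescaled displacement, where s is not 0: as M
    converges, it grows like the inverse squared speed. *)
Definition inverse_gain_sq h : R := (len h / gain h) ^+ 2.

(** The gain is multiplied by (n + 1 - (3/4) (a - 2/3)) / n, which yields the factor
    1 + (3/2) (a - 2/3) / n to first order; then a - 2/3 = (9/32) s^2 + zeta and
    inverse_gain_sq times s^2 is M_n^2. *)
Lemma inverse_gain_sq_increment x h K e : valid h -> ternary x -> 0 <= e <= 1 ->
  `|zeta h| <= K * inv_pow e (size h) -> 0 <= K ->
  `|inverse_gain_sq (x :: h) - inverse_gain_sq h - 27 / 64 * rescaled h ^+ 2 / (len h + 1)| <=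
  inverse_gain_sq h * ((2 * K + 2) * (inv_pow e (size h) / len h)).
Proof.
move=> vh tx /andP[e0 e1] zK K0; have L2 := valid_len vh; have g0 := gain_gt0 vh.
have r1 := growth_gt1 vh; have [a0 a1 s1 s2] := density_bounds vh.
have szh : (0 < size h)%N by case/and3P: vh => /ltnW.
set t := 3 / 4 * (density h - 2 / 3) / (len h + 1).
have i0 : 0 < (len h + 1)^-1 by rewrite invr_gt0; lra.
have i1 : (len h + 1)^-1 <= 1 / 3 by rewrite -[leLHS]mul1r ler_pdivrMr; lra.
have i2 : (len h + 1)^-1 <= (len h)^-1 by rewrite lef_pV2 ?posrE; lra.
have j0 : 0 < (len h)^-1 by rewrite invr_gt0; lra.
have tb : `|t| <= 1 / 2 * (len h + 1)^-1.
  rewrite normrM [X in _ * X]ger0_norm ?(ltW i0)// ler_pM2r// ler_norml.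
  by apply/andP; split; lra.
have gE : inverse_gain_sq (x :: h) = inverse_gain_sq h * (1 - t) ^- 2.
  have tE : 1 - t = (len h + 3 / 4 * (2 - density h)) / (len h + 1) by rewrite /t; field; lra.
  rewrite tE /inverse_gain_sq len_cons gain_cons// /growth; field.
  by rewrite !gt_eqF//; lra.
have G0 : 0 <= inverse_gain_sq h by rewrite sqr_ge0.
have mE : inverse_gain_sq h * speed h ^+ 2 = rescaled h ^+ 2.
  by rewrite /inverse_gain_sq /speed /rescaled; field; apply/andP; split; lra.
have E : inverse_gain_sq (x :: h) - inverse_gain_sq h - 27 / 64 * rescaled h ^+ 2 / (len h + 1) =
  inverse_gain_sq h * ((1 - t) ^- 2 - (1 + 2 * t)) + inverse_gain_sq h * (3 / 2 * zeta h / (len h + 1)).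
  by rewrite gE -mE; move: ((1 - t) ^- 2) => q; rewrite /t /zeta; field; lra.
rewrite E -mulrDr normrM ger0_norm// ler_wpM2l//.
apply: (le_trans (ler_normD _ _)).
have t14 : `|t| <= 1 / 4 by lra.
have h1 := inv_sq_expansion t14.
have rr : (len h)^-1 <= inv_pow e (size h).
  by rewrite /len -inv_pow1 le_inv_pow.
have h2 : 7 * t ^+ 2 <= 2 * (inv_pow e (size h) / len h).
  have q1 : t ^+ 2 <= 1 / 4 * ((len h)^-1 * (len h)^-1).
    rewrite -(real_normK (num_real t)) expr2.
    apply: (@le_trans _ _ ((1 / 2 * (len h)^-1) * (1 / 2 * (len h)^-1))).
      by apply: ler_pM => //; lra.
    by move: (len h)^-1 => i; lra.
  have q2 : (len h)^-1 * (len h)^-1 <= inv_pow e (size h) * (len h)^-1 by rewrite ler_pM2r.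
  have q3 : 0 <= inv_pow e (size h) * (len h)^-1 by rewrite mulr_ge0 ?inv_pow_ge0 ?(ltW j0).
  by move: (t ^+ 2) (inv_pow e (size h)) (len h)^-1 q1 q2 q3 => t2 r i q1 q2 q3; lra.
have h3 : `|3 / 2 * zeta h / (len h + 1)| <= 2 * K * (inv_pow e (size h) / len h).
  rewrite normrM [X in _ * X]ger0_norm ?(ltW i0)// normrM ger0_norm//.
  have q1 : `|zeta h| * (len h + 1)^-1 <= K * inv_pow e (size h) * (len h)^-1.
    by apply: ler_pM; rewrite ?(ltW i0).
  have q2 : 0 <= K * inv_pow e (size h) * (len h)^-1.
    by rewrite !mulr_ge0 ?inv_pow_ge0 ?(ltW j0).
  move: `|zeta h| (len h + 1)^-1 (inv_pow e (size h)) (len h)^-1 q1 q2 => z i' r i q1 q2; lra.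
move: h1 h2 h3; move: `|(1 - t) ^- 2 - (1 + 2 * t)| `|3 / 2 * zeta h / (len h + 1)|.
by move: (t ^+ 2) (inv_pow e (size h) / len h) => t2 r u v h1 h2 h3; lra.
Qed.

End Pathwise.

(** * Logarithmic growth of the inverse squared speed *)

Section Limits.
Context {R : realType}.
Implicit Types (H : nat -> seq R) (x e K L : R) (n N : nat).

Lemma cvg_of_rate (u : nat -> R) L K e N : 0 < e -> (0 < N)%N ->
  (forall n, (N <= n)%N -> `|u n - L| <= K * inv_pow e n) -> u @ \oo --> L.
Proof.
move=> e0 N0 HL; apply/cvgrPdist_le => /= c c0.
have K0 : 0 <= K.
  have := HL N (leqnn _) => h; have := le_trans (normr_ge0 _) h.
  by rewrite pmulr_lge0// inv_pow_gt0.
have /cvgrPdist_lt/(_ (c / (K + 1))) := @inv_pow_cvg0 R _ e0.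
have cK : 0 < c / (K + 1) by rewrite divr_gt0//; lra.
move=> /(_ cK); apply: filter_app; exists N => // n /= Nn.
rewrite sub0r normrN ger0_norm ?inv_pow_ge0// ltr_pdivlMr; last by lra.
move=> lt; rewrite distrC; apply: (le_trans (HL n Nn)).
have := inv_pow_ge0 e n; lra.
Qed.

Lemma cvg_eventually_eq (u v : nat -> R) L : (\forall n \near \oo, u n = v n) ->
  v @ \oo --> L -> u @ \oo --> L.
Proof.
move=> uv; apply: cvg_trans; apply: near_eq_cvg.
by apply: filterS uv => n ->.
Qed.

(** The a priori bound n^(e/2) on the inverse squared gain g makes the errors
    summable in the recursion of g; hence g - (27/64) M^2 log n converges, and
    division by M_n^2, which converges to M^2 at a power rate, gives the claim. *)
Lemma inverse_square_limit H M K e N : trajectory H ->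
  power_limit (fun n => rescaled (H n)) M -> M != 0 ->
  0 < e <= 1 / 10 -> 0 <= K -> (2 <= N)%N ->
  (forall n, (N <= n)%N -> `|zeta (H n)| <= K * inv_pow e n) ->
  (exists Theta : R, (fun n => n%:R ^+ 2 / displ (H n) ^+ 2 - 27 / 64 * ln n%:R) @ \oo --> Theta)
  /\ \forall n \near \oo, Num.sg (displ (H n)) = Num.sg M.
Proof.
move=> [szH trH] plim M0 /andP[e0 e1] K0 N2 Hz.
have [Km [Nm [Km0 Nm0 Hm]]] := plim.
have lenH n : len (H n) = n%:R by rewrite /len szH.
pose N1 := maxn N Nm.
have NN n : (N1 <= n)%N -> [/\ (N <= n)%N, (Nm <= n)%N & (2 <= n)%N].
  by rewrite /N1 geq_max => /andP[h1 h2]; split => //; exact: leq_trans h1.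
have N10 : (0 < N1)%N by rewrite leq_max Nm0 orbT.
pose mu n := rescaled (H n); pose g n := inverse_gain_sq (H n).
pose B := (`|M| + Km) ^+ 2.
have B0 : 0 <= B by exact: sqr_ge0.
have muM n : (N1 <= n)%N -> `|mu n| <= `|M| + Km.
  move=> nN; have [_ n2 n3] := NN n nN.
  have -> : mu n = M + (mu n - M) by ring.
  apply: (le_trans (ler_normD _ _)); rewrite lerD2l; apply: (le_trans (Hm n n2)).
  rewrite -[leRHS]mulr1 ler_wpM2l// inv_pow_le1//; try lra; exact: leq_trans n3.
have mu2 n : (N1 <= n)%N -> mu n ^+ 2 <= B.
  move=> nN; rewrite /B -(real_normK (num_real (mu n))) lerXn2r ?nnegrE ?muM//.
  by rewrite addr_ge0.
pose K4 := Km * (2 * `|M| + Km).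
have K40 : 0 <= K4 by rewrite mulr_ge0// addr_ge0// mulr_ge0.
have mu2M n : (N1 <= n)%N -> `|mu n ^+ 2 - M ^+ 2| <= K4 * inv_pow (1 / 10) n.
  move=> nN; have [_ n2 _] := NN n nN.
  have -> : mu n ^+ 2 - M ^+ 2 = (mu n - M) * (mu n + M) by ring.
  rewrite normrM /K4 mulrAC; apply: ler_pM => //; first exact: Hm.
  apply: (le_trans (ler_normD _ _)); have := muM n nN; lra.
have g0 n : 0 <= g n by exact: sqr_ge0.
have dg n : (N1 <= n)%N ->
    `|g n.+1 - g n - 27 / 64 * mu n ^+ 2 / n.+1%:R| <= g n * ((2 * K + 2) * (inv_pow e n / n%:R)).
  move=> nN; have [n1 n2 n3] := NN n nN.
  have [vh [x tx HE]] := trH n n3.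
  have e01 : 0 <= e <= 1 by apply/andP; split; lra.
  have := @inverse_gain_sq_increment _ x (H n) K e vh tx e01.
  rewrite szH lenH natr1 => inc; rewrite /g HE; apply: inc => //; exact: Hz.
have iS n : (N1 <= n)%N -> n.+1%:R^-1 <= n%:R^-1 :> R.
  move=> nN; have [_ _ n3] := NN n nN.
  by rewrite lef_pV2 ?posrE ?ltr0n ?ler_nat// (leq_trans _ n3).
pose C := (2 * K + 2) + B.
have C0 : 0 <= C by rewrite addr_ge0//; lra.
pose e2 := e / 2; have e20 : 0 < e2 by rewrite /e2; lra.
have dg' n : (N1 <= n)%N -> g n.+1 <= g n * (1 + C * (inv_pow e n / n%:R)) + C / n%:R.
  move=> nN; have := dg n nN; rewrite ler_norml => /andP[_ h1].
  have h2 := mu2 n nN; have h3 := iS n nN; have h4 := sqr_ge0 (mu n).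
  have i0 : 0 <= n.+1%:R^-1 :> R by rewrite invr_ge0.
  have h5 : mu n ^+ 2 * n.+1%:R^-1 <= B * n%:R^-1 by apply: ler_pM.
  have r0 : 0 <= inv_pow e n / n%:R by rewrite mulr_ge0 ?inv_pow_ge0 ?invr_ge0.
  have h6 : 0 <= g n * (B * (inv_pow e n / n%:R)) by rewrite mulr_ge0// mulr_ge0.
  have h7 : 0 <= (2 * K + 2) * n%:R^-1 by rewrite mulr_ge0 ?invr_ge0//; lra.
  have h8 : 0 <= B * n%:R^-1 by rewrite mulr_ge0 ?invr_ge0.
  rewrite /C; move: (inv_pow e n / n%:R) (n.+1%:R^-1) (n%:R^-1) h1 h5 h6 h7 h8 => r i' i h1 h5 h6 h7 h8.
  by move: (g n.+1) (g n) (mu n ^+ 2) h1 h5 h6 => gs gn m h1 h5 h6; lra.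
have [K3 [N3 [K30 N13 Hg]]] := slow_growth e0 e20 C0 N10 (fun n _ => g0 n) dg'.
pose x n := g n - 27 / 64 * M ^+ 2 * ln n%:R.
pose C5 := K3 * (2 * K + 2) + K4 + M ^+ 2.
have C50 : 0 <= C5.
  by rewrite !addr_ge0// ?sqr_ge0// mulr_ge0//; lra.
have e21 : 0 < e2 <= 1 by rewrite e20 /e2/=; lra.
have N30 : (0 < N3)%N by exact: leq_trans N13.
have dx n : (N3 <= n)%N -> `|x n.+1 - x n| <= C5 * (inv_pow e2 n / n%:R).
  move=> nN3; have nN := leq_trans N13 nN3; have [n1 n2 n3] := NN n nN.
  have n0 : (0 < n)%N by exact: leq_trans n3.
  pose u := g n.+1 - g n - 27 / 64 * mu n ^+ 2 / n.+1%:R.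
  pose v := mu n ^+ 2 - M ^+ 2.
  pose l := n.+1%:R^-1 - (ln n.+1%:R - ln n%:R) : R.
  have -> : x n.+1 - x n = u + 27 / 64 * v / n.+1%:R + 27 / 64 * M ^+ 2 * l.
    by rewrite /x /u /v /l; ring.
  have i0 : 0 < n%:R^-1 :> R by rewrite invr_gt0 ltr0n.
  have r0 := inv_pow_gt0 e2 n0.
  have hu : `|u| <= K3 * (2 * K + 2) * (inv_pow e2 n / n%:R).
    apply: (le_trans (dg n nN)).
    have -> : inv_pow e2 n = inv_pow (- e2) n * inv_pow e n.
      by rewrite -inv_powD//; congr inv_pow; rewrite /e2; lra.
    have h := Hg n nN3; have re := inv_pow_ge0 e n.
    have q0 : 0 <= (2 * K + 2) * (inv_pow e n / n%:R).
      by rewrite mulr_ge0 ?mulr_ge0 ?(ltW i0)//; lra.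
    apply: (le_trans (ler_wpM2r q0 h)).
    by rewrite le_eqVlt; apply/orP; left; apply/eqP; ring.
  have hv : `|27 / 64 * v / n.+1%:R| <= K4 * (inv_pow e2 n / n%:R).
    rewrite normrM [X in _ * X]ger0_norm ?invr_ge0// normrM ger0_norm// mulrA.
    apply: ler_pM; rewrite ?mulr_ge0 ?invr_ge0 ?iS//.
    apply: (@le_trans _ _ (K4 * inv_pow (1 / 10) n)).
      by have := mu2M n nN; have := normr_ge0 v; rewrite -/v; lra.
    by rewrite ler_wpM2l// le_inv_pow// /e2; lra.
  have hl : `|l| <= inv_pow e2 n / n%:R.
    have [l1 l2] := @ln_succ_bounds R n n0.
    apply: (@le_trans _ _ (n%:R^-1 - n.+1%:R^-1)).
      by rewrite /l distrC ger0_norm; [rewrite lerB|rewrite subr_ge0].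
    have -> : n%:R^-1 - n.+1%:R^-1 = n.+1%:R^-1 / n%:R :> R.
      by rewrite -natr1; field; rewrite natr1 !pnatr_eq0 -lt0n n0.
    rewrite ler_pM2r//; apply: (le_trans (iS n nN)).
    by rewrite -inv_pow1 le_inv_pow//; case/andP: e21.
  apply: (le_trans (ler_normD _ _)); rewrite /C5 [leRHS]mulrDl; apply: lerD.
    apply: (le_trans (ler_normD _ _)); rewrite [leRHS]mulrDl; exact: lerD.
  rewrite normrM; apply: ler_pM => //.
  by rewrite ger0_norm; have := sqr_ge0 M; lra.
have [L' HL'] := power_rate_limit e21 C50 N30 dx.
have cx : x @ \oo --> L' := cvg_of_rate e20 N30 HL'.
have cmu : mu @ \oo --> M.
  by apply: cvg_of_rate Nm0 Hm; lra.
have cmu2 : (fun n => mu n ^+ 2) @ \oo --> M ^+ 2.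
  by rewrite expr2; under eq_fun do rewrite expr2; exact: cvgM.
have cln : (fun n => ln n%:R * (mu n ^+ 2 - M ^+ 2)) @ \oo --> 0.
  have e30 : 0 < 1 / 20 :> R by lra.
  apply: (@cvg_of_rate _ _ ((1 / 20)^-1 * K4) _ N1 e30 N10) => n nN.
  have [_ _ n3] := NN n nN; have n0 : (0 < n)%N by exact: leq_trans n3.
  rewrite subr0 normrM ger0_norm; last by rewrite ln_ge0// ler1n.
  have l1 := ln_le_inv_pow e30 n0.
  have -> : (1 / 20)^-1 * K4 * inv_pow (1 / 20) n =
      ((1 / 20)^-1 * inv_pow (- (1 / 20)) n) * (K4 * inv_pow (1 / 10) n).
    have -> : inv_pow (1 / 20) n = inv_pow (- (1 / 20)) n * inv_pow (1 / 10) n :> R.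
      by rewrite -inv_powD//; congr inv_pow; lra.
    ring.
  by apply: ler_pM => //; [rewrite ln_ge0// ler1n|exact: mu2M].
have M20 : M ^+ 2 != 0 by rewrite sqrf_eq0.
have sgnear : \forall n \near \oo, Num.sg (mu n) = Num.sg M.
  have M20' : 0 < `|M| / 2 by rewrite divr_gt0// normr_gt0.
  have := power_limit_small plim M20'; apply: filterS => n; rewrite -/(mu n).
  have [Mp|Mn|ME] := ltgtP 0 M; last by rewrite -ME eqxx in M0.
  - rewrite (gtr0_norm Mp) ler_norml => /andP[h1 h2].
    by rewrite !gtr0_sg//; lra.
  - rewrite (ltr0_norm Mn) ler_norml => /andP[h1 h2].
    by rewrite !ltr0_sg//; lra.
have gpos n : (N1 <= n)%N -> 0 < gain (H n).
  by move=> nN; have [_ _ n3] := NN n nN; have [vh _] := trH n n3; exact: gain_gt0.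
split; last first.
  apply: filter_app sgnear; exists N1 => // n /= nN <-.
  by rewrite /mu /rescaled sgrM sgrV (gtr0_sg (gpos n nN)) mulr1.
exists (L' * (M ^+ 2)^-1 - 27 / 64 * (0 * (M ^+ 2)^-1)).
have cv : (fun n => (mu n ^+ 2)^-1) @ \oo --> (M ^+ 2)^-1 by exact: cvgV.
pose v n := x n * (mu n ^+ 2)^-1
  - 27 / 64 * (ln n%:R * (mu n ^+ 2 - M ^+ 2) * (mu n ^+ 2)^-1).
have cvv : v @ \oo --> L' * (M ^+ 2)^-1 - 27 / 64 * (0 * (M ^+ 2)^-1).
  by apply: cvgB; [exact: cvgM|apply: cvgM; [exact: cvg_cst|exact: cvgM]].
apply: cvg_eventually_eq cvv.
apply: filter_app sgnear; exists N1 => // n /= nN sgE.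
have mun : mu n != 0 by rewrite -sgr_eq0 sgE sgr_eq0.
have gp := gpos n nN; have [_ _ n3] := NN n nN.
have posE : displ (H n) = mu n * gain (H n) by rewrite /mu /rescaled divfK// gt_eqF.
rewrite /v /x /g /inverse_gain_sq lenH posE; field.
by rewrite mun gt_eqF.
Qed.

End Limits.

(** * From the inverse squared speed to the expansions *)

Section Consequences.
Context {R : realType}.
Context (S A : nat -> R) (Th Xi : R).
Local Notation log n := (ln n%:R : R).
Context (Xi1 : Xi = 1 \/ Xi = -1).
Context (sgS : \forall n \near \oo, Num.sg (S n) = Xi).
Context (cvgS : (fun n => n%:R ^+ 2 / S n ^+ 2 - 27 / 64 * log n) @ \oo --> Th).
Context (cvgA : (fun n => (A n / n%:R - 2 / 3 - 9 / 32 * (S n / n%:R) ^+ 2) * log n ^+ 2)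
  @ \oo --> (0 : R)).

Let y n : R := n%:R ^+ 2 / S n ^+ 2.
Let z n : R := A n / n%:R - 2 / 3 - 9 / 32 * (S n / n%:R) ^+ 2.

Lemma ln_ge_near (c : R) : \forall n \near \oo, c <= log n.
Proof.
have [N _ HN] : \forall n \near \oo, expR c <= n%:R by exact: nbhs_infty_ger.
exists N => // n /= Nn; have h := HN n Nn.
rewrite -[leLHS]expRK ler_ln ?posrE ?expR_gt0//.
exact: lt_le_trans (expR_gt0 c) h.
Qed.

Lemma cvg_inv_ln : (fun n => (log n)^-1) @ \oo --> (0 : R).
Proof.
apply/cvgrPdist_le => /= e e0; apply: filterS (ln_ge_near e^-1) => n h.
have h0 : 0 < log n by apply: lt_le_trans h; rewrite invr_gt0.
rewrite sub0r normrN ger0_norm ?invr_ge0 ?(ltW h0)//.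
by rewrite -[leRHS]invrK lef_pV2 ?posrE// invr_gt0.
Qed.

Let ln_gt0_near : \forall n \near \oo, 0 < log n.
Proof. by apply: filterS (ln_ge_near 1) => n; lra. Qed.

Let S_neq0 : \forall n \near \oo, S n != 0.
Proof.
by apply: filterS sgS => n; rewrite -sgr_eq0 => ->; case: Xi1 => ->;
  rewrite ?oppr_eq0 oner_eq0.
Qed.

Let n_gt0 : \forall n \near \oo, (0 : R) < n%:R.
Proof. by exists 1%N => // n /= n0; rewrite ltr0n. Qed.

Let y_gt0 : \forall n \near \oo, 0 < y n.
Proof.
near=> n; have Sn : S n != 0 by near: n.
have nn : (0 : R) < n%:R by near: n.
by apply: divr_gt0; [exact: exprn_gt0|rewrite exprn_even_gt0].
Unshelve. all: by end_near. Qed.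

Let cvg_y_ln : (fun n => y n / log n) @ \oo --> (27 / 64 : R).
Proof.
pose v n := 27 / 64 + (y n - 27 / 64 * log n) * (log n)^-1.
have cv : v @ \oo --> 27 / 64 + Th * 0.
  by apply: cvgD; [exact: cvg_cst|apply: cvgM => //; exact: cvg_inv_ln].
rewrite mulr0 addr0 in cv; apply: cvg_eventually_eq cv.
apply: filterS ln_gt0_near => n l0; rewrite /v; field; lra.
Qed.

Let cvg_ln_y : (fun n => log n / y n) @ \oo --> (64 / 27 : R).
Proof.
have : (fun n => (y n / log n)^-1) @ \oo --> (27 / 64 : R)^-1.
  by apply: cvgV => //; lra.
rewrite invf_div => cv; apply: cvg_eventually_eq cv.
by apply: nearW => n; rewrite [RHS]invf_div.
Qed.

Let sS n : S n != 0 -> Num.sg (S n) = Xi -> S n / n%:R = Xi / Num.sqrt (y n).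
Proof.
move=> Sn sg; have -> : Num.sqrt (y n) = n%:R / `|S n|.
  by rewrite /y -expr_div_n sqrtr_sqr normrM normfV normr_nat.
by rewrite invf_div mulrA -sg -numEsg.
Qed.

Lemma speed_expansion : exists2 eps : nat -> R, eps @ \oo --> (0 : R) &
  \forall n \near \oo, S n / n%:R = Xi / Num.sqrt (27 / 64 * log n + Th + eps n).
Proof.
exists (fun n => y n - 27 / 64 * log n - Th).
  rewrite -[X in _ --> X](subrr Th); apply: cvgB => //; exact: cvg_cst.
near=> n.
have -> : 27 / 64 * log n + Th + (y n - 27 / 64 * log n - Th) = y n by ring.
by apply: sS; near: n.
Unshelve. all: by end_near. Qed.

Lemma speed_limit :
  (fun n => Num.sqrt (log n) * (S n / n%:R)) @ \oo --> 8 * Num.sqrt 3 / 9 * Xi.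
Proof.
have cv : (fun n => Num.sqrt (log n / y n)) @ \oo --> Num.sqrt (64 / 27 : R).
  by apply: (cvg_comp (fun n => log n / y n)); [exact: cvg_ln_y|exact: sqrt_continuous].
have sE : Num.sqrt (64 / 27) = 8 * Num.sqrt 3 / 9 :> R.
  have -> : 64 / 27 = (8 / 9) ^+ 2 * 3 :> R by field.
  rewrite sqrtrM ?sqr_ge0// sqrtr_sqr ger0_norm; [ring|lra].
rewrite sE in cv; apply: cvg_eventually_eq (cvgM cv (cvg_cst Xi)).
near=> n; have y0 : 0 < y n by near: n.
have l0 : 0 < log n by near: n.
rewrite sS; try by near: n.
by rewrite /= (sqrtrM (y n)^-1 (ltW l0)) (sqrtrV (ltW y0)); ring.
Unshelve. all: by end_near. Qed.

Let b n : R := A n / n%:R - 2 / 3.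

Let b_y : \forall n \near \oo, b n = 9 / 32 / y n + z n.
Proof.
near=> n; have Sn : S n != 0 by near: n.
have nn : (0 : R) < n%:R by near: n.
by rewrite /b /y /z expr_div_n; field; rewrite Sn gt_eqF.
Unshelve. all: by end_near. Qed.

Let cvg_z_ln : (fun n => z n * log n) @ \oo --> (0 : R).
Proof.
have := cvgM cvgA cvg_inv_ln; rewrite mulr0 => /(_ _) cv; apply: cvg_eventually_eq cv.
apply: filterS ln_gt0_near => n l0; rewrite /= -/(z n); field; lra.
Qed.

Let cvg_z_y : (fun n => z n * y n) @ \oo --> (0 : R).
Proof.
have := cvgM cvg_z_ln cvg_y_ln; rewrite mul0r => /(_ _) cv; apply: cvg_eventually_eq cv.
apply: filterS ln_gt0_near => n l0 /=; field; lra.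
Qed.

Let cvg_z_y2 : (fun n => z n * y n ^+ 2) @ \oo --> (0 : R).
Proof.
have cv : (fun n => z n * log n ^+ 2 * (y n / log n * (y n / log n))) @ \oo -->
    (0 * (27 / 64 * (27 / 64)) : R).
  by apply: cvgM => //; exact: cvgM.
rewrite mul0r in cv; apply: cvg_eventually_eq cv.
apply: filterS ln_gt0_near => n l0; rewrite /= -/(z n); field; lra.
Qed.

Lemma activity_limit : (fun n => log n * (A n / n%:R - 2 / 3)) @ \oo --> (2 / 3 : R).
Proof.
have cv : (fun n => 9 / 32 * (log n / y n) + z n * log n) @ \oo -->
    (9 / 32 * (64 / 27) + 0 : R).
  by apply: cvgD => //; apply: cvgM => //; exact: cvg_cst.
rewrite (_ : 9 / 32 * (64 / 27) + 0 = 2 / 3) in cv; last by field.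
apply: cvg_eventually_eq cv.
near=> n; rewrite -/(b n) (_ : b n = 9 / 32 / y n + z n); last by near: n.
rewrite /=; ring.
Unshelve. all: by end_near. Qed.

Let b_neq0 : \forall n \near \oo, b n != 0.
Proof.
have /cvgrPdist_lt/(_ (1 / 3) (ltac:(lra))) := activity_limit.
apply: filterS => n; rewrite -/(b n) => h; apply/negP => /eqP b0.
by move: h; rewrite b0 mulr0 subr0 ger0_norm; lra.
Qed.

Lemma activity_expansion : exists2 eps : nat -> R, eps @ \oo --> (0 : R) &
  \forall n \near \oo, A n / n%:R - 2 / 3 =
    2 / 3 * (1 / (log n + 64 / 27 * Th + eps n)).
Proof.
exists (fun n => 2 / 3 / b n - log n - 64 / 27 * Th); last first.
  apply: filterS b_neq0 => n b0; 
  have -> : log n + 64 / 27 * Th + (2 / 3 / b n - log n - 64 / 27 * Th) = 2 / 3 / b n by ring.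
  by rewrite -/(b n); field.
pose v n := 64 / 27 * (y n - 27 / 64 * log n)
  - 64 / 27 * (32 / 9 * (z n * y n ^+ 2)) * (1 + 32 / 9 * (z n * y n))^-1 - 64 / 27 * Th.
have c1 : (fun n => (1 + 32 / 9 * (z n * y n))) @ \oo --> (1 : R).
  rewrite -[X in _ --> X]addr0 -[X in _ --> _ + X](mulr0 (32 / 9)).
  by apply: cvgD; [exact: cvg_cst|apply: cvgM; [exact: cvg_cst|exact: cvg_z_y]].
have cv : v @ \oo --> 64 / 27 * Th - 64 / 27 * (32 / 9 * 0) * 1^-1 - 64 / 27 * Th.
  apply: cvgB; last exact: cvg_cst.
  apply: cvgB; first by apply: cvgM => //; exact: cvg_cst.
  apply: cvgM; last by apply: cvgV => //; exact: oner_neq0.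
  by apply: cvgM; [exact: cvg_cst|apply: cvgM; [exact: cvg_cst|exact: cvg_z_y2]].
rewrite mulr0 mulr0 mul0r subr0 subrr in cv; apply: cvg_eventually_eq cv.
near=> n.
have y0 : 0 < y n by near: n.
have b0 : b n != 0 by near: n.
have bE : b n = 9 / 32 / y n + z n by near: n.
have d0 : 1 + 32 / 9 * (z n * y n) != 0.
  apply: contra_neq b0 => d0; rewrite bE.
  have -> : 9 / 32 / y n + z n = 9 / 32 / y n * (1 + 32 / 9 * (z n * y n)).
    by field; rewrite gt_eqF.
  by rewrite d0 mulr0.
have b0' := b0; rewrite bE in b0'.
rewrite /v bE; field.
rewrite (gt_eqF y0) /=.
have e : 9 + 32 * (z n * y n) = 9 * (1 + 32 / 9 * (z n * y n)) by field.
rewrite e !mulf_neq0//; apply/eqP; lra.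
Unshelve. all: by end_near. Qed.

(** With y = n^2 / S_n^2, the main term of a - 2/3 is (9/32) / y, and
    (9/32) / y - (2/3) / log n = - (2/3) (y - (27/64) log n) / (y log n),
    where the second factor tends to [Th] and y / log n to 27/64. *)
Lemma activity_second_order :
  (fun n => (A n / n%:R - 2 / 3 - (2 / 3) / log n + 128 / 81 * Th / log n ^+ 2) * log n ^+ 2)
  @ \oo --> (0 : R).
Proof.
pose v n := - (2 / 3) * (log n / y n) * (y n - 27 / 64 * log n) + z n * log n ^+ 2
  + 128 / 81 * Th.
have cv : v @ \oo --> - (2 / 3) * (64 / 27) * Th + 0 + 128 / 81 * Th.
  apply: cvgD; last exact: cvg_cst.
  apply: cvgD => //; apply: cvgM => //.
  by apply: cvgM => //; exact: cvg_cst.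
rewrite (_ : _ + 0 + _ = 0) in cv; last by field.
apply: cvg_eventually_eq cv.
near=> n; have y0 : 0 < y n by near: n.
have l0 : 0 < log n by near: n.
rewrite -/(b n) (_ : b n = 9 / 32 / y n + z n); last by near: n.
by rewrite /v; field; rewrite !gt_eqF.
Unshelve. all: by end_near. Qed.

Lemma activity_littleo : forall n,
  A n = (2 * n%:R / 3 + 2 * n%:R / (3 * log n) - 128 * Th / 81 * (n%:R / log n ^+ 2))
        +o_(n \near \oo) (n%:R / log n ^+ 2).
Proof.
apply/funeqP/eqaddoP => e e0.
have /cvgrPdist_le/(_ e e0) := activity_second_order.
move=> h; near=> n.
have nn : (0 : R) < n%:R by near: n.
have l0 : 0 < log n by near: n.
have : `|0 - (A n / n%:R - 2 / 3 - (2 / 3) / log n + 128 / 81 * Th / log n ^+ 2) * log n ^+ 2|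
  <= e by near: n.
rewrite sub0r normrN => he.
have q0 : 0 < n%:R / log n ^+ 2 by rewrite divr_gt0// exprn_gt0.
rewrite [X in _ <= _ * X]ger0_norm ?(ltW q0)//.
apply: le_trans (ler_wpM2r (ltW q0) he).
rewrite -[X in _ <= _ * X](ger0_norm (ltW q0)) -normrM le_eqVlt; apply/orP; left; apply/eqP.
congr Num.norm; rewrite /=; rewrite !fctE; field.
by rewrite !gt_eqF.
Unshelve. all: by end_near. Qed.

End Consequences.

(** * The random sign and measurable limits *)

Section Assembly.
Context d (T : measurableType d) (R : realType) (P : probability T R).
Local Notation pr := (pr P).

Lemma exists_rv (f : T -> R) : measurable_fun setT f ->
  exists Y : {RV P >-> R}, forall w, Y w = f w.
Proof. by move=> mf; exists (mfun_Sub (mem_set mf)). Qed.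

(** The upper limit is measurable everywhere and equals the limit wherever the
    latter exists. *)
Lemma exists_limit_rv (u : nat -> T -> R) : (forall n, measurable_fun setT (u n)) ->
  exists Y : {RV P >-> R}, forall w (l : R), u ^~ w @ \oo --> l -> Y w = l.
Proof.
move=> mu.
have mf : measurable_fun setT (fun w => fine (limn_esup (fun n => (u n w)%:E))).
  have mE n : measurable_fun setT (EFin \o u n) by exact/measurable_EFinP.
  have ml := measurable_fun_limn_esup mE.
  exact: (measurableT_comp (fine_measurable measurableT) ml).
have [Y HY] := exists_rv mf; exists Y => w l ul; rewrite HY.
have ul' : (fun n => (u n w)%:E) @ \oo --> l%:E by apply: cvg_EFin => //; exact: nearW.
by rewrite is_cvg_limn_esupE ?(cvg_lim _ ul')//; apply/cvg_ex; exists l%:E.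
Qed.

Context (X : nat -> {RV P >-> R}) (U : 'I_2 -> nat -> {RV P >-> nat})
  (sigma : 'I_2 -> nat -> {RV P >-> R}).
Context (hX : two_channel_elephant (7 / 8) X U sigma).
Local Notation hist := (hist X).

Lemma displ_hist n w : displ (hist n w) = position X n w.
Proof.
elim: n => [|n IH]; first by rewrite /position big_geq// /displ big_nil.
by rewrite /= displ_cons IH /position [RHS]big_nat_recr//= addrC.
Qed.

Lemma activity_hist n w : all ternary (hist n w) -> activity (hist n w) = nonzero_steps X n w.
Proof.
elim: n => [_|n IH /= /andP[tx al]].
  by rewrite /nonzero_steps big_geq// /activity big_nil.
rewrite activity_cons IH// /nonzero_steps [RHS]big_nat_recr//= addrC; congr (_ + _).
rewrite indicE; case: (ternaryP tx) => xE; rewrite xE.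
- by rewrite expr1n mem_set//= xE; exact: oner_neq0.
- by rewrite expr0n /= memNset//= xE eqxx.
- by rewrite sqrrN expr1n mem_set//= xE oppr_eq0; exact: oner_neq0.
Qed.

Lemma hist_trajectory w : (forall k, valid (hist k.+2 w)) -> trajectory (hist ^~ w).
Proof.
move=> vw; split => [n|[|[|n]]// _]; first exact: size_hist.
split; first exact: vw.
by exists (X n.+3 w) => //; have /and3P[_ /= /andP[]] := vw n.+1.
Qed.

Lemma measurable_position n : measurable_fun setT (position X n).
Proof. by apply: measurable_sum => i. Qed.

Definition positive : set T :=
  \bigcup_N \bigcap_(n in [set n | (N <= n)%N]) event X n (fun h => 0 < displ h).
Definition negative : set T :=
  \bigcup_N \bigcap_(n in [set n | (N <= n)%N]) event X n (fun h => displ h < 0).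

Let measurable_liminf_event (b : pred (seq R)) :
  measurable (\bigcup_N \bigcap_(n in [set n | (N <= n)%N]) event X n b).
Proof.
apply: bigcupT_measurable => N; apply: bigcap_measurable; first by exists N => /=.
by move=> n _; exact: (measurable_event hX).
Qed.

Lemma measurable_positive : measurable positive.
Proof. exact: measurable_liminf_event. Qed.

Lemma disjoint_signs : positive `&` negative = set0.
Proof.
apply/seteqP; split => // w [[N _ HN] [N' _ HN']].
have /andP[_ h1] := HN (maxn N N') (leq_maxl _ _).
have /andP[_ h2] := HN' (maxn N N') (leq_maxr _ _).
by have := lt_trans h1 h2; rewrite ltxx.
Qed.

(** By symmetry a positive and a negative position are equally likely, and they
    exclude each other. *)
Lemma positive_mean_le_half k : history_mean k (fun h => (0 < displ h)%R%:R) <= 2^-1 :> R.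
Proof.
have : 1 * history_mean k (fun h => (0 < displ h)%R%:R)
    + 1 * history_mean k (fun h => (displ h < 0)%R%:R) <= 1 :> R.
  rewrite -history_mean_linear -[leRHS](history_mean_cst k).
  apply: le_history_mean => h _ _; rewrite !mul1r.
  by case: (ltgtP (displ h) 0) => _ /=; rewrite ?addr0 ?add0r ?ler01.
rewrite -positive_negative_mean => h; lra.
Qed.

Lemma final_sign w M : (forall k, valid (hist k.+2 w)) -> M != 0 ->
  (\forall n \near \oo, Num.sg (displ (hist n w)) = Num.sg M) ->
  (0 < M -> positive w) /\ (M < 0 -> negative w).
Proof.
move=> vw M0 [N _ HN]; split=> Ms; exists N => // n /= Nn; apply/andP; split; try exact: vw.
  by rewrite -sgr_gt0 HN ?sgr_gt0//= (leq_trans Nn)// -addn2 leq_addr.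
by rewrite -sgr_lt0 HN ?sgr_lt0//= (leq_trans Nn)// -addn2 leq_addr.
Qed.

(** Being finally positive and being finally negative both have probability at most
    1/2 by Fatou's lemma, and together they have probability 1. *)
Lemma pr_positive : {ae P, forall w, positive w \/ negative w} -> pr positive = 2^-1.
Proof.
move=> aepn.
have half (b : pred (seq R)) : (forall k, history_mean k (fun h => (b h)%:R) <= 2^-1 :> R) ->
    pr (\bigcup_N \bigcap_(n in [set n | (N <= n)%N]) event X n b) <= 2^-1.
  move=> hb; apply: (@pr_liminf_le _ _ _ _ _ _ 0) => [n|n _].
    exact: (measurable_event hX).
  by rewrite (pr_event hX).
have h1 : pr positive <= 2^-1 by apply: half => k; exact: positive_mean_le_half.
have h2 : pr negative <= 2^-1.
  by apply: half => k; rewrite -positive_negative_mean; exact: positive_mean_le_half.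
have mp : measurable positive by exact: measurable_liminf_event.
have mn : measurable negative by exact: measurable_liminf_event.
have : pr (positive `|` negative) = 1.
  have mU : measurable (positive `|` negative) by exact: measurableU.
  have := pr_split P measurableT mU; rewrite !setTI prT => ->.
  rewrite [X in _ + X](_ : _ = 0) ?addr0//.
  case: aepn => B [mB B0 sB]; apply/le_anti; rewrite pr_ge0 andbT.
  rewrite (_ : 0 = pr B); last by rewrite /pr B0.
  by apply: le_pr => //; exact: measurableC.
rewrite (prU P mp mn disjoint_signs); lra.
Qed.

End Assembly.

(** * The asymptotics of the walk *)

Section Main.
Context d (T : measurableType d) (R : realType) (P : probability T R)
  (X : nat -> {RV P >-> R}) (U : 'I_2 -> nat -> {RV P >-> nat})
  (sigma : 'I_2 -> nat -> {RV P >-> R}).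
Context (hX : two_channel_elephant (7 / 8) X U sigma).

(** A power of n beats the square of the logarithm. *)
Lemma zeta_ln_cvg (H : nat -> seq R) (e K : R) N : 0 < e -> (0 < N)%N ->
  (forall n, (N <= n)%N -> `|zeta (H n)| <= K * inv_pow e n) ->
  (fun n => zeta (H n) * ln n%:R ^+ 2) @ \oo --> (0 : R).
Proof.
move=> e0 N0 Hz; have e4 : 0 < e / 4 by lra.
have e2 : 0 < e / 2 by lra.
apply: (@cvg_of_rate _ _ _ (K * ((e / 4)^-1 ^+ 2)) _ N e2 N0) => n Nn.
have n0 : (0 < n)%N by exact: leq_trans Nn.
have l0 : 0 <= ln n%:R :> R by rewrite ln_ge0// ler1n.
rewrite subr0 normrM [X in _ * X]ger0_norm ?sqr_ge0//.
have -> : inv_pow (e / 2) n = inv_pow e n * (inv_pow (- (e / 4)) n) ^+ 2 :> R.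
  by rewrite expr2 -!inv_powD//; congr inv_pow; lra.
have -> : K * (e / 4)^-1 ^+ 2 * (inv_pow e n * inv_pow (- (e / 4)) n ^+ 2) =
  (K * inv_pow e n) * ((e / 4)^-1 * inv_pow (- (e / 4)) n) ^+ 2 by ring.
apply: ler_pM; rewrite ?sqr_ge0 ?Hz// lerXn2r ?nnegrE ?ln_le_inv_pow//.
by rewrite mulr_ge0 ?inv_pow_ge0// invr_ge0 ltW.
Qed.

Lemma ae_asymptotics : {ae P, forall w, exists M, [/\ forall k, valid (hist X k.+2 w),
  M != 0, (\forall n \near \oo, Num.sg (displ (hist X n w)) = Num.sg M),
  (exists Th : R, (fun n => n%:R ^+ 2 / displ (hist X n w) ^+ 2 - 27 / 64 * ln n%:R) @ \oo --> Th) &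
  (fun n => zeta (hist X n w) * ln n%:R ^+ 2) @ \oo --> (0 : R)]}.
Proof.
have aeM := ae_rescaled_limit hX; have aeV := ae_valid hX.
have aeA := dominated_rate hX (@noise_act_dominated R).
have aeZ := dominated_rate hX (@noise_z_dominated R).
have aeL := ae_density_limsup hX.
move: aeM; apply: filter_app; move: aeV; apply: filter_app.
move: aeA; apply: filter_app; move: aeZ; apply: filter_app.
apply: filterS aeL => w lw [LZ pZ] [LA pA] vw [M [Km [Nm [M0 Km0 Nm0 HM]]]].
exists M.
have tr := @hist_trajectory _ _ _ _ X w vw.
have plM : power_limit (fun n => rescaled (hist X n w)) M by exists Km, Nm.
have [e e0 He] := density_bounded_below tr pA lw.
have [e' [K [N [e'01 K0 N2 Hz]]]] := zeta_rate tr pZ e0 He.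
have [cTh sM] := inverse_square_limit tr plM M0 e'01 K0 N2 Hz.
have e'0 : 0 < e' by case/andP: e'01.
by split => //; apply: (@zeta_ln_cvg _ e' K N) => //; exact: ltnW.
Qed.

End Main.

Unset Implicit Arguments.

Theorem theorem1p4 (d : measure_display) (T : measurableType d) (R : realType)
    (P : probability T R) (X : nat -> {RV P >-> R})
    (U : 'I_2 -> nat -> {RV P >-> nat}) (sigma : 'I_2 -> nat -> {RV P >-> R})
    (hX : two_channel_elephant (7 / 8) X U sigma) :
  let S := position X in
  let A := nonzero_steps X in
  let log (n : nat) : R := ln n%:R in
  exists (Theta Xi : {RV P >-> R}),
    [/\ (forall w, Xi w = 1 \/ Xi w = -1) /\
        (P [set w | Xi w = 1] = (2^-1)%:E /\ P [set w | Xi w = -1] = (2^-1)%:E),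
        {ae P, forall w,
          (\forall n \near \oo, Num.sg (S n w) = Xi w) /\
          (n%:R ^+ 2 / S n w ^+ 2 - 27 / 64 * log n) @[n --> \oo] --> Theta w},
        {ae P, forall w,
          (exists2 eps : nat -> R, eps @ \oo --> 0 &
             \forall n \near \oo, S n w / n%:R =
               Xi w / Num.sqrt (27 / 64 * log n + Theta w + eps n)) /\
          (Num.sqrt (log n) * (S n w / n%:R)) @[n --> \oo]
             --> 8 * Num.sqrt 3 / 9 * Xi w},
        {ae P, forall w,
          (exists2 eps : nat -> R, eps @ \oo --> 0 &
             \forall n \near \oo, A n w / n%:R - 2 / 3 =
               2 / 3 * (1 / (log n + 64 / 27 * Theta w + eps n))) /\
          (log n * (A n w / n%:R - 2 / 3)) @[n --> \oo] --> (2 / 3 : R)} &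
        {ae P, forall w, forall n,
          A n w = (2 * n%:R / 3 + 2 * n%:R / (3 * log n)
                   - 128 * Theta w / 81 * (n%:R / log n ^+ 2))
                  +o_(n \near \oo) (n%:R / log n ^+ 2)}].
Proof.
move=> S A log.
have aeM := ae_asymptotics hX.
pose E : set T := positive X.
have mE : measurable E by exact: (measurable_positive hX).
pose u n w := n%:R ^+ 2 / S n w ^+ 2 - 27 / 64 * log n.
have mu n : measurable_fun setT (u n).
  apply: measurable_funB => //; apply: measurable_funM => //.
  apply: (eq_measurable_fun (fun w => powR (S n w ^+ 2) (-1))) => [w _|].
    by rewrite powR_inv1 ?sqr_ge0.
  apply: (measurableT_comp (measurable_powR (-1))).
  by apply: measurable_funX; exact: measurable_position.
have [Th HTh] := exists_limit_rv P mu.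
have mxi : measurable_fun setT (fun w => 2 * \1_E w - 1 : R).
  by apply: measurable_funB => //; apply: measurable_funM => //; exact: measurable_indic.
have [Xi HXi] := exists_rv P mxi.
have XiE w : E w -> Xi w = 1 by move=> Ew; rewrite HXi indicE mem_set// mulr1; lra.
have XiN w : ~ E w -> Xi w = -1 by move=> Ew; rewrite HXi indicE memNset// mulr0; lra.
have main_ae : {ae P, forall w, [/\
    (\forall n \near \oo, Num.sg (S n w) = Xi w),
    ((n%:R ^+ 2 / S n w ^+ 2 - 27 / 64 * log n) @[n --> \oo] --> Th w) &
    ((A n w / n%:R - 2 / 3 - 9 / 32 * (S n w / n%:R) ^+ 2) * log n ^+ 2) @[n --> \oo] --> (0 : R)]}.
  apply: filterS aeM => w [M [vw M0 sM [l cl] cz]].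
  have [posM negM] := final_sign vw M0 sM.
  have sXi : Num.sg M = Xi w.
    have [Mp|Mn|ME] := ltgtP 0 M; last by rewrite -ME eqxx in M0.
    - by rewrite gtr0_sg// XiE//; exact: posM.
    - rewrite ltr0_sg// XiN// => Ew.
      have : (positive X `&` negative X) w by split => //; exact: negM.
      by rewrite disjoint_signs.
  have SE n : S n w = displ (hist X n w) by rewrite displ_hist.
  split.
  - by apply: filterS sM => n; rewrite SE sXi.
  - have cu : u ^~ w @ \oo --> l.
      rewrite (_ : u ^~ w = fun n => n%:R ^+ 2 / displ (hist X n w) ^+ 2 - 27 / 64 * ln n%:R)//.
      by apply/funext => n; rewrite /u SE.
    by rewrite (HTh w l cu).
  - apply: cvg_eventually_eq cz; exists 2%N => // -[|[|n]]// _.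
    have al : all ternary (hist X n.+2 w) by have /and3P[] := vw n.
    by rewrite /zeta /density /speed /A -activity_hist// -SE /len size_hist.
have ae1 : {ae P, forall w, positive X w \/ negative X w}.
  apply: filterS aeM => w [M [vw M0 sM _ _]].
  have [posM negM] := final_sign vw M0 sM.
  by have [Mp|Mn|ME] := ltgtP 0 M; [left; exact: posM|right; exact: negM|rewrite -ME eqxx in M0].
have prE : pr P E = 2^-1 by exact: (pr_positive hX ae1).
have XiP w : Xi w = 1 \/ Xi w = -1.
  by have [Ew|Ew] := pselect (E w); [left; exact: XiE|right; exact: XiN].
exists Th, Xi; split.
- split=> //; split.
    rewrite (_ : [set w | Xi w = 1] = E) ?prK ?prE//.
    apply/seteqP; split => w /=; last exact: XiE.
    by move=> Xw; apply: contrapT => /XiN; rewrite Xw => h; lra.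
  rewrite (_ : [set w | Xi w = -1] = ~` E); last first.
    apply/seteqP; split => w /=; last exact: XiN.
    by move=> Xw /XiE; rewrite Xw => h; lra.
  rewrite prK; last exact: measurableC.
  have := pr_split P measurableT mE; rewrite !setTI prT prE => h.
  by congr EFin; lra.
- by apply: filterS main_ae => w [].
- apply: filterS main_ae => w [s c1 c2]; split.
    exact: (speed_expansion (XiP w) s c1).
  exact: (speed_limit (XiP w) s c1).
- apply: filterS main_ae => w [s c1 c2]; split.
    exact: (activity_expansion (XiP w) s c1 c2).
  exact: (activity_limit (XiP w) s c1 c2).
- apply: filterS main_ae => w [s c1 c2].
  exact: (activity_littleo (XiP w) s c1 c2).
Qed.
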